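(* Let $R$ and $S$ be FDZ-algebras. Then the following are equivalent. 1. $R\equiv S$ as arbitrary rings, i.e. $R$ and $S$ satisfy the same first-order sentences of the language $L$. 2. Either $M(R)=N(R)$ and $R\cong S$, or there exist a monomorphism of rings $\phi:R\to S$ and additions $R_0$ and $S_0$ of $R$ and $S$ respectively such that (a) $\phi$ induces an isomorphism $R/R_0\cong S/S_0$, (b) $\phi$ induces an isomorphism $\dfrac{M(R)}{N(R)}\cong\dfrac{M(S)}{N(S)}$, (c) $\phi$ restricts to a monomorphism from $R_0$ into $S_0$, where the index $[S_0:\phi(R_0)]$ is finite and prime to the index $[M(R):N(R)]\neq 1$.
   Context: A ring is an abelian group equipped with a $\mathbb{Z}$-bilinear binary operation (not necessarily associative, commutative or unital). An FDZ-algebra is a ring $R$ whose additive group $R^+$ is finitely generated as an abelian group. $L$ is the first-order language of pure rings, with signature $\langle+,\cdot,0\rangle$ (no constant for a multiplicative identity). For a ring $R$: $Ann(R)=\{x\in R: xy=yx=0\ \text{for all } y\in R\}$; $R^2$ is the ideal of $R$ generated by all products $xy$, $x,y\in R$. For an ideal $I$ of $R$, $Is(I)=\{x\in R: ax\in I\text{ for some }a\in\mathbb{Z}\setminus\{0\}\}$, which is an ideal. For an FDZ-algebra $R$, put $\Delta(R)=Is(R^2)\cap Ann(R)$. An addition $R_0$ of $R$ is a direct complement of $\Delta(R)$ in $Ann(R)$ (as abelian groups); such a complement exists because $Ann(R)/\Delta(R)$ is free abelian, and it is an ideal of $R$. Put $M(R)=Is(R^2+Ann(R))$ and $N(R)=Is(R^2)+Ann(R)$;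 then $M(R)/N(R)$ is a finite abelian group. *)

(* Defs.v *)
From HB Require Import structures.
From mathcomp Require Import all_boot all_algebra.
From mathcomp Require Import boolp classical_sets functions cardinality.

Set Implicit Arguments.
Unset Strict Implicit.
Unset Printing Implicit Defensive.

Import GRing.Theory.

Local Open Scope classical_set_scope.
Local Open Scope ring_scope.

(* MathComp's rings are associative and unital; here a ring is only an abelian
   group with a biadditive (equivalently, Z-bilinear) multiplication. *)
HB.mixin Record Zmodule_isNARing R of GRing.Zmodule R := {
  namul : R -> R -> R;
  namulDl : left_distributive namul +%R;
  namulDr : right_distributive namul +%R
}.

#[short(type="naRingType")]
HB.structure Definition NARing := { R of Zmodule_isNARing R & GRing.Zmodule R }.

Notation "x ** y" := (namul x y) (at level 40, left associativity) : ring_scope.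

Definition na_multiplicative (R S : naRingType) (phi : R -> S) : Prop :=
  {morph phi : x y / x ** y}.

Definition ring_monomorphism (R S : naRingType) (phi : {additive R -> S}) : Prop :=
  na_multiplicative phi /\ injective phi.

Definition ring_isomorphic (R S : naRingType) : Prop :=
  exists phi : {additive R -> S}, na_multiplicative phi /\ bijective phi.

Definition FDZ_algebra (R : naRingType) : Prop :=
  exists (n : nat) (g : 'I_n -> R),
    forall x : R, exists c : 'I_n -> int, x = \sum_(i < n) g i *~ c i.

(** First-order logic over the signature <+, *, 0> *)

Inductive rterm : Type :=
| TVar of nat
| TZero
| TAdd of rterm & rterm
| TMul of rterm & rterm.

Inductive rformula : Type :=
| FEq of rterm & rterm
| FNot of rformula
| FAnd of rformula & rformula
| FOr of rformula & rformula
| FImp of rformula & rformula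
| FForall of nat & rformula
| FExists of nat & rformula.

Fixpoint term_vars (t : rterm) : seq nat :=
  match t with
  | TVar i => [:: i]
  | TZero => [::]
  | TAdd t1 t2 | TMul t1 t2 => term_vars t1 ++ term_vars t2
  end.

Fixpoint free_vars (f : rformula) : seq nat :=
  match f with
  | FEq t1 t2 => term_vars t1 ++ term_vars t2
  | FNot f1 => free_vars f1
  | FAnd f1 f2 | FOr f1 f2 | FImp f1 f2 => free_vars f1 ++ free_vars f2
  | FForall i f1 | FExists i f1 => [seq j <- free_vars f1 | j != i]
  end.

Definition sentence (f : rformula) : Prop := free_vars f = [::].

Fixpoint term_eval (R : naRingType) (e : nat -> R) (t : rterm) : R :=
  match t with
  | TVar i => e i
  | TZero => 0
  | TAdd t1 t2 => term_eval e t1 + term_eval e t2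
  | TMul t1 t2 => term_eval e t1 ** term_eval e t2
  end.

Definition env_upd (R : naRingType) (e : nat -> R) (i : nat) (x : R) : nat -> R :=
  fun j => if j == i then x else e j.

Fixpoint holds (R : naRingType) (e : nat -> R) (f : rformula) : Prop :=
  match f with
  | FEq t1 t2 => term_eval e t1 = term_eval e t2
  | FNot f1 => ~ holds e f1
  | FAnd f1 f2 => holds e f1 /\ holds e f2
  | FOr f1 f2 => holds e f1 \/ holds e f2
  | FImp f1 f2 => holds e f1 -> holds e f2
  | FForall i f1 => forall x : R, holds (env_upd e i x) f1
  | FExists i f1 => exists x : R, holds (env_upd e i x) f1
  end.

Definition satisfies (R : naRingType) (f : rformula) : Prop :=
  forall e : nat -> R, holds e f.

Definition elem_equiv (R S : naRingType) : Prop :=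
  forall f : rformula, sentence f -> (satisfies R f <-> satisfies S f).

(** Subgroups, ideals and quotients *)

Definition is_subgroup (R : zmodType) (A : set R) : Prop :=
  A 0 /\ forall x y, A x -> A y -> A (x - y).

Definition set_sum (R : zmodType) (A B : set R) : set R :=
  [set x + y | x in A & y in B].

Definition is_ideal (R : naRingType) (I : set R) : Prop :=
  is_subgroup I /\ forall r x, I x -> I (r ** x) /\ I (x ** r).

Definition add_coset (R : zmodType) (B : set R) (x : R) : set R :=
  [set x + b | b in B].

Definition add_quotient (R : zmodType) (A B : set R) : set (set R) :=
  [set add_coset B x | x in A].

Definition has_index (R : zmodType) (A B : set R) (n : nat) : Prop :=
  (add_quotient A B #= `I_n)%card.

(* The rule x + B |-> phi x + D is a well-defined bijection from A / B onto
   C / D.  Since operations on cosets are computed on representatives, this map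
   is automatically a morphism of groups, and of rings when phi is
   multiplicative and B and D are ideals. *)
Definition induces_iso (R S : zmodType) (phi : R -> S)
    (A B : set R) (C D : set S) : Prop :=
  exists2 f : set R -> set S,
    forall x, A x -> f (add_coset B x) = add_coset D (phi x)
    & set_bij (add_quotient A B) (add_quotient C D) f.

Section Invariants.
Variable R : naRingType.

Definition Ann : set R := [set x | forall y : R, x ** y = 0 /\ y ** x = 0].

Definition Sq : set R := smallest (@is_ideal R) [set x ** y | x in setT & y in setT].

Definition Is (I : set R) : set R := [set x | exists2 a : int, a != 0 & I (x *~ a)].

Definition Delta : set R := Is Sq `&` Ann.

Definition MR : set R := Is (set_sum Sq Ann).

Definition NR : set R := set_sum (Is Sq) Ann.

Definition is_addition (R0 : set R) : Prop :=
  [/\ is_subgroup R0, set_sum R0 Delta = Ann & R0 `&` Delta = [set 0]].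

End Invariants.

Arguments Ann R _ : clear implicits.
Arguments Sq R _ : clear implicits.
Arguments Delta R _ : clear implicits.
Arguments MR R _ : clear implicits.
Arguments NR R _ : clear implicits.

(* Main.v *)
Require Import Defs.
From HB Require Import structures.
From mathcomp Require Import all_boot all_order all_algebra all_field.
From mathcomp Require Import boolp classical_sets functions cardinality.
From mathcomp Require Import zify ring.

(** The implication from the embedding to elementary equivalence rests on the
    freedom to change [phi] on [R0]. Let [m] be the index of [N(R)] in [M(R)]. As
    [R / M(R)] is free and [N(R)] is the direct sum of [R0] and of the isolator of
    the square, there is an additive projection [p] from [R] to [R0] that kills the
    products and multiplies [R0] by [m] ([addition_projection]). For every additive
    [beta] from [R0] to [S0], the map [phi + beta p] is again a morphism of rings; it
    agrees with [phi] modulo [S0] and with [phi + m beta] on [R0] ([twist]). The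
    index of [phi R0] in [S0] being prime to [m], the morphism can thus be made
    invertible on [R0] modulo any given [Q] ([approximate_iso]); if [m = 1] it can
    even be made an isomorphism. A morphism [theta] that is invertible modulo a
    sufficiently divisible [Q] gives a winning strategy in the Ehrenfeucht-Fraisse
    game of a given length: one maintains that [y - theta x] is highly divisible in
    [S0], and that the same short integral relations hold between the projections
    of the chosen elements to [R0] and to [S0] ([extend_sim]). The first condition
    makes [theta] compatible with products exactly, because [S0] annihilates [S];
    the second one decides the sums.

    For the converse it suffices to find, for every [n], a morphism [phi] whose
    image generates [S] both modulo [Ann S] and modulo [n S]
    ([almost_onto_morphism]). Indeed, for [n] divisible by a few exponents, the
    existence of such morphisms in both directions makes them injective
    ([endo_injective]), and then the annihilators, the squares and their isolators
    correspond to each other, while the preimage of an addition of [S] is an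
    addition of [R] ([almost_onto_conclusion]).

    Such a [phi] is given by the images [z] of finitely many generators of [R]. The
    relations of [R] and the generation modulo [n] are first-order conditions on
    [z]; the point is to express that [z] generates [S] modulo its annihilator
    although one cannot quantify over integers. Let [A] be the free abelian group
    obtained from [S] by dividing out the elements with a nonzero multiple in
    [Ann S]. The endomorphisms [g] of [A] such that for every [x] there is [y] with
    [g(a) x = a y] and [x g(a) = y a] can be coded by families of elements of [S].
    Those that commute with all of them form a definable group [G] of commuting
    integer matrices, which contains the integers. A common triangular form over
    the algebraic numbers shows that the nilpotent elements of [G] form a group,
    that long products of them vanish, and that modulo nilpotents only finitely
    many elements of [G] are roots of a given nonzero polynomial ([nil_mx_chi],
    [chi_roots]). Let [F] be an integral polynomial which kills a family of
    generators of the group [G] of [S]. The transferred sentence ([frame]) says that,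
    modulo nilpotents, the roots of [F] in [G] belong to a list [xs] of combinations
    of [z]; that the layers of the filtration of [A] by the number of nilpotents
    needed to kill an element are generated over [G] by combinations of [z]; and
    that the products of the former with the latter are given combinations of [z].
    In [S] the list [xs] generates [G] over the integers modulo nilpotents, because
    of the choice of [F], and so, layer by layer, the integral combinations of [z]
    exhaust [A] ([frame_spans]). *)

Set Implicit Arguments.
Unset Strict Implicit.
Unset Printing Implicit Defensive.

Import Order.TTheory GRing.Theory Num.Theory.

Local Open Scope classical_set_scope.
Local Open Scope ring_scope.

(** * Finitely generated abelian groups *)

Lemma subg0 (G : zmodType) (H : set G) : is_subgroup H -> H 0.
Proof. by case. Qed.

Lemma subgB (G : zmodType) (H : set G) x y :
  is_subgroup H -> H x -> H y -> H (x - y).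
Proof. by move=> [_]; apply. Qed.

Lemma subgN (G : zmodType) (H : set G) x : is_subgroup H -> H x -> H (- x).
Proof. by move=> sH Hx; rewrite -sub0r; apply: subgB => //; apply: subg0. Qed.

Lemma subgD (G : zmodType) (H : set G) x y :
  is_subgroup H -> H x -> H y -> H (x + y).
Proof.
by move=> sH Hx Hy; rewrite -[y]opprK; apply: subgB => //; apply: subgN.
Qed.

Lemma subgMn (G : zmodType) (H : set G) x n :
  is_subgroup H -> H x -> H (x *+ n).
Proof.
move=> sH Hx; elim: n => [|n IH]; first by rewrite mulr0n; apply: subg0.
by rewrite mulrS; apply: subgD.
Qed.

Lemma subgMz (G : zmodType) (H : set G) x (c : int) :
  is_subgroup H -> H x -> H (x *~ c).
Proof.
move=> sH Hx; case: c => n; first exact: subgMn.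
by rewrite NegzE mulrNz; apply: subgN => //; apply: subgMn.
Qed.

Lemma subg_sum (G : zmodType) (H : set G) (I : Type) (r : seq I) (P : pred I) F :
  is_subgroup H -> (forall i, P i -> H (F i)) -> H (\sum_(i <- r | P i) F i).
Proof.
move=> sH HF; apply: (big_ind H) => //; first exact: subg0.
by move=> x y; apply: subgD.
Qed.

Lemma subg_subr (G : zmodType) (H : set G) x y :
  is_subgroup H -> H x -> H (x - y) -> H y.
Proof. by move=> sH Hx Hxy; rewrite -[y](subKr x); apply: subgB. Qed.

Lemma subg_setT (G : zmodType) : is_subgroup [set: G].
Proof. by []. Qed.

Lemma subg_set0 (G : zmodType) : is_subgroup [set (0 : G)].
Proof. by split=> [|x y -> ->] //=; rewrite subrr. Qed.

Lemma subgI (G : zmodType) (H K : set G) :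
  is_subgroup H -> is_subgroup K -> is_subgroup (H `&` K).
Proof.
move=> sH sK; split; first by split; apply: subg0.
by move=> x y [Hx Kx] [Hy Ky]; split; apply: subgB.
Qed.

Lemma subg_set_sum (G : zmodType) (H K : set G) :
  is_subgroup H -> is_subgroup K -> is_subgroup (set_sum H K).
Proof.
move=> sH sK; split.
  by exists 0; [exact: subg0 | exists 0; [exact: subg0 | rewrite addr0]].
move=> _ _ [x Hx [y Ky <-]] [x' Hx' [y' Ky' <-]].
exists (x - x'); first exact: subgB.
by exists (y - y'); [exact: subgB | rewrite opprD addrACA].
Qed.

Lemma subg_image (G H : zmodType) (f : {additive G -> H}) (A : set G) :
  is_subgroup A -> is_subgroup (f @` A).
Proof.
move=> sA; split; first by exists 0; [exact: subg0 | rewrite raddf0].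
by move=> _ _ [x Ax <-] [y Ay <-]; exists (x - y); [exact: subgB | rewrite raddfB].
Qed.

Lemma subg_Is (R : naRingType) (H : set R) : is_subgroup H -> is_subgroup (Is H).
Proof.
move=> sH; split; first by exists 1 => //; rewrite mul0rz; apply: subg0.
move=> x y [a a0 Ha] [b b0 Hb]; exists (a * b); first by rewrite mulf_neq0.
rewrite mulrzBl mulrzA [a * b]mulrC mulrzA.
by apply: subgB => //; apply: subgMz.
Qed.

Lemma sub_Is (R : naRingType) (H : set R) : H `<=` Is H.
Proof. by move=> x Hx; exists 1. Qed.

Lemma Is_isolated (R : naRingType) (H : set R) x (c : int) :
  c != 0 -> Is H (x *~ c) -> Is H x.
Proof.
move=> c0 [a a0 Ha]; exists (c * a); first by rewrite mulf_neq0.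
by rewrite mulrzA.
Qed.

Fixpoint span (G : zmodType) (t : seq G) : set G :=
  if t is g :: t' then [set x | exists c : int, span t' (x - g *~ c)]
  else [set 0].

Lemma subg_span (G : zmodType) (t : seq G) : is_subgroup (span t).
Proof.
elim: t => [|g t IH]; first exact: subg_set0.
split=> [|x y [c Hc] [d Hd]].
  by exists 0; rewrite mulr0z subr0; apply: subg0.
exists (c - d).
have -> : x - y - g *~ (c - d) = (x - g *~ c) - (y - g *~ d).
  by rewrite mulrzBr !opprD !opprK addrACA.
exact: subgB.
Qed.

Lemma span_tail (G : zmodType) (g : G) t x : span t x -> span (g :: t) x.
Proof. by move=> tx; exists 0; rewrite mulr0z subr0. Qed.

Lemma mem_span (G : zmodType) (t : seq G) x : x \in t -> span t x.
Proof.
elim: t => // g t IH; rewrite inE => /orP[/eqP->|/IH]; last exact: span_tail.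
by exists 1; rewrite subrr; apply: subg0; apply: subg_span.
Qed.

Lemma span_min (G : zmodType) (t : seq G) (H : set G) :
  is_subgroup H -> (forall x, x \in t -> H x) -> span t `<=` H.
Proof.
move=> sH; elim: t => [|g t IH] tH x /=; first by move=> ->; apply: subg0.
move=> [c /IH Hc]; rewrite -[x](subrK (g *~ c)).
apply: subgD => //; first by apply: Hc => y yt; apply: tH; rewrite inE yt orbT.
by apply: subgMz => //; apply: tH; rewrite inE eqxx.
Qed.

Lemma spanP (G : zmodType) (t : seq G) x :
  span t x <-> exists c : 'I_(size t) -> int, x = \sum_(i < size t) t`_i *~ c i.
Proof.
split; last first.
  move=> [c ->]; apply: subg_sum => [|i _]; first exact: subg_span.
  by apply: subgMz; [exact: subg_span | apply/mem_span/mem_nth].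
elim: t x => [|g t IH] x /=.
  by move=> ->; exists (fun=> 0); rewrite big_ord0.
move=> [c /IH[d Hd]].
exists (fun i => if unlift ord0 i is Some j then d j else c).
rewrite big_ord_recl unlift_none /= -[x](subrK (g *~ c)) Hd addrC.
by congr (_ + _); apply: eq_bigr => i _; rewrite liftK.
Qed.

Lemma FDZ_span (R : naRingType) : FDZ_algebra R -> exists t : seq R, span t = setT.
Proof.
move=> [n [g Hg]]; exists (codom g); apply/seteqP; split=> // x _.
have [c ->] := Hg x; apply: subg_sum => [|i _]; first exact: subg_span.
by apply: subgMz; [exact: subg_span | apply/mem_span/codom_f].
Qed.

Lemma int_subgroup (H : set int) : is_subgroup H ->
  exists2 d : int, H d & forall c, H c -> exists q, c = d * q.
Proof.
move=> sH; have [[c [Hc c0]]|noc] := pselect (exists c, H c /\ c != 0); last first.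
  exists 0; first exact: subg0.
  move=> c Hc; exists 0; rewrite mulr0; apply/eqP; apply/negPn/negP => c0.
  by apply: noc; exists c.
have HM x (q : int) : H x -> H (x * q).
  by move=> Hx; have := subgMz q sH Hx; rewrite -mulrzr intz.
have exP : exists k : nat, `[< H k%:Z /\ (0 < k)%N >].
  exists `|c|%N; apply/asboolP; split; last by rewrite absz_gt0.
  by rewrite abszE; case: (ger0P c) => _ //; apply: subgN.
case: (ex_minnP exP) => k /asboolP[Hk k0] kmin.
exists k%:Z => // x Hx; exists (x %/ k%:Z)%Z.
have Hr : H (x %% k%:Z)%Z.
  have -> : (x %% k%:Z)%Z = x - k%:Z * (x %/ k%:Z)%Z.
    by rewrite {2}(divz_eq x k%:Z) [_ * k%:Z]mulrC addrC addKr.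
  by apply: subgB => //; apply: HM.
have k0' : k%:Z != 0 by rewrite -lt0n in k0 *.
have r0 := modz_ge0 x k0'.
have rk : (x %% k%:Z)%Z < k%:Z by apply: ltz_pmod; rewrite ltz_nat.
rewrite {1}(divz_eq x k%:Z) mulrC.
suff -> : (x %% k%:Z)%Z = 0 by rewrite addr0.
case: (x %% k%:Z)%Z Hr r0 rk => // [[|r]] // Hr _; rewrite ltz_nat => rk.
have /kmin : `[< H r.+1%:Z /\ (0 < r.+1)%N >] by apply/asboolP.
by rewrite leqNgt rk.
Qed.

(** The coefficients of the first generator in the elements of [H] form a
    subgroup of the integers; a lift to [H] of a generator of that subgroup
    completes a generating family of the part of [H] in the span of the other
    generators. *)
Lemma subgroup_fg (G : zmodType) (t : seq G) (H : set G) :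
  is_subgroup H -> H `<=` span t -> exists t', H = span t'.
Proof.
elim: t H => [|g t IH] H sH HT.
  exists [::]; apply/seteqP; split=> // x ->; exact: subg0.
have [|x [] //|t' Ht'] := IH (H `&` span t).
  by apply: subgI => //; apply: subg_span.
pose C : set int := [set c | exists2 y, span t y & H (g *~ c + y)].
have sC : is_subgroup C.
  split; first by exists 0; [apply: subg0; apply: subg_span
                            | rewrite mulr0z addr0; apply: subg0].
  move=> c d [y ty Hy] [y' ty' Hy'].
  exists (y - y'); first by apply: subgB => //; apply: subg_span.
  by rewrite mulrzBr addrACA -opprD; apply: subgB.
have [d [y ty Hy] dC] := int_subgroup sC.
exists (g *~ d + y :: t'); apply/seteqP; split=> x /=; last first.
  move=> [c]; rewrite -Ht' => -[Hx _].
  by rewrite -[x](subrK ((g *~ d + y) *~ c)); apply: subgD => //; apply: subgMz.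
move=> Hx; have [c Hc] := HT _ Hx.
have [|q Eq] := dC c.
  by exists (x - g *~ c) => //; rewrite addrC subrK.
exists q; rewrite -Ht'; split; first by apply: subgB => //; apply: subgMz.
rewrite mulrzDl opprD addrA -mulrzA -Eq; apply: subgB => //; first exact: subg_span.
by apply: subgMz => //; apply: subg_span.
Qed.

Lemma FDZ_subgroup_fg (R : naRingType) (H : set R) :
  FDZ_algebra R -> is_subgroup H -> exists t, H = span t.
Proof.
by move=> /FDZ_span[t tT] sH; apply: (subgroup_fg (t := t)) => //; rewrite tT.
Qed.

Lemma span_exponent (G : zmodType) (t : seq G) (H : set G) : is_subgroup H ->
  (forall x, x \in t -> exists2 a : int, a != 0 & H (x *~ a)) ->
  exists2 e : nat, (0 < e)%N & forall x, span t x -> H (x *+ e).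
Proof.
move=> sH; elim: t => [|g t IH] tH.
  by exists 1%N => // x ->; rewrite mul0rn; apply: subg0.
have [|e e0 He] := IH; first by move=> x xt; apply: tH; rewrite inE xt orbT.
have [|a a0 Ha] := tH g; first by rewrite inE eqxx.
exists (`|a| * e)%N; first by rewrite muln_gt0 absz_gt0 a0.
have Hg : H (g *+ `|a|).
  by case: a {a0} Ha => n //=; rewrite NegzE mulrNz => /(subgN sH); rewrite opprK.
move=> x [c /He Hc]; rewrite -[x](subrK (g *~ c)) mulrnDl; apply: subgD => //.
  by rewrite mulnC mulrnA; apply: subgMn.
have -> : g *~ c *+ (`|a| * e) = g *+ `|a| *~ c *+ e.
  by rewrite mulrnA !pmulrn; congr (_ *~ _); rewrite mulrzAC.
by apply: subgMn => //; apply: subgMz.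
Qed.

Lemma Is_exponent (R : naRingType) (H : set R) : FDZ_algebra R -> is_subgroup H ->
  exists2 e : nat, (0 < e)%N & forall x, Is H x -> H (x *+ e).
Proof.
move=> hR sH; have [t It] := FDZ_subgroup_fg hR (subg_Is sH).
have [|e e0 He] := @span_exponent _ t H sH.
  by move=> x xt; have : Is H x by rewrite It; apply: mem_span.
by exists e => // x; rewrite It; apply: He.
Qed.

Lemma mulrzn (G : zmodType) (x : G) (n : nat) (c : int) :
  x *+ n *~ c = x *~ c *+ n.
Proof. by rewrite -[x *+ n]/(x *~ n%:Z) mulrzAC. Qed.

Definition lc (G : zmodType) (d : nat) (b : 'I_d -> G) (c : 'I_d -> int) : G :=
  \sum_(i < d) b i *~ c i.

Lemma lcD (G : zmodType) d (b : 'I_d -> G) c c' :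
  lc b (fun i => c i + c' i) = lc b c + lc b c'.
Proof. by rewrite /lc -big_split; apply: eq_bigr => i _; rewrite mulrzDr. Qed.

Lemma lcB (G : zmodType) d (b : 'I_d -> G) c c' :
  lc b (fun i => c i - c' i) = lc b c - lc b c'.
Proof.
by rewrite /lc -sumrB; apply: eq_bigr => i _; rewrite mulrzBr.
Qed.

Lemma lcM (G : zmodType) d (b : 'I_d -> G) c (k : int) :
  lc b (fun i => c i * k) = lc b c *~ k.
Proof.
by rewrite /lc mulrz_suml; apply: eq_bigr => i _; rewrite mulrzA.
Qed.

Lemma lc_delta (G : zmodType) d (b : 'I_d -> G) i :
  lc b (fun j => (j == i)%:Z) = b i.
Proof.
rewrite /lc (bigD1 i) //= eqxx mulr1z big1 ?addr0 // => j /negPf->.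
by rewrite mulr0z.
Qed.

Lemma subg_lc (G : zmodType) (H : set G) d (b : 'I_d -> G) c :
  is_subgroup H -> (forall i, H (b i)) -> H (lc b c).
Proof. by move=> sH Hb; apply: subg_sum => // i _; apply: subgMz. Qed.

Definition basis_mod (G : zmodType) (K H : set G) d (b : 'I_d -> G) :=
  [/\ forall i, K (b i), forall x, K x -> exists c, H (x - lc b c)
    & forall c, H (lc b c) -> forall i, c i = 0].

(** The first generator [g] is handled by passing from [H] to its isolated
    closure with [g] in [K], which is cyclic modulo [H]: after multiplication by
    a common exponent it embeds into the multiples of [g], that is into the
    integers, whose subgroups are cyclic. *)
Lemma free_basis (G : zmodType) (T t : seq G) (K H : set G) :
  is_subgroup K -> K `<=` span T -> is_subgroup H -> H `<=` K ->
  (forall x, x \in t -> K x) -> (forall x, K x -> exists2 y, span t y & H (x - y)) ->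
  (forall x (c : int), K x -> c != 0 -> H (x *~ c) -> H x) ->
  exists d (b : 'I_d -> G), basis_mod K H b.
Proof.
move=> sK KT; elim: t H => [|g t IH] H sH HK tK Kt isoH.
  exists 0%N, (fun=> 0); split=> [[]//|x Kx|c _ []//].
  exists (fun=> 0); rewrite /lc big_ord0 subr0.
  by have [y -> ] := Kt x Kx; rewrite subr0.
have tK' : forall x, x \in t -> K x by move=> x xt; apply: tK; rewrite inE xt orbT.
have Kg : K g by apply: tK; rewrite inE eqxx.
have [Hg|nHg] := pselect (H g).
  apply: IH => // x /Kt[y [c yc] Hxy]; exists (y - g *~ c) => //.
  by rewrite opprB addrCA; apply: subgD => //; apply: subgMz.
pose H1 := set_sum H (span [:: g]).
have sH1 : is_subgroup H1 by apply: subg_set_sum => //; apply: subg_span.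
have H1P y : H1 y <-> exists a : int, H (y - g *~ a).
  split=> [[h Hh [z [a /= za] <-]]|[a Ha]].
    by exists a; rewrite (_ : z = g *~ a) ?addrK //; apply/eqP; rewrite -subr_eq0; apply/eqP.
  by exists (y - g *~ a) => //; exists (g *~ a); [exists a; rewrite /= subrr | rewrite subrK].
pose K1 : set G := [set x | K x /\ exists2 c : int, c != 0 & H1 (x *~ c)].
have HH1 y : H y -> H1 y by move=> Hy; apply/H1P; exists 0; rewrite mulr0z subr0.
have sK1 : is_subgroup K1.
  split; first by split; [exact: subg0 | exists 1 => //; rewrite mul0rz; apply: subg0].
  move=> x y [Kx [c c0 Hc]] [Ky [c' c0' Hc']]; split; first exact: subgB.
  exists (c * c'); first by rewrite mulf_neq0.
  rewrite mulrzBl; apply: subgB => //; first by rewrite mulrzA; apply: subgMz.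
  by rewrite mulrC mulrzA; apply: subgMz.
have HK1 : H `<=` K1 by move=> x Hx; split; [exact: HK | exists 1 => //; apply: HH1].
have K1g : K1 g.
  by split=> //; exists 1 => //; apply/H1P; exists 1; rewrite subrr; apply: subg0.
have [||||d [b [Kb bK b0]]] := IH K1 sK1.
- by move=> x [].
- by [].
- move=> x /Kt[y [c yc] Hxy]; exists (y - g *~ c) => //.
  rewrite opprB addrCA; apply: subgD => //; last exact: HK1.
  by apply: subgMz.
- move=> x c Kx c0 [_ [a a0 Ha]]; split=> //; exists (c * a); first by rewrite mulf_neq0.
  by rewrite mulrzA.
have [t1 K1t] : exists t1, K1 = span t1.
  by apply: (subgroup_fg (t := T)) => // x [Kx _]; apply: KT.
have [|e e0 He] := @span_exponent _ t1 H1 sH1.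
  by move=> x xt; have : K1 x; [rewrite K1t; apply: mem_span | case].
pose D : set int := [set a | exists2 x, K1 x & H (x *+ e - g *~ a)].
have sD : is_subgroup D.
  split; first by exists 0; [exact: subg0 | rewrite mul0rn mulr0z subr0; apply: subg0].
  move=> a a' [x Kx Hx] [x' Kx' Hx']; exists (x - x'); first exact: subgB.
  have -> : (x - x') *+ e - g *~ (a - a') = (x *+ e - g *~ a) - (x' *+ e - g *~ a').
    by rewrite mulrnBl mulrzBr !opprD !opprK addrACA.
  exact: subgB.
have [d0 [x0 Kx0 Hx0] dD] := int_subgroup sD.
have d00 : d0 != 0.
  apply/eqP => d00; have [|q] := dD e%:Z.
    by exists g => //; rewrite pmulrn subrr; apply: subg0.
  by rewrite d00 mul0r => /eqP; rewrite eqz_nat; case: (e) e0.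
have x0q c : H (x0 *~ c) -> c = 0.
  move=> Hc; apply/eqP/negPn/negP => c0; apply: nHg.
  apply: (isoH _ (d0 * c)) => //; first by rewrite mulf_neq0.
  rewrite mulrzA; have /(subgMz c sH) := Hx0.
  rewrite mulrzBl; apply: subg_subr => //.
  by rewrite mulrzn; apply: subgMn.
exists d.+1, (fun i => if unlift ord0 i is Some j then b j else x0).
have lcE c : lc (fun i => if unlift ord0 i is Some j then b j else x0) c
    = x0 *~ c ord0 + lc b (fun i => c (lift ord0 i)).
  rewrite /lc big_ord_recl unlift_none; congr (_ + _).
  by apply: eq_bigr => i _; rewrite liftK.
split.
- by move=> i; case: unliftP => [j _|_] //; case: Kx0.
- move=> x Kx; have [c K1c] := bK x Kx.
  have /He/H1P[a Ha] : span t1 (x - lc b c) by rewrite -K1t.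
  have [|q Eq] := dD a; first by exists (x - lc b c).
  exists (fun i => if unlift ord0 i is Some j then c j else q).
  rewrite lcE unlift_none (_ : (fun i => _) = c); last first.
    by apply/funext => i; rewrite liftK.
  rewrite opprD addrCA addrC.
  have [K1x _] : K1 (x - lc b c - x0 *~ q) by apply: subgB => //; apply: subgMz.
  apply: (isoH _ e%:Z) => //; first by rewrite eqz_nat; case: (e) e0.
  rewrite -pmulrn mulrnBl -mulrzn.
  have := subgB sH Ha (subgMz q sH Hx0).
  by rewrite Eq mulrzBl mulrzA opprB addrA subrK.
- move=> c; rewrite lcE => Hc.
  have c0 : forall i, c (lift ord0 i) = 0.
    apply: b0; apply: (subg_subr (x := - (x0 *~ c ord0))) => //.
      by apply: subgN => //; apply: subgMz.
    by rewrite -opprD; apply: subgN => //; apply: HK1.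
  move=> i; case: (unliftP ord0 i) => [j ->|->] //; apply: x0q.
  move: Hc; rewrite [lc _ _]big1 ?addr0 // => j _.
  by rewrite c0 mulr0z.
Qed.

Lemma FDZ_basis (R : naRingType) (K H : set R) :
  FDZ_algebra R -> is_subgroup K -> is_subgroup H -> H `<=` K ->
  (forall x (c : int), K x -> c != 0 -> H (x *~ c) -> H x) ->
  exists d (b : 'I_d -> R), basis_mod K H b.
Proof.
move=> hR sK sH HK isoH; have [t Kt] := FDZ_subgroup_fg hR sK.
apply: (@free_basis _ t t) => //; rewrite ?Kt //; first exact: mem_span.
by move=> x tx; exists x => //; rewrite subrr; apply: subg0.
Qed.

(** Outside [K] the function [v] takes arbitrary values. *)
Lemma coordinates (G : zmodType) (K H : set G) d (b : 'I_d -> G) :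
  is_subgroup K -> is_subgroup H -> H `<=` K -> basis_mod K H b ->
  exists v : G -> 'rV[int]_d,
    [/\ forall x, K x -> H (x - lc b (v x 0)),
        forall x y, K x -> K y -> v (x - y) = v x - v y,
        forall x, K x -> (v x = 0 <-> H x)
      & forall c, v (lc b c) = \row_i c i].
Proof.
move=> sK sH HK [Kb bK b0].
have /choice[v Hv] : forall x, exists w : 'rV[int]_d, K x -> H (x - lc b (w 0)).
  move=> x; have [/bK[c Hc]|nK] := pselect (K x); last by exists 0.
  by exists (\row_i c i) => _; rewrite (_ : (_ 0) = c) //; apply/funext => i; rewrite mxE.
have uniq x (w : 'rV_d) : K x -> H (x - lc b (w 0)) -> v x = w.
  move=> Kx Hw; apply/rowP => i; apply/eqP; rewrite -subr_eq0; apply/eqP.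
  apply: (b0 (fun i => v x 0 i - w 0 i)); rewrite lcB.
  have := subgB sH Hw (Hv x Kx).
  by rewrite opprB addrC addrA subrK.
exists v; split=> //.
- move=> x y Kx Ky; apply: uniq; first exact: subgB.
  rewrite (_ : (_ 0) = (fun i => v x 0 i - v y 0 i)); last by apply/funext => i; rewrite !mxE.
  have -> : x - y - lc b (fun i => v x 0 i - v y 0 i)
      = (x - lc b (v x 0)) - (y - lc b (v y 0)).
    by rewrite lcB !opprD !opprK addrACA.
  by apply: subgB => //; apply: Hv.
- move=> x Kx; have lc0 : lc b ((0 : 'rV[int]_d) 0) = 0.
    by rewrite /lc big1 // => i _; rewrite mxE mulr0z.
  split=> [vx0|Hx]; last by apply: uniq => //; rewrite lc0 subr0.
  by have := Hv x Kx; rewrite vx0 lc0 subr0.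
- move=> c; apply: uniq; first exact: subg_lc.
  rewrite (_ : (_ 0) = c); last by apply/funext => i; rewrite mxE.
  by rewrite subrr; apply: subg0.
Qed.

Lemma add_coset_eq (G : zmodType) (B : set G) x y : is_subgroup B ->
  add_coset B x = add_coset B y <-> B (x - y).
Proof.
move=> sB; split=> [E|Bxy].
  have : add_coset B x x by exists 0; [exact: subg0 | rewrite addr0].
  by rewrite E => -[b Bb <-]; rewrite addrC addKr.
apply/seteqP; split=> z [b Bb <-].
  by exists (x - y + b); [exact: subgD | rewrite addrA addrCA subrr addr0].
exists (b - (x - y)); first exact: subgB.
by rewrite opprB addrCA [x + _]addrC subrK addrC.
Qed.

Lemma has_index_reps (G : zmodType) (A B : set G) (J : finType) (f : J -> G) :
  is_subgroup B -> (forall j, A (f j)) -> (forall x, A x -> exists j, B (x - f j)) ->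
  (forall j j', B (f j - f j') -> j = j') -> has_index A B #|{: J}|.
Proof.
move=> sB Af fA fI; rewrite /has_index card_eq_sym.
pose g k := if insub k is Some i then add_coset B (f (enum_val (i : 'I_#|{: J}|))) else set0.
have gE (i : 'I_#|{: J}|) : g i = add_coset B (f (enum_val i)) by rewrite /g valK.
apply/card_set_bijP; exists g; split.
- by move=> k /= kJ; rewrite (gE (Ordinal kJ)); apply: imageP.
- move=> k k'; rewrite !inE /= => kJ kJ'; rewrite (gE (Ordinal kJ)) (gE (Ordinal kJ')).
  by move=> /(add_coset_eq _ _ sB)/fI/enum_val_inj[].
- move=> _ [x Ax <-]; have [j Bj] := fA x Ax; exists (enum_rank j) => //=.
  by rewrite gE enum_rankK; apply/esym/(add_coset_eq _ _ sB).
Qed.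

Lemma reps_of_index (G : zmodType) (A B : set G) k :
  is_subgroup B -> has_index A B k ->
  exists f : 'I_k -> G, [/\ forall j, A (f j), forall x, A x -> exists j, B (x - f j)
    & forall j j', B (f j - f j') -> j = j'].
Proof.
move=> sB; rewrite /has_index card_eq_sym => /card_set_bijP[g [gF gI gS]].
have /choice[f Hf] : forall j : 'I_k, exists x, A x /\ add_coset B x = g j.
  by move=> j; have [|x Ax <-] := gF j; [exact: ltn_ord | exists x].
exists f; split=> [j|x Ax|j j' Bj]; first by have [] := Hf j.
- have [|i ik Ei] := gS (add_coset B x); first by exists x.
  exists (Ordinal ik); apply/(add_coset_eq _ _ sB).
  by rewrite -Ei; have [_ ->] := Hf (Ordinal ik).
- apply: val_inj; apply: gI; rewrite ?inE /=; try exact: ltn_ord.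
  have [_ <-] := Hf j; have [_ <-] := Hf j'.
  exact/(add_coset_eq _ _ sB).
Qed.

(** Translation by [x] permutes the cosets, so it does not change the sum of
    a system of representatives modulo [B]. *)
Lemma index_exponent (G : zmodType) (A B : set G) k x :
  is_subgroup A -> is_subgroup B -> has_index A B k -> A x -> B (x *+ k).
Proof.
move=> sA sB /(reps_of_index sB)[f [Af fA fI]] Ax.
have /choice[s Hs] : forall j, exists i : 'I_k, B (x + f j - f i).
  by move=> j; apply: fA; apply: subgD.
have sI : injective s.
  move=> i j Eij; apply: fI; have := subgB sB (Hs i) (Hs j).
  by rewrite Eij opprB addrA subrK opprD addrACA subrr add0r.
have := subg_sum (index_enum 'I_k) (P := predT) sB (fun j _ => Hs j).
rewrite sumrB big_split /= sumr_const card_ord.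
have -> : \sum_i f (s i) = \sum_i f i by rewrite [RHS](reindex_inj sI).
by rewrite addrK.
Qed.

Lemma has_index_gt0 (G : zmodType) (A B : set G) k :
  is_subgroup A -> is_subgroup B -> has_index A B k -> (0 < k)%N.
Proof.
move=> sA sB /(reps_of_index sB)[f [_ fA _]].
by have [[j jk] _] := fA 0 (subg0 sA); apply: leq_ltn_trans jk.
Qed.

(** Each new generator multiplies the index by its order modulo the group
    already reached, and this order divides [e]. *)
Lemma finite_index (G : zmodType) (t : seq G) (H : set G) (e : nat) :
  is_subgroup H -> (0 < e)%N -> (forall x, x \in t -> H (x *+ e)) ->
  exists2 k, has_index (set_sum (span t) H) H k
    & forall p, prime p -> (p %| k -> p %| e)%N.
Proof.
move=> sH e0; elim: t => [|g t IH] tH.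
  exists 1%N => [|p pp]; last by rewrite dvdn1 => /eqP p1; rewrite p1 in pp.
  rewrite -(card_ord 1); apply: (has_index_reps (f := fun=> 0)) => //.
  - by move=> _; exists 0 => //; exists 0; [exact: subg0 | rewrite addr0].
  - by move=> _ [_ -> [y Hy <-]]; exists ord0; rewrite add0r subr0.
  - by move=> j j' _; rewrite !ord1.
have [|k Ik pk] := IH; first by move=> x xt; apply: tH; rewrite inE xt orbT.
set K1 := set_sum (span t) H in Ik.
have sK1 : is_subgroup K1 by apply: subg_set_sum => //; apply: subg_span.
have HK1 : H `<=` K1.
  by move=> x Hx; exists 0; [apply: subg0; apply: subg_span | exists x; rewrite ?add0r].
have [f [Kf fK fI]] := reps_of_index sH Ik.
have sD : is_subgroup [set a : int | K1 (g *~ a)].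
  split; first by rewrite /= mulr0z; apply: subg0.
  by move=> a b; rewrite /= mulrzBr; apply: subgB.
have [d Kd dD] := int_subgroup sD.
have [q Eq] : exists q, e%:Z = d * q.
  by apply: dD; apply: HK1; apply: tH; rewrite inE eqxx.
have de : (`|d| %| e)%N.
  by rewrite (_ : e = `|e%:Z|)%N // Eq abszM dvdn_mulr.
have d0 : (0 < `|d|)%N by apply: dvdn_gt0 de.
exists (#|{: 'I_`|d| * 'I_k}|)%N; last first.
  move=> p pp; rewrite card_prod !card_ord Euclid_dvdM // => /orP[pd|/pk]; last exact.
  exact: dvdn_trans de.
apply: (has_index_reps (f := fun ij : 'I_`|d| * 'I_k => g *~ ij.1%:Z + f ij.2)) => //.
- move=> [i j] /=; have [x tx [y Hy <-]] := Kf j.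
  exists (g *~ i%:Z + x); last by exists y => //; rewrite addrA.
  by exists i%:Z; rewrite addrC addKr.
- move=> _ [x [c tx] [y Hy <-]].
  pose r := (c %% `|d|%:Z)%Z.
  have d0' : `|d|%:Z != 0 by rewrite eqz_nat -lt0n.
  have [i Ei] : exists i : 'I_`|d|, i%:Z = r.
    have r0 : 0 <= r := modz_ge0 c d0'.
    have rd : (`|r| < `|d|)%N by rewrite -ltz_nat gez0_abs // ltz_pmod.
    by exists (Ordinal rd) => /=; rewrite gez0_abs.
  have Kcr : K1 (g *~ (c - r)).
    have -> : c - r = d * (Num.sg d * (c %/ `|d|%:Z)%Z).
      by rewrite mulrA [d * _]mulrC -abszEsg {1}(divz_eq c `|d|%:Z) addrK mulrC.
    by rewrite mulrzA; apply: subgMz.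
  have [|j Hj] := fK (x + y - g *~ i%:Z).
    have -> : x + y - g *~ i%:Z = x - g *~ c + y + g *~ (c - r).
      by rewrite Ei mulrzBr addrA [X in _ = X - _]addrAC subrK.
    apply: subgD => //; apply: subgD => //; last exact: HK1.
    by exists (x - g *~ c) => //; exists 0; [exact: subg0 | rewrite addr0].
  by exists (i, j); rewrite /= opprD addrA.
- move=> [i j] [i' j'] /= Hij.
  have [q' Eii] : exists q', i%:Z - i'%:Z = d * q'.
    apply: dD; rewrite /= mulrzBr.
    have -> : g *~ i%:Z - g *~ i'%:Z
        = g *~ i%:Z + f j - (g *~ i'%:Z + f j') - (f j - f j').
      by rewrite opprD addrACA addrK.
    by apply: subgB => //; [apply: HK1 | apply: subgB].
  have dii : (`|d| %| `|i%:Z - i'%:Z|)%N by rewrite Eii abszM dvdn_mulr.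
  have Ei : i = i'.
    apply: val_inj; apply/eqP; rewrite -eqz_nat -subr_eq0 -absz_eq0.
    have [//|ii0] := posnP `|i%:Z - i'%:Z|%N.
    have := dvdn_leq ii0 dii; have := ltn_ord i; have := ltn_ord i'; lia.
  by congr (_, _) => //; apply: fI; rewrite Ei opprD addrACA subrr add0r in Hij.
Qed.

Lemma det_cong n (N : int) (Y : 'M[int]_n) :
  exists q, \det (1%:M - N *: Y) = 1 + N * q.
Proof.
pose C x y := exists q, x = y + N * q.
have CD x y x' y' : C x y -> C x' y' -> C (x + x') (y + y').
  by move=> [q ->] [q' ->]; exists (q + q'); ring.
have CM x y x' y' : C x y -> C x' y' -> C (x * x') (y * y').
  by move=> [q ->] [q' ->]; exists (y * q' + q * y' + N * q * q'); ring.
have Cxx x : C x x by exists 0; rewrite mulr0 addr0.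
suff : C (\det (1%:M - N *: Y)) (\det (1%:M : 'M_n)) by rewrite det1.
apply: (big_ind2 C) => // s _.
apply: (CM) => //; apply: (big_ind2 C) => [//|x y x' y'|i _]; first exact: CM.
rewrite !mxE; move: (Y i _) => y; exists (- y); ring.
Qed.

(** The determinant trick: with [g = h + N Y g] for a vector [h] over [H], the
    adjugate of [1 - N Y] shows that its determinant multiplies [G] into [H]. *)
Lemma nakayama (G : zmodType) (t : seq G) (H : set G) (N : nat) :
  span t = setT -> is_subgroup H -> (forall x, exists y, H (x - y *+ N)) ->
  exists q : int, forall x, H (x *~ (1 + N%:Z * q)).
Proof.
move=> tT sH HN; pose g (i : 'I_(size t)) := t`_i.
have /choice[Y HY] : forall i, exists w : 'rV[int]_(size t), H (g i - lc g (w 0) *+ N).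
  move=> i; have [y Hy] := HN (g i).
  have [c Ec] : exists c, y = lc g c by apply/spanP; rewrite tT.
  exists (\row_j c j); rewrite (_ : lc _ _ = y) // Ec.
  by apply: eq_bigr => j _; rewrite mxE.
pose M : 'M[int]_(size t) := 1%:M - N%:Z *: \matrix_i Y i.
have [q Eq] : exists q, \det M = 1 + N%:Z * q by apply: det_cong.
have HM i : H (lc g (M i)).
  have -> : lc g (M i) = g i - lc g (Y i 0) *+ N; last exact: HY.
  rewrite -(lc_delta g i) pmulrn -lcM -lcB; apply: eq_bigr => j _; congr (_ *~ _).
  by rewrite !mxE eq_sym mulrC; case: eqP.
exists q => x; rewrite -Eq.
apply: (span_min (t := t) (H := [set x | H (x *~ \det M)])); last by rewrite tT.
  split=> [|y z]; first by rewrite /= mul0rz; apply: subg0.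
  by rewrite /= mulrzBl; apply: subgB.
move=> y /(nthP 0)[k kt <-] /=; pose i := Ordinal kt.
suff -> : t`_k *~ \det M = lc (fun j => lc g (M j)) (\adj M i).
  exact: subg_lc.
rewrite /lc; under [RHS]eq_bigr => j _ do rewrite mulrz_suml.
rewrite exchange_big /= (bigD1 i) //= [X in _ + X]big1 => [|l il].
  rewrite addr0; under eq_bigr => j _ do rewrite -mulrzA mulrC.
  rewrite -mulrz_sumr; congr (_ *~ _).
  by have /matrixP/(_ i i) := mul_adj_mx M; rewrite !mxE eqxx => ->.
under eq_bigr => j _ do rewrite -mulrzA mulrC.
rewrite -mulrz_sumr; have /matrixP/(_ i l) := mul_adj_mx M.
by rewrite !mxE eq_sym (negPf il) mulr0n => ->; rewrite mulr0z.
Qed.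

(** The group is equal to [n] times itself modulo the image, so the image has
    finite index prime to [n]. *)
Lemma onto_modulo_exponent (G H : zmodType) (f : {additive G -> H}) (t : seq H) (n : nat) :
  span t = setT -> (2 <= n)%N -> (forall y, exists x z, y = f x + z *+ n) ->
  exists2 E : int, E != 0 &
    (exists q, E = 1 + n%:Z * q) /\ forall y, exists x, f x = y *~ E.
Proof.
move=> tT n2 fn; have sf : is_subgroup (range f) by apply: subg_image.
have [|q Hq] := nakayama (N := n) tT sf.
  by move=> y; have [x [z ->]] := fn y; exists z; rewrite addrK; exists x.
exists (1 + n%:Z * q).
  apply/eqP => /eqP; rewrite addr_eq0 => /eqP/(congr1 absz).
  rewrite absz1 abszN abszM absz_nat => /esym/eqP.
  by rewrite muln_eq1 => /andP[/eqP n1 _]; rewrite n1 in n2.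
split; first by exists q.
by move=> y; have [x _ E] := Hq y; exists x.
Qed.

(** * Annihilator, square and additions of a ring *)

Lemma additive_of (G H : zmodType) (f : G -> H) : {morph f : x y / x - y} ->
  exists g : {additive G -> H}, g =1 f.
Proof.
move=> fB; pose m := GRing.isZmodMorphism.Build G H f fB.
by exists (HB.pack f m : {additive G -> H}).
Qed.

Section NARing.
Variable R : naRingType.
Implicit Types x y z : R.

Lemma namul0r x : 0 ** x = 0 :> R.
Proof. by apply: (addIr (0 ** x)); rewrite -namulDl !add0r. Qed.

Lemma namulr0 x : x ** 0 = 0 :> R.
Proof. by apply: (addIr (x ** 0)); rewrite -namulDr !add0r. Qed.

Lemma namulNr x y : (- x) ** y = - (x ** y).
Proof. by apply/eqP; rewrite -subr_eq0 opprK -namulDl addNr namul0r. Qed.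

Lemma namulrN x y : x ** (- y) = - (x ** y).
Proof. by apply/eqP; rewrite -subr_eq0 opprK -namulDr addNr namulr0. Qed.

Lemma namulBl x y z : (x - y) ** z = x ** z - y ** z.
Proof. by rewrite namulDl namulNr. Qed.

Lemma namulBr x y z : z ** (x - y) = z ** x - z ** y.
Proof. by rewrite namulDr namulrN. Qed.

Lemma namulMzl x y (c : int) : (x *~ c) ** y = (x ** y) *~ c.
Proof.
have nat_case n : (x *+ n) ** y = (x ** y) *+ n.
  by elim: n => [|n IH]; rewrite ?namul0r // !mulrS namulDl IH.
case: c => n; first exact: nat_case.
by rewrite NegzE !mulrNz namulNr -!pmulrn nat_case.
Qed.

Lemma namulMzr x y (c : int) : x ** (y *~ c) = (x ** y) *~ c.
Proof.
have nat_case n : x ** (y *+ n) = (x ** y) *+ n.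
  by elim: n => [|n IH]; rewrite ?namulr0 // !mulrS namulDr IH.
case: c => n; first exact: nat_case.
by rewrite NegzE !mulrNz namulrN -!pmulrn nat_case.
Qed.

Lemma subg_Ann : is_subgroup (Ann R).
Proof.
split=> [y|x x' Ax Ax' y]; first by rewrite namul0r namulr0.
have [xy yx] := Ax y; have [xy' yx'] := Ax' y.
by rewrite namulBl namulBr xy yx xy' yx' subrr.
Qed.

Lemma Sq_sub (I : set R) : is_ideal I -> (forall x y, I (x ** y)) -> Sq R `<=` I.
Proof. by move=> iI Ixy z; apply; split=> // _ [x _ [y _ <-]]. Qed.

Lemma Sq_ideal : is_ideal (Sq R).
Proof.
split; first split.
- by move=> I [[[I0 _] _] _].
- move=> x y Sx Sy I iI; have [[[_ IB] _] _] := iI.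
  by apply: IB; [apply: Sx | apply: Sy].
- move=> r x Sx; split=> I iI; have [[_ IM] _] := iI.
    by have [] := IM r x (Sx I iI).
  by have [] := IM r x (Sx I iI).
Qed.

Lemma subg_Sq : is_subgroup (Sq R).
Proof. by have [] := Sq_ideal. Qed.

Lemma Sq_mul x y : Sq R (x ** y).
Proof. by move=> I [_]; apply; exists x => //; exists y. Qed.

Lemma subg_IsSq : is_subgroup (Is (Sq R)).
Proof. exact/subg_Is/subg_Sq. Qed.

Lemma IsSq_mul x y : Is (Sq R) (x ** y).
Proof. by apply: sub_Is; apply: Sq_mul. Qed.

Lemma subg_NR : is_subgroup (NR R).
Proof. apply: subg_set_sum; [exact: subg_IsSq | exact: subg_Ann]. Qed.

Lemma subg_MR : is_subgroup (MR R).
Proof. apply/subg_Is/subg_set_sum; [exact: subg_Sq | exact: subg_Ann]. Qed.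

Lemma subg_Delta : is_subgroup (Delta R).
Proof. apply: subgI; [exact: subg_IsSq | exact: subg_Ann]. Qed.

Lemma NR_MR : NR R `<=` MR R.
Proof.
move=> _ [x [a a0 Sx] [y Ay <-]]; exists a => //; rewrite mulrzDl.
by exists (x *~ a) => //; exists (y *~ a) => //; apply: (subgMz _ subg_Ann).
Qed.

Lemma MR_Is_NR : MR R `<=` Is (NR R).
Proof.
move=> x [a a0 [y Sy [z Az E]]]; exists a => //; exists y; first by apply: sub_Is.
by exists z.
Qed.

Lemma MR_isolated x (c : int) : c != 0 -> MR R (x *~ c) -> MR R x.
Proof. exact: Is_isolated. Qed.

(** This is why an addition is torsion-free. *)
Lemma torsion_Delta x (c : int) : Ann R x -> c != 0 -> x *~ c = 0 -> Delta R x.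
Proof. by move=> Ax c0 xc; split=> //; exists c => //; rewrite xc; exact: (subg0 subg_Sq). Qed.

Section Addition.
Variables (R0 : set R) (aR0 : is_addition R0).

Lemma subg_addition : is_subgroup R0.
Proof. by case: aR0. Qed.

Lemma addition_Ann : R0 `<=` Ann R.
Proof.
have [sR0 <- _] := aR0; move=> x R0x; exists x => //; exists 0; last by rewrite addr0.
exact: (subg0 subg_Delta).
Qed.

Lemma addition_inj x : R0 x -> Is (Sq R) x -> x = 0.
Proof.
move=> R0x Sx; have [_ _ E] := aR0.
have : (R0 `&` Delta R) x by split=> //; split=> //; apply: addition_Ann.
by rewrite E.
Qed.

Lemma addition_free x (c : int) : R0 x -> c != 0 -> x *~ c = 0 -> x = 0.
Proof.
move=> R0x c0 xc; apply: addition_inj => //.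
by have [] := torsion_Delta (addition_Ann R0x) c0 xc.
Qed.

Lemma addition_free_n x n : R0 x -> (0 < n)%N -> x *+ n = 0 -> x = 0.
Proof.
by move=> R0x n0; rewrite pmulrn; apply: addition_free => //; rewrite eqz_nat -lt0n.
Qed.

Lemma NR_addition x : NR R x -> exists2 r, R0 r & Is (Sq R) (x - r).
Proof.
have [_ E _] := aR0; move=> [y Sy [z + <-]]; rewrite -E => -[r R0r [d [Sd _] <-]].
exists r => //; rewrite [r + d]addrC addrA addrK.
by apply: subgD => //; apply: subg_IsSq.
Qed.

(** [M] is a direct summand because [R / M] is free; multiplication by [m] maps
    [M] into [N], which is the direct sum of [R0] and of the isolator of the
    square. *)
Lemma addition_projection (m : nat) : FDZ_algebra R ->
  (forall x, MR R x -> NR R (x *+ m)) ->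
  exists p : R -> R, [/\ forall x, R0 (p x), {morph p : x y / x - y},
    forall x y, p (x ** y) = 0 & forall r, R0 r -> p r = r *+ m].
Proof.
move=> hR hm.
have [d [b bM]] : exists d (b : 'I_d -> R), basis_mod [set: R] (MR R) b.
  by apply: FDZ_basis => // [|x c _]; [exact: subg_MR | exact: MR_isolated].
have [v [vM vB v0 _]] := coordinates (@subg_setT _) subg_MR (fun _ _ => I) bM.
pose q x := x - lc b (v x 0).
have qB x y : q (x - y) = q x - q y.
  rewrite /q vB // (_ : (v x - v y) 0 = (fun i => v x 0 i - v y 0 i)).
    by rewrite lcB !opprD !opprK addrACA.
  by apply/funext => i; rewrite !mxE.
have /choice[p Hp] : forall x, exists r, R0 r /\ Is (Sq R) (q x *+ m - r).
  by move=> x; have [r R0r Sr] := NR_addition (hm _ (vM x I)); exists r.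
have pE x r : R0 r -> Is (Sq R) (q x *+ m - r) -> p x = r.
  move=> R0r Sr; have [R0p Sp] := Hp x; apply/eqP; rewrite -subr_eq0; apply/eqP.
  apply: addition_inj; first by apply: subgB => //; apply: subg_addition.
  have := subgB subg_IsSq Sr Sp.
  by rewrite opprB addrC addrA subrK.
have qM x : MR R x -> q x = x.
  move=> Mx; rewrite /q; have /v0 -> := Mx => //.
  by rewrite /lc big1 ?subr0 // => i _; rewrite mxE mulr0z.
exists p; split=> [x|x y|x y|r R0r]; first by have [] := Hp x.
- have [R0x Sx] := Hp x; have [R0y Sy] := Hp y.
  apply: pE; first by apply: subgB => //; apply: subg_addition.
  have -> : q (x - y) *+ m - (p x - p y) = (q x *+ m - p x) - (q y *+ m - p y).
    by rewrite qB mulrnBl !opprD !opprK addrACA.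
  by apply: subgB => //; apply: subg_IsSq.
- apply: pE; first exact: (subg0 subg_addition).
  rewrite subr0 qM; first by apply: subgMn; [exact: subg_IsSq | exact: IsSq_mul].
  apply: NR_MR; exists (x ** y); first exact: IsSq_mul.
  by exists 0; rewrite ?addr0 //; exact: (subg0 subg_Ann).
- apply: pE; first by apply: subgMn => //; apply: subg_addition.
  rewrite qM ?subrr; first exact: (subg0 subg_IsSq).
  apply: NR_MR; exists 0; first exact: (subg0 subg_IsSq).
  by exists r; rewrite ?add0r //; apply: addition_Ann.
Qed.

End Addition.

Lemma addition_basis (R0 : set R) : FDZ_algebra R -> is_addition R0 ->
  exists d (b : 'I_d -> R), basis_mod R0 [set 0] b.
Proof.
move=> hR aR0; have sR0 := subg_addition aR0.
apply: FDZ_basis => //; first exact: subg_set0.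
  by move=> _ ->; apply: subg0.
by move=> x c R0x c0 E; apply: addition_free R0x c0 E.
Qed.

Lemma addition_exists : FDZ_algebra R -> exists R0, is_addition (R := R) R0.
Proof.
move=> hR.
have sD := subg_Delta; have sA := subg_Ann.
have [||||d [b [Ab bA b0]]] := @FDZ_basis R (Ann R) (Delta R) hR => //.
- by move=> x [].
- move=> x c Ax c0 [[a a0 Sa] _]; split=> //; exists (c * a); first by rewrite mulf_neq0.
  by rewrite mulrzA.
exists [set x | exists c, x = lc b c]; split.
- split; first by exists (fun=> 0); rewrite /lc big1 // => i _; rewrite mulr0z.
  by move=> _ _ [c ->] [c' ->]; exists (fun i => c i - c' i); rewrite lcB.
- apply/seteqP; split=> [_ [_ [c ->] [y [_ Ay] <-]]|x Ax].
    by apply: (subgD sA) => //; apply: (subg_lc _ sA).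
  have [c Hc] := bA x Ax; exists (lc b c); first by exists c.
  by exists (x - lc b c) => //; rewrite addrC subrK.
- apply/seteqP; split=> [_ [[c ->] /b0 c0]|_ ->].
    by rewrite /= /lc big1 // => i _; rewrite c0 mulr0z.
  split; last exact: subg0.
  by exists (fun=> 0); rewrite /lc big1 // => i _; rewrite mulr0z.
Qed.

End NARing.

(** * Back-and-forth between two close rings *)

(** The demands made by one direction of the game. Think of [rho q x y] as a
    congruence modulo [q S0] between [y] and the image of [x] under a
    morphism. The projections [p] and [p'] onto the free groups [R0] and [S0]
    detect the additive relations: by [hc_ker], a relation between elements
    of [R] holds for their counterparts up to an element of [m q S0], an
    error that [hc_shift] can correct. *)
Record half_close (R S : naRingType) (m Q : nat) (R0 : set R) (S0 : set S)
    (p : {additive R -> R}) (p' : {additive S -> S}) (rho : nat -> R -> S -> Prop) :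
  Prop := {
  hc_rep : forall x, R0 (p x);
  hc_mul : forall x y, p (x ** y) = 0;
  hc_mult : forall r, R0 r -> p r = r *+ m;
  hc_free : forall r (c : int), R0 r -> c != 0 -> r *~ c = 0 -> r = 0;
  hc_ex : forall x, exists y, rho Q x y;
  hc_shift : forall q x y s, S0 s -> rho q x y -> rho q x (y + s *+ q);
  hc_ker : forall q x y, (q %| Q)%N -> p x = 0 -> rho q x y ->
    exists2 s, S0 s & p' y = s *+ (m * q);
  hc_zero : forall y, rho 1%N 0 y -> p' y = 0 -> y = 0;
  hc_triv : (forall s, S0 s -> s = 0) -> forall r, R0 r -> r = 0
}.

Record close_rel (R S : naRingType) (rho : nat -> R -> S -> Prop) : Prop := {
  cr_0 : forall q, rho q 0 0;
  cr_sub : forall q x x' y y', rho q x y -> rho q x' y' -> rho q (x - x') (y - y');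
  cr_dvd : forall q q' x y, (q %| q')%N -> rho q' x y -> rho q x y;
  cr_mul : forall x x' y y', rho 1%N x y -> rho 1%N x' y' -> rho 1%N (x ** x') (y ** y')
}.

Lemma close_rel_lc (R S : naRingType) (rho : nat -> R -> S -> Prop) q n
    (e : 'I_n -> R) (e' : 'I_n -> S) c : close_rel rho ->
  (forall j, rho q (e j) (e' j)) -> rho q (lc e c) (lc e' c).
Proof.
move=> hr he.
pose g : set (R * S)%type := [set u | rho q u.1 u.2].
have sg : is_subgroup g.
  by split=> [|x y]; [apply: cr_0 hr _ | apply: cr_sub hr _ _ _ _ _].
have -> : lc e c = (lc (fun j => (e j, e' j)) c).1.
  by rewrite /lc raddf_sum; apply: eq_bigr => j _; rewrite raddfMz.
have -> : lc e' c = (lc (fun j => (e j, e' j)) c).2.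
  by rewrite /lc raddf_sum; apply: eq_bigr => j _; rewrite raddfMz.
by apply: (subg_lc _ sg) => j; apply: he.
Qed.

Lemma lc_raddf (G H : zmodType) (p : {additive G -> H}) d (b : 'I_d -> G) c :
  p (lc b c) = lc (fun i => p (b i)) c.
Proof. by rewrite /lc raddf_sum; apply: eq_bigr => i _; rewrite raddfMz. Qed.

(** Only relations with coefficients at most [N] are compared: these are
    finitely many, so that a new element can avoid all of them. *)
Definition sim (R S : naRingType) (p : {additive R -> R}) (p' : {additive S -> S})
    (rho : nat -> R -> S -> Prop) (n N q : nat) (e : nat -> R) (e' : nat -> S) :=
  (forall j : 'I_n, rho q (e j) (e' j)) /\
  (forall c : 'I_n -> int, (forall j, (`|c j| <= N)%N) ->
     (lc (fun j : 'I_n => p (e j)) c = 0 <-> lc (fun j : 'I_n => p' (e' j)) c = 0)).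

Lemma lc_upd (R : naRingType) (f : R -> R) n (e : nat -> R) (i : 'I_n) x c :
  lc (fun j : 'I_n => f (env_upd e i x j)) c
  = f x *~ c i + lc (fun j : 'I_n => f (e j)) (fun j => if j == i then 0 else c j).
Proof.
rewrite /lc (bigD1 i) //= [in RHS](bigD1 i) //= eqxx mulr0z add0r /env_upd eqxx.
congr (_ + _); apply: eq_bigr => j /[dup] ji /negPf ->.
by rewrite (inj_eq val_inj) (negPf ji).
Qed.

Lemma lc_upd0 (R : naRingType) (f : R -> R) n (e : nat -> R) (i : 'I_n) x c :
  c i = 0 ->
  lc (fun j : 'I_n => f (env_upd e i x j)) c = lc (fun j : 'I_n => f (e j)) c.
Proof.
move=> ci; rewrite lc_upd ci mulr0z add0r; congr lc; apply/funext => j.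
by case: eqP => [->|].
Qed.

(** Cross-multiplication of two relations eliminates the new element [x] and
    produces coefficients of the size of [2 N ^ 2]. *)
Lemma lc_elim (R : naRingType) (p : {additive R -> R}) (R0 : set R) n N
    (e : nat -> R) (i : 'I_n) x (c d : 'I_n -> int) :
  is_subgroup R0 -> (forall x, R0 (p x)) ->
  (forall r (c : int), R0 r -> c != 0 -> r *~ c = 0 -> r = 0) ->
  (forall j, (`|c j| <= N)%N) -> (forall j, (`|d j| <= N)%N) -> c i != 0 ->
  lc (fun j : 'I_n => p (env_upd e i x j)) c = 0 ->
  let k j := d j * c i - c j * d i in
  (forall j, (`|k j| <= 2 * N ^ 2)%N) /\
  (lc (fun j : 'I_n => p (env_upd e i x j)) d = 0
     <-> lc (fun j : 'I_n => p (e j)) k = 0).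
Proof.
move=> sR0 R0p R0f cN dN ci Lc k; split.
  move=> j; have := cN j; have := cN i; have := dN j; have := dN i.
  move=> h1 h2 h3 h4; have := leq_mul h2 h3; have := leq_mul h4 h1.
  by rewrite /k -!abszM expnS expn1; lia.
have <- : lc (fun j : 'I_n => p (env_upd e i x j)) k = lc (fun j : 'I_n => p (e j)) k.
  by apply: lc_upd0; rewrite /k mulrC subrr.
rewrite /k lcB !lcM Lc mul0rz subr0; split=> [->|]; first by rewrite mul0rz.
by apply: R0f => //; apply: subg_lc.
Qed.

(** If some bounded relation involves [x], it determines [p' y], and solving
    it for [y] divides by its coefficient at [x]; the factorial [N`!] in the
    modulus makes this possible. Otherwise [y] is a translate of a first
    candidate [y0] by a multiple of a nonzero element [s] of [S0]: each
    bounded relation excludes at most one multiple, so by the pigeonhole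
    principle one of them is left. *)
Lemma extend_sim (R S : naRingType) (m Q : nat) (R0 : set R) (S0 : set S)
    (p : {additive R -> R}) (p' : {additive S -> S}) (rho : nat -> R -> S -> Prop)
    n N q (e : nat -> R) (e' : nat -> S) (i : 'I_n) (x : R) :
  (0 < m)%N -> (0 < N)%N -> (0 < q)%N -> (q * N`! %| Q)%N ->
  is_subgroup R0 -> is_subgroup S0 ->
  close_rel rho -> half_close m Q R0 S0 p p' rho ->
  (forall y, S0 (p' y)) -> (forall s, S0 s -> p' s = s *+ m) ->
  (forall r (c : int), S0 r -> c != 0 -> r *~ c = 0 -> r = 0) ->
  sim p p' rho n (2 * N ^ 2) (q * N`!) e e' ->
  exists y, sim p p' rho n N q (env_upd e i x) (env_upd e' i y).
Proof.
move=> m0 N0 q0 qQ sR0 sS0 hr hc S0p' p'm S0f [rhoe Le].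
have [y0 Hy0] := hc_ex hc x.
have Hq (j : 'I_n) : rho q (e j) (e' j).
  by apply: (cr_dvd hr _ (rhoe j)); apply: dvdn_mulr.
have Hupd y : rho q x y -> forall j : 'I_n, rho q (env_upd e i x j) (env_upd e' i y j).
  by move=> Hy j; rewrite /env_upd; case: eqP.
have [[c [cN ci Lc]]|noc] := pselect (exists c : 'I_n -> int, [/\ forall j, (`|c j| <= N)%N,
    c i != 0 & lc (fun j : 'I_n => p (env_upd e i x j)) c = 0]).
  pose c0 j := if j == i then 0 else c j.
  pose w := x *~ c i + lc (fun j : 'I_n => e j) c0.
  pose w' := y0 *~ c i + lc (fun j : 'I_n => e' j) c0.
  have pw : p w = 0 by rewrite -Lc lc_upd /w raddfD /= raddfMz lc_raddf.
  have Hw : rho (q * N`!)%N w w'.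
    pose f (j : 'I_n.+1) := if unlift ord0 j is Some k then e k else x.
    pose f' (j : 'I_n.+1) := if unlift ord0 j is Some k then e' k else y0.
    pose g (j : 'I_n.+1) := if unlift ord0 j is Some k then c0 k else c i.
    have -> : w = lc f g.
      rewrite /lc big_ord_recl /f /g unlift_none; congr (_ + _).
      by apply: eq_bigr => j _; rewrite liftK.
    have -> : w' = lc f' g.
      rewrite /lc big_ord_recl /f' /g unlift_none; congr (_ + _).
      by apply: eq_bigr => j _; rewrite liftK.
    apply: close_rel_lc => // j; rewrite /f /f'; case: unliftP => [k _|_] //.
    exact: (cr_dvd hr qQ).
  have [s S0s Es] := hc_ker hc qQ pw Hw.
  have [u Eu] : exists u : int, c i * u = - N`!%:Z.
    have /dvdnP[t Et] : (`|c i| %| N`!)%N.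
      by apply: dvdn_fact; rewrite absz_gt0 ci cN.
    exists (- (Num.sg (c i) * t%:Z)).
    by rewrite Et PoszM abszEsg; ring.
  pose y := y0 + s *~ u *+ q.
  have Hy : rho q x y.
    apply: (hc_shift hc); first exact: subgMz.
    by apply: (cr_dvd hr _ Hy0); apply: dvdn_trans qQ; apply: dvdn_mulr.
  have Lc' : lc (fun j : 'I_n => p' (env_upd e' i y j)) c = 0.
    rewrite lc_upd -/c0 -lc_raddf -raddfMz -raddfD.
    have -> : y *~ c i + lc (fun j : 'I_n => e' j) c0 = w' + s *~ (- N`!%:Z) *+ q.
      rewrite /y mulrzDl addrAC /w'; congr (_ + _).
      by rewrite mulrzn -mulrzA [u * _]mulrC Eu.
    rewrite raddfD /= Es raddfMn /= raddfMz p'm //.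
    rewrite !pmulrn -!mulrzA -mulrzDr.
    by rewrite (_ : _ + _ = 0) ?mulr0z // !PoszM; ring.
  exists y; split=> [|d dN]; first exact: Hupd.
  have [kN ->] := lc_elim sR0 (hc_rep hc) (hc_free hc) cN dN ci Lc.
  have [_ ->] := lc_elim sS0 S0p' S0f cN dN ci Lc'.
  exact: Le.
have [s [S0s s0]] : exists s, S0 s /\ s != 0.
  apply: contrapT => noS; apply: noc; exists (fun j => (j == i)%:Z); split.
  - by move=> j; case: eqP.
  - by rewrite eqxx.
  rewrite lc_delta; apply: (hc_triv hc) (hc_rep hc _) => s S0s.
  by apply: contrapT => /eqP s0; apply: noS; exists s.
pose y (t : nat) := y0 + s *+ t *+ q.
have [t Ht] : exists t, forall c : 'I_n -> int, (forall j, (`|c j| <= N)%N) ->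
    c i != 0 -> lc (fun j : 'I_n => p' (env_upd e' i (y t) j)) c <> 0.
  apply: contrapT => noT.
  have /choice[c Hc] : forall t, exists c : 'I_n -> int, [/\ forall j, (`|c j| <= N)%N,
      c i != 0 & lc (fun j : 'I_n => p' (env_upd e' i (y t) j)) c = 0].
    move=> t; apply: contrapT => noc'; apply: noT; exists t => c cN ci Lc.
    by apply: noc'; exists c.
  pose code t : {ffun 'I_n -> 'I_(2 * N).+1} := [ffun j => inord `|c t j + N%:Z|].
  have codeI t t' : code t = code t' -> t = t'.
    move=> /ffunP E; have [cN ci Lc] := Hc t; have [cN' _ Lc'] := Hc t'.
    have Ec : c t = c t'.
      apply/funext => j; have := E j; rewrite !ffunE => /(congr1 val).
      have := cN j; have := cN' j => h h' /=.
      by rewrite !inordK; lia.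
    move: Lc Lc'; rewrite -Ec !lc_upd => /eqP; rewrite addr_eq0 => /eqP E1 /eqP.
    rewrite addr_eq0 -E1 -subr_eq0 -mulrzBl -raddfB /= => /eqP E0.
    have Ey : y t' - y t = s *~ (t'%:Z - t%:Z) *+ q.
      by rewrite /y opprD addrACA subrr add0r -mulrnBl mulrzBr -!pmulrn.
    move: E0; rewrite Ey p'm; last by apply: subgMn => //; apply: subgMz.
    rewrite !pmulrn -!mulrzA => E0.
    have [//|tt] := eqVneq t t'; case/eqP: s0.
    apply: S0f E0 => //; rewrite !mulf_neq0 //; lia.
  have /leq_card : injective (fun t : 'I_#|{: {ffun 'I_n -> 'I_(2 * N).+1}}|.+1 => code t).
    by move=> t t' /codeI/val_inj.
  by rewrite card_ord ltnn.
exists (y t); split=> [|c cN].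
  apply: Hupd; apply: (hc_shift hc); first exact: subgMn.
  by apply: (cr_dvd hr _ Hy0); apply: dvdn_trans qQ; apply: dvdn_mulr.
have [ci|ci] := eqVneq (c i) 0.
  rewrite !lc_upd0 //; apply: Le => j; apply: leq_trans (cN j) _.
  by rewrite expnS expn1; nia.
split=> Lc; last by case: (Ht c).
by case: noc; exists c.
Qed.

Record closeness (R S : naRingType) (m Q : nat) (R0 : set R) (S0 : set S)
    (p : {additive R -> R}) (p' : {additive S -> S}) (rho : nat -> R -> S -> Prop) :
  Prop := {
  cl_m : (0 < m)%N;
  cl_subR : is_subgroup R0;
  cl_subS : is_subgroup S0;
  cl_rel : close_rel rho;
  cl_forth : half_close m Q R0 S0 p p' rho;
  cl_back : half_close m Q S0 R0 p' p (fun q y x => rho q x y)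
}.

Lemma closeness_sym (R S : naRingType) (m Q : nat) (R0 : set R) (S0 : set S)
    (p : {additive R -> R}) (p' : {additive S -> S}) rho :
  closeness m Q R0 S0 p p' rho -> closeness m Q S0 R0 p' p (fun q y x => rho q x y).
Proof.
case=> m0 sR sS [r0 rB rd rM] hf hb; split=> //; split=> // [q x x' y y'|q q' x y|x x' y y'].
- exact: rB.
- exact: rd.
- exact: rM.
Qed.

Lemma sim_sym (R S : naRingType) (p : {additive R -> R}) (p' : {additive S -> S}) rho n N q e e' :
  sim p p' rho n N q e e' -> sim p' p (fun q y x => rho q x y) n N q e' e.
Proof. by move=> [Hr Hc]; split=> // c /Hc; tauto. Qed.

Lemma sim_weaken (R S : naRingType) (p : {additive R -> R}) (p' : {additive S -> S}) rho
    n N q N' q' e e' : close_rel rho -> (N' <= N)%N -> (q' %| q)%N ->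
  sim p p' rho n N q e e' -> sim p p' rho n N' q' e e'.
Proof.
move=> hr NN qq [Hr Hc]; split=> [j|c cN]; first exact: (cr_dvd hr qq).
by apply: Hc => j; apply: leq_trans (cN j) NN.
Qed.

Fixpoint vars_below (n : nat) (f : rformula) : bool :=
  match f with
  | FEq t1 t2 => all (fun i => i < n)%N (term_vars t1 ++ term_vars t2)
  | FNot f1 => vars_below n f1
  | FAnd f1 f2 | FOr f1 f2 | FImp f1 f2 => vars_below n f1 && vars_below n f2
  | FForall i f1 | FExists i f1 => (i < n)%N && vars_below n f1
  end.

Lemma vars_below_ex f : exists n, vars_below n f.
Proof.
have mono f' n n' : (n <= n')%N -> vars_below n f' -> vars_below n' f'.
  move=> nn; elim: f' =>
    [t1 t2|f1 IH|f1 IH1 f2 IH2|f1 IH1 f2 IH2|f1 IH1 f2 IH2|i f1 IH|i f1 IH] //=.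
  - by apply: sub_all => i /leq_trans; apply.
  1-3: by move=> /andP[/IH1-> /IH2->].
  1-2: by move=> /andP[/leq_trans-> // /IH->].
have two f1 f2 : (exists n, vars_below n f1) -> (exists n, vars_below n f2) ->
    exists n, vars_below n f1 && vars_below n f2.
  move=> [n Hn] [n' Hn']; exists (maxn n n').
  by rewrite (mono _ _ _ (leq_maxl n n') Hn) (mono _ _ _ (leq_maxr n n') Hn').
have one i f1 : (exists n, vars_below n f1) -> exists n, (i < n)%N && vars_below n f1.
  move=> [n Hn]; exists (maxn i.+1 n).
  by rewrite leq_maxl (mono _ _ _ (leq_maxr i.+1 n) Hn).
elim: f => [t1 t2|f1 IH|f1 IH1 f2 IH2|f1 IH1 f2 IH2|f1 IH1 f2 IH2|i f1 IH|i f1 IH] //=;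
  try by [apply: two | apply: one].
exists (\max_(i <- term_vars t1 ++ term_vars t2) i.+1).
by apply/allP => i it; apply: leq_bigmax_seq.
Qed.

(** Products are dropped because the projections [p] and [p'] kill them. *)
Fixpoint linear_part (t : rterm) (j : nat) : int :=
  match t with
  | TVar i => (i == j)%:Z
  | TAdd t1 t2 => linear_part t1 j + linear_part t2 j
  | TZero | TMul _ _ => 0
  end.

Lemma additive_term (R : naRingType) (p : {additive R -> R}) n (e : nat -> R) t :
  (forall x y, p (x ** y) = 0) -> all (fun i => i < n)%N (term_vars t) ->
  p (term_eval e t) = lc (fun j : 'I_n => p (e j)) (fun j => linear_part t j).
Proof.
move=> pM; elim: t => [i|| t1 IH1 t2 IH2|t1 _ t2 _] /=.
- rewrite andbT => ni; have := lc_delta (fun j : 'I_n => p (e j)) (Ordinal ni) => /= <-.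
  by apply: eq_bigr => j _; rewrite eq_sym.
- by rewrite raddf0 /lc big1 // => j _; rewrite mulr0z.
- by rewrite all_cat => /andP[/IH1 E1 /IH2 E2]; rewrite raddfD /= E1 E2 -lcD.
- by rewrite pM /lc big1 // => j _; rewrite mulr0z.
Qed.

Lemma close_rel_term (R S : naRingType) rho n (e : nat -> R) (e' : nat -> S) t :
  close_rel rho -> (forall j : 'I_n, rho 1%N (e j) (e' j)) ->
  all (fun i => i < n)%N (term_vars t) -> rho 1%N (term_eval e t) (term_eval e' t).
Proof.
move=> hr He; elim: t => [i|| t1 IH1 t2 IH2|t1 IH1 t2 IH2] /=.
- by rewrite andbT => ni; apply: (He (Ordinal ni)).
- by move=> _; apply: cr_0.
- rewrite all_cat => /andP[/IH1 h1 /IH2 h2].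
  rewrite -[X in _ + X]opprK -[X in rho _ _ (_ + X)]opprK.
  apply: (cr_sub hr) => //; rewrite -[X in rho _ X]sub0r -[X in rho _ _ X]sub0r.
  by apply: (cr_sub hr) => //; apply: cr_0.
- by rewrite all_cat => /andP[/IH1 h1 /IH2 h2]; apply: (cr_mul hr).
Qed.

(** The difference of the two sides in [S] is congruent to zero, and its
    projection vanishes by the comparison of the linear parts. *)
Lemma close_eq (R S : naRingType) (m Q : nat) (R0 : set R) (S0 : set S)
    (p : {additive R -> R}) (p' : {additive S -> S}) rho n t1 t2 e e' :
  closeness m Q R0 S0 p p' rho ->
  all (fun i => i < n)%N (term_vars t1) -> all (fun i => i < n)%N (term_vars t2) ->
  sim p p' rho n (\sum_(j < n) `|linear_part t1 j - linear_part t2 j|) 1 e e' ->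
  term_eval e t1 = term_eval e t2 -> term_eval e' t1 = term_eval e' t2.
Proof.
move=> [_ _ _ hr hf hb] t1n t2n [He Hc] E; apply/eqP; rewrite -subr_eq0; apply/eqP.
apply: (hc_zero hf).
  rewrite -(subrr (term_eval e t1)) {2}E.
  by apply: (cr_sub hr); apply: close_rel_term t1n || apply: close_rel_term t2n.
rewrite raddfB /= !(additive_term _ (hc_mul hb) _ (n := n)) // -lcB.
apply/Hc => [j|]; last first.
  by rewrite lcB -!(additive_term _ (hc_mul hf)) // E subrr.
by rewrite (bigD1 j) //= leq_addr.
Qed.

(** The bounds [N] and [q] do not depend on the rings, since the pair of
    close rings is chosen only once the formula, and hence [q], is known. *)
Definition holds_when_similar (n : nat)
    (P : forall R S : naRingType, (nat -> R) -> (nat -> S) -> Prop) : Prop :=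
  exists N q, [/\ (0 < N)%N, (0 < q)%N &
    forall (R S : naRingType) (m Q : nat) (R0 : set R) (S0 : set S)
      (p : {additive R -> R}) (p' : {additive S -> S}) rho e e',
    closeness m Q R0 S0 p p' rho -> (q %| Q)%N -> sim p p' rho n N q e e' -> P R S e e'].

(** The bounds [N] and [q] for a formula are computed from the atomic ones by
    reversing the loss of precision of [extend_sim] at each quantifier. *)
Lemma sim_holds n f : vars_below n f ->
  holds_when_similar n (fun R S e e' => holds e f <-> holds e' f).
Proof.
have two P1 P2 : holds_when_similar n P1 -> holds_when_similar n P2 ->
    holds_when_similar n (fun R S e e' => P1 R S e e' /\ P2 R S e e').
  move=> [N1 [q1 [N10 q10 H1]]] [N2 [q2 [N20 q20 H2]]].
  exists (maxn N1 N2), (q1 * q2)%N; split; [by rewrite leq_max N10 | by rewrite muln_gt0 q10|].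
  move=> R S m Q R0 S0 p p' rho e e' hcl qQ hs; have hr := cl_rel hcl.
  split; [apply: (H1 _ _ m Q R0 S0 p p' rho) => // | apply: (H2 _ _ m Q R0 S0 p p' rho) => //].
  - by apply: dvdn_trans qQ; apply: dvdn_mulr.
  - by apply: sim_weaken hs => //; [apply: leq_maxl | apply: dvdn_mulr].
  - by apply: dvdn_trans qQ; apply: dvdn_mull.
  - by apply: sim_weaken hs => //; [apply: leq_maxr | apply: dvdn_mull].
have ext i P : (i < n)%N -> holds_when_similar n P ->
    holds_when_similar n (fun R S e e' =>
      (forall x, exists y, P R S (env_upd e i x) (env_upd e' i y)) /\
      (forall y, exists x, P R S (env_upd e i x) (env_upd e' i y))).
  move=> ni [N [q [N0 q0 H]]]; exists (2 * N ^ 2)%N, (q * N`!)%N.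
  split; [by rewrite muln_gt0 expn_gt0 N0 | by rewrite muln_gt0 q0 fact_gt0 |].
  move=> R S m Q R0 S0 p p' rho e e' hcl qQ hs.
  have qQ' : (q %| Q)%N by apply: dvdn_trans qQ; apply: dvdn_mulr.
  case: (hcl) => m0 sR0 sS0 hr hf hb; split=> [x|y].
    have [y hy] := extend_sim (Ordinal ni) x m0 N0 q0 qQ sR0 sS0 hr hf
      (hc_rep hb) (hc_mult hb) (hc_free hb) hs.
    by exists y; apply: (H _ _ m Q R0 S0 p p' rho).
  have hr' := cl_rel (closeness_sym hcl).
  have [x hx] := extend_sim (Ordinal ni) y m0 N0 q0 qQ sS0 sR0 hr' hb
    (hc_rep hf) (hc_mult hf) (hc_free hf) (sim_sym hs).
  by exists x; apply: (H _ _ m Q R0 S0 p p' rho) => //; apply: sim_sym hx.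
elim: f => [t1 t2|f1 IH|f1 IH1 f2 IH2|f1 IH1 f2 IH2|f1 IH1 f2 IH2|i f1 IH|i f1 IH] /=.
- rewrite all_cat => /andP[t1n t2n].
  exists (\sum_(j < n) `|linear_part t1 j - linear_part t2 j|).+1, 1%N; split=> //.
  move=> R S m Q R0 S0 p p' rho e e' hcl _ hs.
  have {}hs := sim_weaken (cl_rel hcl) (leqnSn _) (dvdnn 1) hs.
  split; first exact: close_eq hcl t1n t2n hs.
  exact: close_eq (closeness_sym hcl) t1n t2n (sim_sym hs).
- move=> /IH[N [q [N0 q0 H]]]; exists N, q; split=> //.
  move=> R S m Q R0 S0 p p' rho e e' hcl qQ hs.
  by have := H _ _ m Q R0 S0 p p' rho e e' hcl qQ hs; tauto.
- move=> /andP[/IH1 h1 /IH2 h2]; have [N [q [N0 q0 H]]] := two _ _ h1 h2.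
  exists N, q; split=> // R S m Q R0 S0 p p' rho e e' hcl qQ hs.
  by have := H _ _ m Q R0 S0 p p' rho e e' hcl qQ hs; tauto.
- move=> /andP[/IH1 h1 /IH2 h2]; have [N [q [N0 q0 H]]] := two _ _ h1 h2.
  exists N, q; split=> // R S m Q R0 S0 p p' rho e e' hcl qQ hs.
  by have := H _ _ m Q R0 S0 p p' rho e e' hcl qQ hs; tauto.
- move=> /andP[/IH1 h1 /IH2 h2]; have [N [q [N0 q0 H]]] := two _ _ h1 h2.
  exists N, q; split=> // R S m Q R0 S0 p p' rho e e' hcl qQ hs.
  by have := H _ _ m Q R0 S0 p p' rho e e' hcl qQ hs; tauto.
- move=> /andP[ni /IH h1]; have [N [q [N0 q0 H]]] := ext _ _ ni h1.
  exists N, q; split=> // R S m Q R0 S0 p p' rho e e' hcl qQ hs.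
  have [Hx Hy] := H _ _ m Q R0 S0 p p' rho e e' hcl qQ hs.
  split=> [h y|h x]; first by have [x [hxy _]] := Hy y; apply: hxy.
  by have [y [_ hyx]] := Hx x; apply: hyx.
- move=> /andP[ni /IH h1]; have [N [q [N0 q0 H]]] := ext _ _ ni h1.
  exists N, q; split=> // R S m Q R0 S0 p p' rho e e' hcl qQ hs.
  have [Hx Hy] := H _ _ m Q R0 S0 p p' rho e e' hcl qQ hs.
  split=> [[x h]|[y h]].
    by have [y [hxy _]] := Hx x; exists y; apply: hxy.
  by have [x [_ hyx]] := Hy y; exists x; apply: hyx.
Qed.

Lemma term_eval_ext (R : naRingType) (e e' : nat -> R) t :
  (forall i, i \in term_vars t -> e i = e' i) -> term_eval e t = term_eval e' t.
Proof.
elim: t => [i|| t1 IH1 t2 IH2|t1 IH1 t2 IH2] //= H.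
- by apply: H; rewrite inE.
- by rewrite IH1 ?IH2 // => i it; apply: H; rewrite mem_cat it ?orbT.
- by rewrite IH1 ?IH2 // => i it; apply: H; rewrite mem_cat it ?orbT.
Qed.

Lemma holds_ext (R : naRingType) (e e' : nat -> R) f :
  (forall i, i \in free_vars f -> e i = e' i) -> holds e f <-> holds e' f.
Proof.
have cat_ext (e1 e2 : nat -> R) s1 s2 : (forall i, i \in s1 ++ s2 -> e1 i = e2 i) ->
    (forall i, i \in s1 -> e1 i = e2 i) /\ (forall i, i \in s2 -> e1 i = e2 i).
  by move=> H; split=> i it; apply: H; rewrite mem_cat it ?orbT.
have upd_ext (e1 e2 : nat -> R) f1 i x :
    (forall j, j \in [seq j <- free_vars f1 | j != i] -> e1 j = e2 j) ->
    forall j, j \in free_vars f1 -> env_upd e1 i x j = env_upd e2 i x j.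
  move=> H j jf; rewrite /env_upd; case: eqP => // /eqP ji.
  by apply: H; rewrite mem_filter ji.
elim: f e e' => [t1 t2|f1 IH|f1 IH1 f2 IH2|f1 IH1 f2 IH2|f1 IH1 f2 IH2|i f1 IH|i f1 IH] e e' /= H.
- by have [/term_eval_ext-> /term_eval_ext->] := cat_ext _ _ _ _ H.
- by have := IH _ _ H; tauto.
1-3: by have [/IH1 h1 /IH2 h2] := cat_ext _ _ _ _ H; tauto.
- by split=> h x; apply/(IH _ _ (upd_ext _ _ _ _ x H)).
- by split=> -[x h]; exists x; apply/(IH _ _ (upd_ext _ _ _ _ x H)).
Qed.

Lemma sentence_satisfies (R : naRingType) f (e : nat -> R) :
  sentence f -> satisfies R f <-> holds e f.
Proof.
move=> sf; split=> [/(_ e)//|h e'].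
by apply/(@holds_ext R e e') => // i; rewrite sf.
Qed.

Lemma close_elem_equiv (R S : naRingType) (m : nat) :
  (forall Q, (0 < Q)%N -> exists R0 S0 p p' rho, @closeness R S m Q R0 S0 p p' rho) ->
  elem_equiv R S.
Proof.
move=> hQ f sf; have [n nf] := vars_below_ex f.
have [N [q [N0 q0 H]]] := sim_holds nf.
have [R0 [S0 [p [p' [rho hcl]]]]] := hQ q q0.
rewrite (sentence_satisfies (fun=> 0) sf) (sentence_satisfies (fun=> 0) sf).
apply: (H _ _ m q R0 S0 p p' rho) => //; split=> [j|c _]; first exact: (cr_0 (cl_rel hcl)).
by split=> _; rewrite /lc big1 // => j _; rewrite raddf0 mul0rz.
Qed.

(** * Adjusting an embedding along an addition *)

Definition additive_on (G H : zmodType) (A : set G) (f : G -> H) :=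
  forall x y, A x -> A y -> f (x - y) = f x - f y.

Section AdditiveOn.
Variables (G H : zmodType) (A : set G) (f : G -> H).
Hypotheses (sA : is_subgroup A) (fB : additive_on A f).

Lemma aon0 : f 0 = 0.
Proof. by rewrite -(subrr 0) fB ?subrr //; apply: subg0. Qed.

Lemma aonN x : A x -> f (- x) = - f x.
Proof. by move=> Ax; rewrite -sub0r fB ?aon0 ?sub0r //; apply: subg0. Qed.

Lemma aonD x y : A x -> A y -> f (x + y) = f x + f y.
Proof. by move=> Ax Ay; rewrite -{1}[y]opprK fB ?aonN ?opprK //; apply: subgN. Qed.

Lemma aonMn x n : A x -> f (x *+ n) = f x *+ n.
Proof.
move=> Ax; elim: n => [|n IH]; first by rewrite !mulr0n aon0.
by rewrite !mulrS aonD ?IH //; apply: subgMn.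
Qed.

Lemma aonMz x (c : int) : A x -> f (x *~ c) = f x *~ c.
Proof.
move=> Ax; case: c => n; first exact: aonMn.
by rewrite NegzE !mulrNz aonN ?aonMn //; apply: subgMn.
Qed.

End AdditiveOn.

Lemma lc_lc (G : zmodType) n d (b : 'I_d -> G) (P : 'I_n -> 'I_d -> int) c :
  lc (fun i => lc b (P i)) c = lc b (fun j => \sum_i P i j * c i).
Proof.
rewrite /lc; under eq_bigr => i _ do rewrite mulrz_suml.
rewrite exchange_big; apply: eq_bigr => j _; rewrite mulrz_sumr.
by apply: eq_bigr => i _; rewrite mulrzA.
Qed.

Lemma basis_lc_inj (G : zmodType) (A : set G) d (b : 'I_d -> G) c c' :
  basis_mod A [set 0] b -> lc b c = lc b c' -> c =1 c'.
Proof.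
move=> [_ _ b0] E i; apply/eqP; rewrite -subr_eq0; apply/eqP.
by apply: (b0 (fun i => c i - c' i)); rewrite /= lcB E subrr.
Qed.

Lemma basis_gen (G : zmodType) (A : set G) d (b : 'I_d -> G) x :
  basis_mod A [set 0] b -> A x -> exists c, x = lc b c.
Proof.
by move=> [_ bA _] /bA[c /= /eqP]; rewrite subr_eq0 => /eqP->; exists c.
Qed.

(** If [P] and [P'] are the matrices of [f] and of [k] times its inverse, then
    both products are [k] times the identity, and they have the same trace. *)
Lemma finite_index_rank (G H : zmodType) (f : {additive G -> H}) (A : set G) (B : set H)
    d (b : 'I_d -> G) d' (b' : 'I_d' -> H) (k : nat) :
  injective f -> (0 < k)%N -> is_subgroup A -> is_subgroup B ->
  basis_mod A [set 0] b -> basis_mod B [set 0] b' ->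
  (forall x, A x -> B (f x)) -> (forall y, B y -> exists2 x, A x & f x = y *+ k) ->
  d = d'.
Proof.
move=> fI k0 sA sB hb hb' fAB fk; have [bA _ _] := hb; have [bB _ _] := hb'.
have /choice[P HP] : forall i, exists c : 'I_d' -> int, f (b i) = lc b' c.
  by move=> i; apply: (basis_gen hb'); apply: fAB.
have /choice[P' HP'] : forall j, exists c : 'I_d -> int, f (lc b c) = b' j *+ k.
  move=> j; have [x Ax Ex] := fk _ (bB j).
  by have [c Ec] := basis_gen hb Ax; exists c; rewrite -Ec.
have fE c : f (lc b c) = lc b' (fun j => \sum_i P i j * c i).
  by rewrite lc_raddf -lc_lc; congr lc; apply/funext => i.
have E2 j l : \sum_i P' j i * P i l = (l == j)%:Z * k%:Z.
  have := HP' j; rewrite fE -(lc_delta b' j) pmulrn -lcM.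
  by move=> /(basis_lc_inj hb')/(_ l) <-; apply: eq_bigr => i _; rewrite mulrC.
have E1 i l : \sum_j P i j * P' j l = (l == i)%:Z * k%:Z.
  have : lc b (fun l => \sum_j P i j * P' j l) = lc b (fun l => (l == i)%:Z * k%:Z).
    apply: fI; rewrite lcM lc_delta raddfMz /= HP fE.
    transitivity (lc b' (P i) *~ k); last by [].
    rewrite -lcM; congr lc; apply/funext => j.
    under eq_bigr => i' _ do rewrite mulr_sumr.
    rewrite exchange_big /= (bigD1 j) //= [X in _ + X]big1 => [|j' jj].
      under eq_bigr => i' _ do rewrite mulrCA [P i' j * _]mulrC.
      by rewrite -mulr_sumr E2 eqxx mul1r addr0.
    under eq_bigr => i' _ do rewrite mulrCA [P i' j * _]mulrC.
    by rewrite -mulr_sumr E2 eq_sym (negPf jj) mul0r mulr0.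
  by move=> /(basis_lc_inj hb)/(_ l).
have T1 : \sum_i \sum_j P i j * P' j i = d%:Z * k%:Z.
  under eq_bigr => i _ do rewrite E1 eqxx mul1r.
  by rewrite sumr_const card_ord -mulr_natl natz.
have T2 : \sum_i \sum_j P i j * P' j i = d'%:Z * k%:Z.
  rewrite exchange_big /=.
  under eq_bigr => j _ do (under eq_bigr => i _ do rewrite mulrC).
  under eq_bigr => j _ do rewrite E2 eqxx mul1r.
  by rewrite sumr_const card_ord -mulr_natl natz.
apply/eqP; rewrite -eqz_nat -(inj_eq (mulIf (x := k%:Z) _)) ?T1 -?T2 ?eqxx //.
  by rewrite -T1 T2.
by rewrite eqz_nat -lt0n.
Qed.

Lemma subg_iso (G H : zmodType) (f : {additive G -> H}) (A : set G) (B : set H)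
    d (b : 'I_d -> G) d' (b' : 'I_d' -> H) (k : nat) :
  injective f -> (0 < k)%N -> is_subgroup A -> is_subgroup B ->
  basis_mod A [set 0] b -> basis_mod B [set 0] b' ->
  (forall x, A x -> B (f x)) -> (forall y, B y -> exists2 x, A x & f x = y *+ k) ->
  exists (g : G -> H) (g' : H -> G),
    [/\ forall x, A x -> B (g x), forall y, B y -> A (g' y),
        forall x, A x -> g' (g x) = x & forall y, B y -> g (g' y) = y] /\
    (additive_on A g /\ additive_on B g').
Proof.
move=> fI k0 sA sB hb hb' fAB fk.
have E := finite_index_rank fI k0 sA sB hb hb' fAB fk.
case: d' / E b' hb' => b' hb'.
have sA0 : [set (0 : G)] `<=` A by move=> _ ->; apply: subg0.
have sB0 : [set (0 : H)] `<=` B by move=> _ ->; apply: subg0.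
have [v [vA vB _ vl]] := coordinates sA (@subg_set0 _) sA0 hb.
have [w [wA wB _ wl]] := coordinates sB (@subg_set0 _) sB0 hb'.
have [bA _ _] := hb; have [bB _ _] := hb'.
have vE x : A x -> lc b (v x 0) = x by move=> /vA/eqP; rewrite subr_eq0 => /eqP.
have wE x : B x -> lc b' (w x 0) = x by move=> /wA/eqP; rewrite subr_eq0 => /eqP.
have row0 (r : 'rV[int]_d) : \row_i r 0 i = r.
  by apply/rowP => i; rewrite mxE.
exists (fun x => lc b' (v x 0)), (fun y => lc b (w y 0)); split; split.
- by move=> x _; apply: subg_lc.
- by move=> y _; apply: subg_lc.
- by move=> x Ax; rewrite wl row0 vE.
- by move=> y By; rewrite vl row0 wE.
- move=> x y Ax Ay; rewrite vB // -lcB; congr lc; apply/funext => i; by rewrite !mxE.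
- move=> x y Bx By; rewrite wB // -lcB; congr lc; apply/funext => i; by rewrite !mxE.
Qed.

(** By the Chinese remainder theorem there is a combination of [f] and of an
    isomorphism from [A] onto [B] that agrees with [f] modulo [m] and with the
    isomorphism modulo the part of [Q] prime to [m]. It is invertible modulo
    [m Q], because [f] already is invertible modulo the powers of the primes
    dividing [m]. *)
Lemma approximate_iso (G H : zmodType) (f : {additive G -> H}) (A : set G) (B : set H)
    d (b : 'I_d -> G) d' (b' : 'I_d' -> H) (k m Q : nat) :
  injective f -> (0 < k)%N -> (0 < m)%N -> (0 < Q)%N -> coprime k m ->
  is_subgroup A -> is_subgroup B ->
  basis_mod A [set 0] b -> basis_mod B [set 0] b' ->
  (forall x, A x -> B (f x)) -> (forall y, B y -> exists2 x, A x & f x = y *+ k) ->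
  exists lam : G -> H,
    [/\ forall x, A x -> B (lam x),
        additive_on A lam,
        forall x, A x -> exists2 y, B y & lam x = f x + y *+ m,
        forall y, B y -> exists x y', [/\ A x, B y' & y = lam x + y' *+ Q]
      & forall q x y, (q %| Q)%N -> A x -> B y -> lam x = y *+ (m * q) ->
          exists2 x', A x' & x = x' *+ (m * q)].
Proof.
move=> fI k0 m0 Q0 km sA sB hb hb' fAB fk.
have [g [g' [[gB g'A g'K gK] [gD g'D]]]] := subg_iso fI k0 sA sB hb hb' fAB fk.
have /choice[h Hh] : forall y, exists x, B y -> A x /\ f x = y *+ k.
  move=> y; have [/fk[x Ax Ex]|nB] := pselect (B y); last by exists 0.
  by exists x.
have hA y : B y -> A (h y) by move=> /Hh[].
have hf y : B y -> f (h y) = y *+ k by move=> /Hh[].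
have hK x : A x -> h (f x) = x *+ k.
  by move=> Ax; apply: fI; rewrite hf ?raddfMn //; apply: fAB.
have hD : additive_on B h.
  by move=> x y Bx By; apply: fI; rewrite raddfB /= !hf ?mulrnBl //; apply: subgB.
(* [a Q' = m Q], where [a] has the same primes as [m] and [Q'] is prime to [m];
   [u] is 1 modulo [a] and 0 modulo [Q'], and [v] is the other way around. *)
pose Qm := partn Q \pi(m); pose a := (m * Qm)%N; pose Q' := partn Q \pi(m)^'.
have aQ : (a * Q' = m * Q)%N by rewrite -mulnA partnC.
have aQ' : coprime a Q'.
  rewrite coprimeMl coprime_partC andbT.
  by rewrite -(part_pnat_id (pnat_pi m0)) coprime_partC.
have ka : coprime k a.
  rewrite coprimeMr km coprime_sym; apply: (@pnat_coprime \pi(m)); first exact: part_pnat.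
  by rewrite -coprime_pi' // coprime_sym.
have bez (x y : nat) : coprime x y -> exists s t : int, x%:Z * s + y%:Z * t = 1.
  move=> xy; have [s [t E]] := Bezoutz x y; exists s, t.
  by rewrite mulrC [y%:Z * t]mulrC E /gcdz /= (eqP xy).
have [s [t Est]] := bez _ _ aQ'.
have [kb [w Ek]] := bez _ _ ka.
pose u := Q'%:Z * t; pose v := a%:Z * s.
have uv1 : u = 1 - v by rewrite -Est /u /v; ring.
pose lam x := f x *~ u + g x *~ v.
pose mu y := h y *~ (u * kb) + g' y *~ v.
have lamB x : A x -> B (lam x).
  by move=> Ax; apply: subgD => //; apply: subgMz => //; [apply: fAB | apply: gB].
have muA y : B y -> A (mu y).
  by move=> By; apply: subgD => //; apply: subgMz => //; [apply: hA | apply: g'A].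
have lamD : additive_on A lam.
  by move=> x y Ax Ay; rewrite /lam gD // raddfB !mulrzBl opprD addrACA.
have muD : additive_on B mu.
  by move=> x y Bx By; rewrite /mu g'D // hD // !mulrzBl opprD addrACA.
have E1 : u * u * kb * k%:Z + v * v = 1 + (m * Q)%:Z * (- (2 * s * t + Q'%:Z * t * t * w)).
  have -> : u * u * kb * k%:Z = u * u * (1 - a%:Z * w) by rewrite -Ek; ring.
  have -> : (m * Q)%:Z = a%:Z * Q'%:Z by rewrite -aQ PoszM.
  rewrite /u /v; transitivity ((Q'%:Z * t + a%:Z * s) ^+ 2
      - a%:Z * Q'%:Z * (2 * s * t + Q'%:Z * t * t * w)); first by ring.
  by rewrite [Q'%:Z * t + _]addrC Est; ring.
have E2 : u * v = (m * Q)%:Z * (s * t).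
  by rewrite /u /v -aQ PoszM; ring.
(* Both composites of [lam] and [mu] are this combination, with [x] the argument
   and [y], [z] the two mixed terms. *)
have comb (X : zmodType) (x y z : X) :
    x *~ (u * u * kb * k%:Z + v * v) + y *~ (u * kb * v) + z *~ (u * v)
    = x + (x *~ (- (2 * s * t + Q'%:Z * t * t * w)) + y *~ (s * t * kb) + z *~ (s * t))
      *+ (m * Q).
  have -> : u * kb * v = (s * t * kb) * (m * Q)%:Z by rewrite -mulrA [kb * v]mulrC mulrA E2; ring.
  rewrite E1 E2 mulrzDr mulr1z pmulrn !mulrzDl -!mulrzA -!addrA.
  by congr (_ + (_ *~ _ + (_ + _ *~ _))); rewrite mulrC.
have muK x : A x -> exists2 x', A x' & mu (lam x) = x + x' *+ (m * Q).
  move=> Ax; have Bf := fAB _ Ax; have Bg := gB _ Ax.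
  rewrite /mu /lam (aonD sB hD) ?(aonD sB g'D) ?(aonMz sB hD) ?(aonMz sB g'D) //;
    try exact: subgMz.
  rewrite hK // g'K //.
  exists (x *~ (- (2 * s * t + Q'%:Z * t * t * w)) + h (g x) *~ (s * t * kb) + g' (f x) *~ (s * t)).
    by do !apply: subgD => //; apply: subgMz => //; [apply: hA | apply: g'A].
  rewrite -comb !mulrzDl !pmulrn -!mulrzA mulrzDr addrAC -!addrA; congr (_ *~ _ + _).
    by ring.
  rewrite addrCA; congr (_ + _); rewrite [RHS]addrC; congr (_ *~ _ + _ *~ _); ring.
have lamK y : B y -> exists2 y', B y' & lam (mu y) = y + y' *+ (m * Q).
  move=> By; have Ah := hA _ By; have Ag := g'A _ By.
  rewrite /mu /lam (aonD sA gD) ?(aonMz sA gD) //; try exact: subgMz.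
  rewrite raddfD /= !raddfMz /= hf // gK //.
  exists (y *~ (- (2 * s * t + Q'%:Z * t * t * w)) + g (h y) *~ (s * t * kb) + f (g' y) *~ (s * t)).
    by do !apply: subgD => //; apply: subgMz => //; [apply: gB | apply: fAB].
  rewrite -comb !mulrzDl !pmulrn -!mulrzA mulrzDr addrAC -!addrA; congr (_ *~ _ + _).
    by ring.
  by rewrite addrCA [v * u]mulrC.
exists lam; split=> //.
- move=> x Ax; exists ((g x - f x) *~ (Qm%:Z * s)).
    by apply: subgMz => //; apply: subgB => //; [apply: gB | apply: fAB].
  rewrite /lam uv1 mulrzBr mulr1z -addrA [- _ + _]addrC -mulrzBl /v /a.
  by congr (_ + _); rewrite pmulrn -mulrzA; congr (_ *~ _); rewrite PoszM; ring.
- move=> y By; have [y' By' E] := lamK y By.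
  exists (mu y), (- (y' *+ m)); split; [exact: muA | by apply: subgN => //; apply: subgMn|].
  by rewrite E mulrnA mulNrn addrK.
- move=> q x y /dvdnP[c Ec] Ax By E.
  have [x' Ax' E'] := muK x Ax; exists (mu y - x' *+ c).
    by apply: subgB => //; [apply: muA | apply: subgMn].
  rewrite mulrnBl -(aonMn sB muD) // -E E' -mulrnA Ec.
  by rewrite (_ : c * (m * q) = m * (c * q))%N ?addrK //; lia.
Qed.

Section Adjust.
Variables (R S : naRingType) (phi : {additive R -> S}) (R0 : set R) (S0 : set S).
Hypotheses (phiM : na_multiplicative phi) (phiI : injective phi).
Hypotheses (aR0 : is_addition R0) (aS0 : is_addition S0).
Hypothesis gen : forall y, exists x, S0 (y - phi x).
Hypothesis ker : forall x, S0 (phi x) <-> R0 x.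
Variables (m : nat) (p : {additive R -> R}).
Hypotheses (m0 : (0 < m)%N) (Rp : forall x, R0 (p x)).
Hypotheses (pM : forall x y, p (x ** y) = 0) (pm : forall r, R0 r -> p r = r *+ m).

Let sR0 := subg_addition aR0.
Let sS0 := subg_addition aS0.

(** [theta = phi + beta p] with [lam = phi + m beta] on [R0]; it is multiplicative
    because [p] kills products and [beta] takes values in the annihilator. *)
Lemma twist (lam : R -> S) : (forall r, R0 r -> S0 (lam r)) -> additive_on R0 lam ->
  (forall r, R0 r -> exists2 s, S0 s & lam r = phi r + s *+ m) ->
  exists theta : {additive R -> S}, [/\ na_multiplicative theta,
    forall r, R0 r -> theta r = lam r & forall x, S0 (theta x - phi x)].
Proof.
move=> lamS lamB lamE.
have /choice[be Hbe] : forall r, exists s, R0 r -> S0 s /\ lam r = phi r + s *+ m.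
  move=> r; have [/lamE[s S0s E]|nr] := pselect (R0 r); last by exists 0.
  by exists s.
have beS r : R0 r -> S0 (be r) by move=> /Hbe[].
have beE r : R0 r -> lam r = phi r + be r *+ m by move=> /Hbe[].
have be_uniq r s : R0 r -> S0 s -> lam r = phi r + s *+ m -> be r = s.
  move=> R0r S0s; rewrite beE // => /addrI/eqP; rewrite -subr_eq0 -mulrnBl => /eqP E.
  apply/eqP; rewrite -subr_eq0; apply/eqP; apply: (addition_free_n aS0 _ m0 E).
  by apply: subgB => //; apply: beS.
have beB : additive_on R0 be.
  move=> x y Rx Ry; apply: be_uniq; first exact: subgB.
    by apply: subgB => //; apply: beS.
  by rewrite lamB // !beE // raddfB mulrnBl opprD addrACA.
have [theta thE] : exists theta : {additive R -> S}, theta =1 (fun x => phi x + be (p x)).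
  by apply: additive_of => x y; rewrite !raddfB beB // opprD addrACA.
have be0 : be 0 = 0 by apply: aon0 beB.
have S0A s : S0 s -> Ann S s by apply: addition_Ann.
exists theta; split=> [x y|r R0r|x].
- rewrite !thE phiM pM be0 addr0 namulDl !namulDr.
  have [_ ->] := S0A _ (beS _ (Rp y)) (phi x).
  have [-> _] := S0A _ (beS _ (Rp x)) (phi y).
  by have [-> _] := S0A _ (beS _ (Rp x)) (be (p y)); rewrite !addr0.
- by rewrite thE pm // (aonMn sR0 beB) // beE.
- by rewrite thE addrAC subrr add0r; apply: beS.
Qed.

(** The projection of [S] onto [S0] is transported from that of [R], so that it
    commutes with [theta]. *)
Lemma closeness_exists (k Q : nat) : FDZ_algebra R -> FDZ_algebra S ->
  (0 < k)%N -> (0 < Q)%N -> coprime k m ->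
  (forall s, S0 s -> exists2 r, R0 r & phi r = s *+ k) ->
  exists p' rho, closeness m Q R0 S0 p p' rho.
Proof.
move=> hR hS k0 Q0 km fk.
have [d [b hb]] := addition_basis hR aR0; have [d' [b' hb']] := addition_basis hS aS0.
have phiS r : R0 r -> S0 (phi r) by move=> /ker.
have [lam [lamS lamB lamE lam_surj lam_inj]] :=
  approximate_iso phiI k0 m0 Q0 km sR0 sS0 hb hb' phiS fk.
have [theta [thM thE thS]] := twist lamS lamB lamE.
have thker x : S0 (theta x) -> R0 x.
  by move=> h; apply/ker; apply: subg_subr h (thS x).
have thgen y : exists x, S0 (y - theta x).
  have [x Hx] := gen y; exists x; have := subgB sS0 Hx (thS x).
  by rewrite opprB addrA subrK.
have lam0 : lam 0 = 0 by apply: aon0 lamB.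
have S0A s : S0 s -> Ann S s by apply: (addition_Ann aS0).
have /choice[pS HpS] : forall y, exists z, exists x s,
    [/\ S0 s, y = theta x + s & z = lam (p x) + s *+ m].
  move=> y; have [x Hx] := thgen y; exists (lam (p x) + (y - theta x) *+ m), x, (y - theta x).
  by split=> //; rewrite addrC subrK.
have pSE x s : S0 s -> pS (theta x + s) = lam (p x) + s *+ m.
  move=> S0s; have [x' [s' [S0s' E ->]]] := HpS (theta x + s).
  have Ex : theta (x - x') = s' - s.
    by rewrite raddfB; apply/eqP; rewrite subr_eq addrAC -[theta x](addrK s) E [_ + s']addrC.
  have R0x : R0 (x - x') by apply: thker; rewrite Ex; apply: subgB.
  have : lam (p x) - lam (p x') = (s' - s) *+ m.
    by rewrite -lamB // -raddfB pm // (aonMn sR0 lamB) // -(thE (x - x')) // Ex.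
  rewrite mulrnBl => /eqP; rewrite subr_eq addrAC eq_sym subr_eq.
  by rewrite [s' *+ m + _]addrC => /eqP.
have [p' Ep'] : exists p' : {additive S -> S}, p' =1 pS.
  apply: additive_of => y y'; have [x [s [S0s -> ->]]] := HpS y.
  have [x' [s' [S0s' -> ->]]] := HpS y'.
  rewrite opprD addrACA -raddfB pSE; last exact: subgB.
  by rewrite raddfB lamB // mulrnBl opprD addrACA.
have p'E x s : S0 s -> p' (theta x + s) = lam (p x) + s *+ m.
  by move=> S0s; rewrite Ep' pSE.
have p'M y y' : p' (y ** y') = 0.
  have [x [s [S0s -> _]]] := HpS y; have [x' [s' [S0s' -> _]]] := HpS y'.
  rewrite namulDl !namulDr.
  have [-> _] := S0A _ S0s s'; have [-> _] := S0A _ S0s (theta x').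
  have [_ ->] := S0A _ S0s' (theta x); rewrite !addr0 -thM -[theta _]addr0.
  by rewrite p'E ?pM ?lam0 ?mul0rn ?addr0 //; apply: subg0.
pose rho q x y := exists2 s, S0 s & y = theta x + s *+ q.
exists p', rho; split=> //.
- split.
  + by move=> q; exists 0; [exact: subg0 | rewrite raddf0 mul0rn addr0].
  + move=> q x x' y y' [s S0s ->] [s' S0s' ->]; exists (s - s'); first exact: subgB.
    by rewrite raddfB mulrnBl opprD addrACA.
  + move=> q q' x y /dvdnP[c ->] [s S0s ->]; exists (s *+ c); first exact: subgMn.
    by rewrite mulrnA.
  + move=> x x' y y' [s S0s ->] [s' S0s' ->]; exists 0; first exact: subg0.
    rewrite mul0rn addr0 !mulr1n thM namulDl !namulDr.
    have [-> _] := S0A _ S0s (theta x'); have [-> _] := S0A _ S0s s'.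
    by have [_ ->] := S0A _ S0s' (theta x); rewrite !addr0.
- split=> //.
  + by move=> r c R0r; apply: addition_free R0r.
  + by move=> x; exists (theta x), 0; [exact: subg0 | rewrite mul0rn addr0].
  + move=> q x y s S0s [s' S0s' ->]; exists (s' + s); first exact: subgD.
    by rewrite mulrnDl addrA.
  + move=> q x y qQ px [s S0s ->]; exists s => //.
    by rewrite p'E ?px ?lam0 ?add0r; [rewrite -mulrnA mulnC | apply: subgMn].
  + move=> y [s S0s ->]; rewrite mulr1n p'E // raddf0 raddf0 lam0 !add0r.
    exact: (addition_free_n aS0 S0s m0).
  + move=> S00 r R0r; apply: phiI; rewrite raddf0; apply: S00.
    exact: phiS.
- split=> //.
  + move=> y; have [x [s [S0s _]]] := HpS y; rewrite -Ep' => ->.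
    by apply: subgD => //; [apply: lamS | apply: subgMn].
  + move=> s S0s; rewrite -[s in LHS]add0r -(raddf0 theta) p'E // raddf0 lam0.
    by rewrite add0r.
  + by move=> s c S0s; apply: addition_free S0s.
  + move=> y; have [x S0y] := thgen y; have [r [s' [R0r S0s' E]]] := lam_surj _ S0y.
    exists (x + r), s' => //; rewrite raddfD /= (thE r) //.
    by rewrite -addrA -E addrC subrK.
  + move=> q y x r R0r [s S0s ->]; exists (s - lam r).
      by apply: subgB => //; apply: lamS.
    rewrite raddfD raddfMn /= (thE r) // mulrnBl addrACA -addrA; congr (_ + _).
    by rewrite addrA addrK.
  + move=> q y x qQ p'y [s S0s E]; move: p'y; rewrite E p'E; last exact: subgMn.
    rewrite -mulrnA mulnC => /eqP; rewrite addr_eq0 -mulNrn => /eqP.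
    by apply: lam_inj => //; apply: subgN.
  + move=> x [s S0s /esym/eqP]; rewrite mulr1n addr_eq0 => /eqP E px.
    have R0x : R0 x by apply: thker; rewrite E; apply: subgN.
    by apply: (addition_free_n aR0 R0x m0); rewrite -pm.
  + move=> R00 s S0s; have [r R0r E] := fk s S0s.
    by apply: (addition_free_n aS0 S0s k0); rewrite -E (R00 _ R0r) raddf0.
Qed.

End Adjust.

(** * Isomorphisms induced on quotients *)

Lemma induces_isoP (G H : zmodType) (f : {additive G -> H}) (A B : set G) (C D : set H) :
  is_subgroup A -> is_subgroup B -> is_subgroup D ->
  induces_iso f A B C D ->
  (forall x, A x -> D (f x) -> B x) /\ (forall y, C y -> exists2 x, A x & D (y - f x)).
Proof.
move=> sA sB sD [F FE [Ff FI FS]]; split=> [x Ax Dx|y Cy].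
  have A0 := subg0 sA; rewrite -[x]subr0; apply/(add_coset_eq _ _ sB).
  apply: FI; rewrite ?inE; [by exists x | by exists 0 |].
  by rewrite !FE // raddf0; apply/(add_coset_eq _ _ sD); rewrite subr0.
have [|_ [x Ax <-]] := FS (add_coset D y); first by exists y.
by rewrite FE // => /esym/(add_coset_eq _ _ sD) Dy; exists x.
Qed.

Lemma induces_isoI (G H : zmodType) (f : {additive G -> H}) (A B : set G) (C D : set H) :
  is_subgroup A -> is_subgroup B -> is_subgroup D ->
  (forall x, A x -> C (f x)) -> (forall x, A x -> (B x <-> D (f x))) ->
  (forall y, C y -> exists2 x, A x & D (y - f x)) ->
  induces_iso f A B C D.
Proof.
move=> sA sB sD fAC fBD fS.
have cosetE x x' : A x -> A x' ->
    (add_coset B x = add_coset B x' <-> add_coset D (f x) = add_coset D (f x')).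
  move=> Ax Ax'; rewrite !add_coset_eq // -raddfB; apply: fBD.
  exact: subgB.
have /choice[F HF] : forall X : set G, exists Y : set H,
    forall x, A x -> X = add_coset B x -> Y = add_coset D (f x).
  move=> X; have [[x Ax EX]|nX] := pselect (exists2 x, A x & X = add_coset B x).
    by exists (add_coset D (f x)) => x' Ax'; rewrite EX => /cosetE; apply.
  by exists set0 => x Ax EX; case: nX; exists x.
have FE x : A x -> F (add_coset B x) = add_coset D (f x).
  by move=> Ax; apply: HF.
exists F => //; split.
- by move=> _ [x Ax <-]; rewrite FE //; exists (f x) => //; apply: fAC.
- move=> X Y; rewrite !inE => -[x Ax <-] [x' Ax' <-]; rewrite !FE //.
  by move/cosetE; apply.
- move=> _ [y Cy <-]; have [x Ax Dy] := fS y Cy.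
  exists (add_coset B x); first by exists x.
  by rewrite FE //; apply/esym/(add_coset_eq _ _ sD).
Qed.

Lemma iso_elem_equiv (R S : naRingType) : ring_isomorphic R S -> elem_equiv R S.
Proof.
move=> [phi [phiM [psi phiK psiK]]].
have termE (e : nat -> R) t : term_eval (phi \o e) t = phi (term_eval e t).
  elim: t => [i||t1 IH1 t2 IH2|t1 IH1 t2 IH2] //=; first by rewrite raddf0.
    by rewrite raddfD IH1 IH2.
  by rewrite phiM IH1 IH2.
have updE (e : nat -> R) i x : phi \o env_upd e i x = env_upd (phi \o e) i (phi x).
  by apply/funext => j; rewrite /= /env_upd; case: eqP.
have holdsE f : forall e : nat -> R, holds e f <-> holds (phi \o e) f.
  elim: f => [t1 t2|f1 IH|f1 IH1 f2 IH2|f1 IH1 f2 IH2|f1 IH1 f2 IH2|i f1 IH|i f1 IH] e /=.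
  - by rewrite !termE; split=> [->|/(can_inj phiK)].
  - by have := IH e; tauto.
  1-3: by have := IH1 e; have := IH2 e; tauto.
  - split=> h x; last by apply/IH; rewrite updE; apply: h.
    by rewrite -(psiK x) -updE; apply/IH.
  - split=> -[x h]; first by exists (phi x); rewrite -updE; apply/IH.
    by exists (psi x); apply/IH; rewrite updE psiK.
move=> f sf; rewrite (sentence_satisfies (fun=> 0) sf) holdsE.
by rewrite -(sentence_satisfies _ sf).
Qed.

Lemma embedding_elem_equiv (R S : naRingType) (phi : {additive R -> S})
    (R0 : set R) (S0 : set S) (k m : nat) :
  FDZ_algebra R -> FDZ_algebra S -> ring_monomorphism phi ->
  is_addition R0 -> is_addition S0 -> induces_iso phi setT R0 setT S0 ->
  phi @` R0 `<=` S0 -> has_index S0 (phi @` R0) k -> has_index (MR R) (NR R) m ->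
  coprime k m -> elem_equiv R S.
Proof.
move=> hR hS [phiM phiI] aR0 aS0 iso phiR0 ik im km.
have sR0 := subg_addition aR0; have sS0 := subg_addition aS0.
have [ker' gen'] := induces_isoP (@subg_setT _) sR0 sS0 iso.
have ker x : S0 (phi x) <-> R0 x.
  by split=> [/ker'|R0x]; [apply | apply: phiR0; exists x].
have gen y : exists x, S0 (y - phi x) by have [x _ Hx] := gen' y I; exists x.
have m0 : (0 < m)%N by apply: has_index_gt0 (@subg_MR R) (@subg_NR R) im.
have hm x : MR R x -> NR R (x *+ m).
  by apply: index_exponent (@subg_MR R) (@subg_NR R) im.
have sphi := subg_image phi sR0.
have k0 := has_index_gt0 sS0 sphi ik.
have fk s : S0 s -> exists2 r, R0 r & phi r = s *+ k.
  by move=> /(index_exponent sS0 sphi ik)[r R0r E]; exists r.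
have [p0 [Rp pB pM pm]] := addition_projection aR0 hR hm.
have [p pE] := additive_of pB.
apply: (close_elem_equiv (m := m)) => Q Q0; exists R0, S0, p.
apply: (@closeness_exists _ _ phi _ _ phiM phiI aR0 aS0 gen ker m p m0 _ _ _ k Q hR hS) => //.
- by move=> x; rewrite pE.
- by move=> x y; rewrite pE.
- by move=> r R0r; rewrite pE pm.
Qed.

Section AlmostOnto.
Variables (R S : naRingType) (hR : FDZ_algebra R) (hS : FDZ_algebra S).
Variables (phi : {additive R -> S}) (n m : nat).
Hypotheses (phiM : na_multiplicative phi) (phiI : injective phi).
Hypotheses (genA : forall y, exists x, Ann S (y - phi x)).
Hypotheses (genn : forall y, exists x z, y = phi x + z *+ n).
Hypotheses (n2 : (2 <= n)%N) (mn : (m %| n)%N) (im : has_index (MR R) (NR R) m).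
Hypothesis (nSq : forall x, Is (Sq S) x -> Sq S (x *+ n)).

Lemma image_exponent : exists2 E : int, E != 0 &
  (exists q, E = 1 + n%:Z * q) /\ forall y, exists x, phi x = y *~ E.
Proof. by have [t tT] := FDZ_span hS; apply: onto_modulo_exponent tT n2 genn. Qed.

Lemma Ann_phi x : Ann S (phi x) <-> Ann R x.
Proof.
split=> [Ax y|Ax y].
  have [E1 E2] := Ax (phi y).
  by split; apply: phiI; rewrite phiM raddf0.
have [x' Ax'] := genA y; have [E1 E2] := Ax' (phi x); have [E3 E4] := Ax x'.
rewrite -[y](subrK (phi x')) namulDr namulDl E1 E2 -!phiM E3 E4 raddf0.
by rewrite addr0.
Qed.

Lemma Sq_phi y : Sq S y <-> exists2 x, Sq R x & phi x = y.
Proof.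
split=> [Sy|[x Sx <-]].
  have [[Sq0 SqB] SqM] := Sq_ideal R.
  apply: (Sq_sub (I := [set y | exists2 x, Sq R x & phi x = y])) Sy.
    split; first split.
    - by exists 0 => //; rewrite raddf0.
    - move=> _ _ [x Sx <-] [x' Sx' <-]; exists (x - x'); last by rewrite raddfB.
      exact: SqB.
    move=> s _ [x Sx <-]; have [r Ar] := genA s.
    have [E1 E2] := Ar (phi x); have [Srx Sxr] := SqM r x Sx.
    rewrite -[s](subrK (phi r)) namulDl namulDr E1 E2 !add0r -!phiM.
    by split; [exists (r ** x) | exists (x ** r)].
  move=> s s'; have [r Ar] := genA s; have [r' Ar'] := genA s'.
  exists (r ** r'); first exact: Sq_mul.
  have [E1 _] := Ar s'; have [_ E2] := Ar' (phi r).
  rewrite phiM (_ : s ** s' = phi r ** s').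
    by rewrite -[s' in RHS](subrK (phi r')) namulDr E2 add0r.
  by rewrite -[s in LHS](subrK (phi r)) namulDl E1 add0r.
apply: (Sq_sub (I := [set x | Sq S (phi x)])) Sx; last first.
  by move=> x' x''; rewrite /= phiM; apply: Sq_mul.
have [[Sq0 SqB] SqM] := Sq_ideal S.
split; first by split=> [|x1 x2]; rewrite /= ?raddf0 // raddfB; apply: SqB.
move=> r x1 Sx1; have [h1 h2] := SqM (phi r) (phi x1) Sx1.
by rewrite /= !phiM.
Qed.

(** If [y] is in the isolator of the square of [S], then [n y] is in the
    square, hence in the image of [phi], and so is [E y] with [E] congruent
    to 1 modulo [n]. *)
Lemma IsSq_phi y : Is (Sq S) y <-> exists2 x, Is (Sq R) x & phi x = y.
Proof.
split=> [Sy|[x [a a0 Sx] <-]]; last first.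
  by exists a => //; rewrite -raddfMz; apply/Sq_phi; exists (x *~ a).
have [E E0 [[q Eq] HE]] := image_exponent.
have [x Ex] := HE y; have /Sq_phi[x' Sx' Ex'] := nSq Sy.
have Exy : phi (x - x' *~ q) = y.
  by rewrite raddfB raddfMz /= Ex Ex' Eq mulrzDr mulr1z mulrzA -pmulrn addrK.
exists (x - x' *~ q) => //; have [a a0 Sa] := Sy; exists a => //.
have /Sq_phi[w Sw] := Sa; rewrite -Exy -raddfMz => /phiI <-.
exact: Sw.
Qed.

Lemma NR_phi x : NR S (phi x) <-> NR R x.
Proof.
split=> [[_ /IsSq_phi[i Si <-] [a Aa E]]|[i Si [a Aa <-]]].
  exists i => //; exists (x - i); last by rewrite addrC subrK.
  by apply/Ann_phi; rewrite raddfB /= -E addrC addKr.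
rewrite raddfD; exists (phi i); first by apply/IsSq_phi; exists i.
by exists (phi a) => //; apply/Ann_phi.
Qed.

Lemma MR_phi x : MR S (phi x) <-> MR R x.
Proof.
split=> [[c c0 [_ /Sq_phi[i Si <-] [a Aa E]]]|[c c0 [i Si [a Aa E]]]]; exists c => //.
  exists i => //; exists (x *~ c - i); last by rewrite addrC subrK.
  by apply/Ann_phi; rewrite raddfB raddfMz /= -E addrC addKr.
rewrite -raddfMz -E raddfD; exists (phi i); first by apply/Sq_phi; exists i.
by exists (phi a) => //; apply/Ann_phi.
Qed.

Lemma MN_phi : induces_iso phi (MR R) (NR R) (MR S) (NR S).
Proof.
apply: induces_isoI; [exact: subg_MR | exact: subg_NR | exact: subg_NR | | |].
- by move=> x /MR_phi.
- by move=> x _; rewrite NR_phi.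
- move=> y My; have [x Ax] := genA y; exists x; last first.
    exists 0; first exact: (subg0 (subg_IsSq S)).
    by exists (y - phi x) => //; rewrite add0r.
  have AM : MR S (y - phi x).
    apply: NR_MR; exists 0; first exact: (subg0 (subg_IsSq S)).
    by exists (y - phi x) => //; rewrite add0r.
  by apply/MR_phi; apply: (subg_subr (subg_MR S) My AM).
Qed.

(** [Delta S] is contained in the image of [phi], so only the part in [S0] of
    an annihilating element can lie outside of this image. *)
Lemma preimage_addition (S0 : set S) : is_addition S0 ->
  is_addition (phi @^-1` S0) /\ forall y, exists x, S0 (y - phi x).
Proof.
move=> aS0; have sS0 := subg_addition aS0; have [_ ES E0] := aS0.
have AR0 x : S0 (phi x) -> Ann R x.
  by move=> /(addition_Ann aS0)/Ann_phi.
have dec y : Ann S y -> exists2 x, Delta R x & S0 (y - phi x).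
  rewrite -ES => -[s S0s [d [Sd Ad] <-]].
  have /IsSq_phi[x Sx Ex] := Sd; exists x; last by rewrite Ex addrK.
  by split=> //; apply/Ann_phi; rewrite Ex.
split; last first.
  move=> y; have [x /dec[x' _ S0y]] := genA y; exists (x + x').
  by rewrite raddfD opprD addrA.
split.
- split; first by rewrite /preimage /= raddf0; apply: subg0.
  by move=> x y; rewrite /preimage /= raddfB; apply: subgB.
- apply/seteqP; split=> [_ [x S0x [d [_ Ad] <-]]|x Ax].
    by apply: (subgD (subg_Ann R)) => //; apply: AR0.
  have [|d Dd S0x] := dec (phi x); first exact/Ann_phi.
  exists (x - d); first by rewrite /preimage /= raddfB.
  by exists d => //; rewrite subrK.
- apply/seteqP; split=> [x [S0x [Sx Ax]]|_ ->]; last first.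
    split; first by rewrite /preimage /= raddf0; apply: subg0.
    exact: (subg0 (subg_Delta R)).
  apply: phiI; rewrite raddf0; apply: (addition_inj aS0) => //.
  by apply/IsSq_phi; exists x.
Qed.

(** The index of [phi R0] in [S0] divides a power of [E], which is 1 modulo
    [n] and therefore prime to [m]. If [m] is 1, then [twist] applies with an
    isomorphism from [R0] onto [S0] and replaces [phi] by an isomorphism of
    rings. *)
Lemma almost_onto_conclusion :
  (MR R = NR R /\ ring_isomorphic R S) \/
  (exists (phi : {additive R -> S}) (R0 : set R) (S0 : set S),
     [/\ ring_monomorphism phi, is_addition R0 & is_addition S0] /\
     [/\ induces_iso phi setT R0 setT S0,
         induces_iso phi (MR R) (NR R) (MR S) (NR S)
       & phi @` R0 `<=` S0 /\
         exists k m : nat,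
           [/\ has_index S0 (phi @` R0) k, has_index (MR R) (NR R) m,
               coprime k m & m <> 1%N]]).
Proof.
have [S0 aS0] := addition_exists hS.
have [aR0 gen] := preimage_addition aS0; set R0 := phi @^-1` S0 in aR0.
have sR0 := subg_addition aR0; have sS0 := subg_addition aS0.
have phiR0 : phi @` R0 `<=` S0 by move=> _ [x R0x <-].
have sphi := subg_image phi sR0.
have [E E0 [[q Eq] HE]] := image_exponent.
have absE y : exists2 x, phi x = y *+ `|E| & S0 y -> R0 x.
  have [x Ex] : exists x, phi x = y *+ `|E|.
    have [x Ex] := HE y; case: (E) Ex => a Ex; first by exists x.
    by exists (- x); rewrite raddfN /= Ex NegzE mulrNz opprK.
  by exists x => // S0y; rewrite /R0 /preimage /= Ex; apply: subgMn.
have [t tS0] := FDZ_subgroup_fg hS sS0.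
have E0' : (0 < `|E|)%N by rewrite absz_gt0.
have [|k ik kE] := @finite_index _ t _ `|E| sphi E0'.
  move=> x /mem_span; rewrite -tS0 => S0x; have [r Er R0r] := absE x.
  by exists r => //; apply: R0r.
have {}ik : has_index S0 (phi @` R0) k.
  rewrite (_ : set_sum (span t) _ = S0) // in ik; rewrite -tS0.
  apply/seteqP; split=> [_ [x S0x [y /phiR0 S0y <-]]|x S0x]; first exact: subgD.
  by exists x => //; exists 0; [exact: subg0 | rewrite addr0].
have km : coprime k m.
  rewrite coprime_has_primes; [|exact: has_index_gt0 sS0 sphi ik
                             |exact: has_index_gt0 (@subg_MR R) (@subg_NR R) im].
  apply/hasPn => r; rewrite !mem_primes => /and3P[pr _ rm].
  apply/negP => /and3P[_ _ /(kE _ pr) rE].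
  have : (r%:Z %| E - n%:Z * q)%Z.
    apply: rpredB; first by rewrite dvdzE.
    by apply: dvdz_mulr; rewrite dvdzE /=; apply: dvdn_trans rm mn.
  by rewrite Eq addrK dvdzE /= dvdn1 => /eqP r1; rewrite r1 in pr.
have [m1|m1] := eqVneq m 1%N; [left|right]; last first.
  exists phi, R0, S0; do !split=> //.
  - apply: induces_isoI => // y _.
    by have [x Hx] := gen y; exists x.
  - exact: MN_phi.
  - by exists k, m; split=> //; apply/eqP.
have hm x : MR R x -> NR R (x *+ m).
  by apply: index_exponent (@subg_MR R) (@subg_NR R) im.
split.
  by apply/seteqP; split=> [x /hm|]; [rewrite m1 | exact: NR_MR].
have [p0 [Rp pB pM pm]] := addition_projection aR0 hR hm.
have [p pE] := additive_of pB.
have [d [b hb]] := addition_basis hR aR0; have [d' [b' hb']] := addition_basis hS aS0.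
have fk s : S0 s -> exists2 r, R0 r & phi r = s *+ `|E|.
  by move=> S0s; have [r Er R0r] := absE s; exists r => //; apply: R0r.
have [g [g' [[gS g'R g'K gK] [gD g'D]]]] :=
  subg_iso phiI E0' sR0 sS0 hb hb' (fun x h => h) fk.
have m0 : (0 < m)%N by rewrite m1.
have [| | | |theta [thM thE thS]] := @twist _ _ phi R0 S0 phiM aR0 aS0 m p m0 _ _ _ g gS gD.
- by move=> x; rewrite pE.
- by move=> x y; rewrite pE.
- by move=> r R0r; rewrite pE pm.
- move=> r R0r; exists (g r - phi r); first by apply: subgB => //; apply: gS.
  by rewrite m1 mulr1n addrC subrK.
exists theta; split=> //.
have thI : injective theta.
  apply: raddf_inj => x thx.
  have R0x : R0 x.
    have := thS x; rewrite thx sub0r => /(subgN sS0).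
    by rewrite opprK.
  rewrite -(g'K x R0x) -thE // thx.
  exact: aon0 g'D.
have thS' y : exists x, theta x = y.
  have [x Hx] := gen y; have S0y : S0 (y - theta x).
    by have := subgB sS0 Hx (thS x); rewrite opprB addrA subrK.
  exists (x + g' (y - theta x)).
  by rewrite raddfD /= (thE (g' _)) ?gK; [rewrite addrC subrK | | apply: g'R].
have /choice[psi Hpsi] := thS'.
by exists psi => x; [apply: thI; rewrite Hpsi | rewrite Hpsi].
Qed.

End AlmostOnto.

(** * Definable properties *)

(** Variables are indexed by an arbitrary type [I], so that a quantifier adds
    one by passing to [option I] and a quantified family by passing to a sum;
    [nu] assigns their names, and the bound [n] leaves fresh names available. *)
Definition definable (I : Type) (P : forall R : naRingType, (I -> R) -> Prop) : Prop :=
  forall (nu : I -> nat) n, (forall i, nu i < n)%N ->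
  exists f, (forall j, j \in free_vars f -> (j < n)%N) /\
    forall (R : naRingType) (e : nat -> R), holds e f <-> P R (fun i => e (nu i)).

(** There is no subtraction in the language, so a term function is the
    difference of two terms. *)
Definition definable_term (I : Type) (t : forall R : naRingType, (I -> R) -> R) : Prop :=
  forall (nu : I -> nat) n, (forall i, nu i < n)%N ->
  exists t1 t2, (forall j, j \in term_vars t1 ++ term_vars t2 -> (j < n)%N) /\
    forall (R : naRingType) (e : nat -> R),
      t R (fun i => e (nu i)) = term_eval e t1 - term_eval e t2.

Lemma definable_sentence (P : naRingType -> Prop) :
  definable (I := void) (fun R _ => P R) ->
  forall R S, elem_equiv R S -> P R -> P S.
Proof.
move=> dP R S RS PR; have [|f [fv fP]] := dP (fun=> 0%N) 0%N; first by case.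
have sf : sentence f.
  rewrite /sentence; case: (free_vars f) fv => // j s /(_ j).
  by rewrite inE eqxx => /(_ isT).
have [RS1 _] := RS f sf.
have : satisfies S f by apply: RS1 => e; apply/fP.
by move=> /(_ (fun=> 0))/fP.
Qed.

Section Closure.
Variable I : Type.
Implicit Types P Q : forall R : naRingType, (I -> R) -> Prop.
Implicit Types t u : forall R : naRingType, (I -> R) -> R.

Lemma def_ext P Q :
  (forall R e, P R e <-> Q R e) -> definable P -> definable Q.
Proof.
move=> PQ dP nu n nun; have [f [fv fP]] := dP nu n nun.
by exists f; split=> // R e; rewrite fP.
Qed.

Lemma def_rename (J : Type) (s : I -> J) P :
  definable P -> definable (fun (R : naRingType) (e : J -> R) => P R (fun i => e (s i))).
Proof. by move=> dP nu n nun; apply: (dP (fun i => nu (s i))). Qed.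

Lemma dterm_rename (J : Type) (s : I -> J) t : definable_term t ->
  definable_term (fun (R : naRingType) (e : J -> R) => t R (fun i => e (s i))).
Proof. by move=> dt nu n nun; apply: (dt (fun i => nu (s i))). Qed.

Lemma def_not P : definable P -> definable (fun R e => ~ P R e).
Proof.
move=> dP nu n nun; have [f [fv fP]] := dP nu n nun.
by exists (FNot f); split=> // R e /=; rewrite fP.
Qed.

Lemma def_and P Q : definable P -> definable Q -> definable (fun R e => P R e /\ Q R e).
Proof.
move=> dP dQ nu n nun; have [f [fv fP]] := dP nu n nun; have [g [gv gQ]] := dQ nu n nun.
exists (FAnd f g); split=> [j|R e] /=; last by rewrite fP gQ.
by rewrite mem_cat => /orP[/fv|/gv].
Qed.

Lemma def_imp P Q : definable P -> definable Q -> definable (fun R e => P R e -> Q R e).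
Proof.
move=> dP dQ nu n nun; have [f [fv fP]] := dP nu n nun; have [g [gv gQ]] := dQ nu n nun.
exists (FImp f g); split=> [j|R e] /=; last by rewrite fP gQ.
by rewrite mem_cat => /orP[/fv|/gv].
Qed.

Lemma def_const (A : Prop) : definable (fun (R : naRingType) (_ : I -> R) => A).
Proof.
move=> nu n nun; have [HA|nA] := pselect A.
  by exists (FEq TZero TZero).
by exists (FNot (FEq TZero TZero)); split=> // R e /=; split=> // [[]].
Qed.

Lemma def_all_in (T : eqType) (s : seq T) (P : T -> forall R : naRingType, (I -> R) -> Prop) :
  (forall x, definable (P x)) -> definable (fun R e => forall x, x \in s -> P x R e).
Proof.
move=> dP; elim: s => [|y s IH].
  by apply: def_ext (def_const True) => R e; split.
apply: def_ext (def_and (dP y) IH) => R e; split=> [[Py Ps] x|H].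
  by rewrite inE => /orP[/eqP->|/Ps].
by split=> [|x xs]; apply: H; rewrite inE ?eqxx ?xs ?orbT.
Qed.

Lemma def_ex_in (T : eqType) (s : seq T) (P : T -> forall R : naRingType, (I -> R) -> Prop) :
  (forall x, definable (P x)) -> definable (fun R e => exists2 x, x \in s & P x R e).
Proof.
move=> dP; have dn := def_not (def_all_in s (fun x => def_not (dP x))).
apply: def_ext dn => R e; split=> [H|[x xs Px] /(_ x xs)//].
by apply: contrapT => nP; apply: H => x xs Px; apply: nP; exists x.
Qed.

Lemma def_all_ord k (P : 'I_k -> forall R : naRingType, (I -> R) -> Prop) :
  (forall i, definable (P i)) -> definable (fun R e => forall i, P i R e).
Proof.
move=> dP; apply: def_ext (def_all_in (enum 'I_k) dP) => R e; split=> H i //.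
by apply: H; rewrite mem_enum.
Qed.

Lemma def_ex (P : forall R : naRingType, (I -> R) -> R -> Prop) :
  definable (fun (R : naRingType) (e : option I -> R) => P R (fun i => e (Some i)) (e None)) ->
  definable (fun R e => exists x, P R e x).
Proof.
move=> dP nu n nun; pose mu o := if o is Some i then nu i else n.
have [|f [fv fP]] := dP mu n.+1; first by case=> [i|] //=; apply: leqW.
exists (FExists n f); split=> [j|R e] /=.
  by rewrite mem_filter => /andP[jn /fv]; rewrite ltnS leq_eqVlt (negPf jn).
have E x : (fun i => env_upd e n x (mu (Some i))) = (fun i => e (nu i)).
  by apply/funext => i; rewrite /env_upd /= ltn_eqF.
by split=> -[x] => [/fP|Px]; [rewrite E /env_upd eqxx => Px | ];
  exists x; [ | apply/fP; rewrite E /env_upd eqxx].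
Qed.

Lemma def_all (P : forall R : naRingType, (I -> R) -> R -> Prop) :
  definable (fun (R : naRingType) (e : option I -> R) => P R (fun i => e (Some i)) (e None)) ->
  definable (fun R e => forall x, P R e x).
Proof.
move=> dP nu n nun; pose mu o := if o is Some i then nu i else n.
have [|f [fv fP]] := dP mu n.+1; first by case=> [i|] //=; apply: leqW.
exists (FForall n f); split=> [j|R e] /=.
  by rewrite mem_filter => /andP[jn /fv]; rewrite ltnS leq_eqVlt (negPf jn).
have E x : (fun i => env_upd e n x (mu (Some i))) = (fun i => e (nu i)).
  by apply/funext => i; rewrite /env_upd /= ltn_eqF.
split=> H x; first by have /fP := H x; rewrite E /env_upd eqxx.
by apply/fP; rewrite E /env_upd eqxx.
Qed.

Lemma dterm_var i : definable_term (fun (R : naRingType) (e : I -> R) => e i).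
Proof.
move=> nu n nun; exists (TVar (nu i)), TZero; split=> [j|R e] /=.
  by rewrite inE => /eqP->.
by rewrite subr0.
Qed.

Lemma dterm0 : definable_term (fun (R : naRingType) (e : I -> R) => 0).
Proof. by move=> nu n nun; exists TZero, TZero; split=> // R e /=; rewrite subrr. Qed.

Lemma dtermN t : definable_term t -> definable_term (fun R e => - t R e).
Proof.
move=> dt nu n nun; have [t1 [t2 [tv tE]]] := dt nu n nun.
exists t2, t1; split=> [j jt|R e]; last by rewrite tE opprB.
by apply: tv; move: jt; rewrite !mem_cat orbC.
Qed.

Lemma dtermD t u : definable_term t -> definable_term u ->
  definable_term (fun R e => t R e + u R e).
Proof.
move=> dt du nu n nun; have [t1 [t2 [tv tE]]] := dt nu n nun.
have [u1 [u2 [uv uE]]] := du nu n nun.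
exists (TAdd t1 u1), (TAdd t2 u2); split=> [j|R e] /=.
  rewrite !mem_cat => /orP[]/orP[] jt; first
    [by apply: tv; rewrite mem_cat jt ?orbT | by apply: uv; rewrite mem_cat jt ?orbT].
by rewrite tE uE opprD addrACA.
Qed.

Lemma dtermB t u : definable_term t -> definable_term u ->
  definable_term (fun R e => t R e - u R e).
Proof. by move=> dt du; apply: dtermD => //; apply: dtermN. Qed.

Lemma dtermM t u : definable_term t -> definable_term u ->
  definable_term (fun R e => t R e ** u R e).
Proof.
move=> dt du nu n nun; have [t1 [t2 [tv tE]]] := dt nu n nun.
have [u1 [u2 [uv uE]]] := du nu n nun.
exists (TAdd (TMul t1 u1) (TMul t2 u2)), (TAdd (TMul t1 u2) (TMul t2 u1)).
split=> [j|R e] /=.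
  rewrite !mem_cat => /orP[]/orP[]/orP[] jt; first
    [by apply: tv; rewrite mem_cat jt ?orbT | by apply: uv; rewrite mem_cat jt ?orbT].
by rewrite tE uE namulBl !namulBr opprB opprD addrACA.
Qed.

Lemma dtermMn t k : definable_term t -> definable_term (fun R e => t R e *+ k).
Proof.
move=> dt; elim: k => [|k IH].
  by have := dterm0; congr definable_term.
by have := dtermD dt IH; congr definable_term; apply/functional_extensionality_dep => R;
  apply/funext => e; rewrite mulrS.
Qed.

Lemma dtermMz t c : definable_term t -> definable_term (fun R e => t R e *~ c).
Proof.
move=> dt; case: c => k; first exact: dtermMn.
by apply: dtermN; apply: dtermMn.
Qed.

Lemma dterm_sum (J : Type) (r : seq J) (F : J -> forall R : naRingType, (I -> R) -> R) :
  (forall j, definable_term (F j)) -> definable_term (fun R e => \sum_(j <- r) F j R e).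
Proof.
move=> dF; elim: r => [|j r IH].
  have := dterm0; congr definable_term; apply/functional_extensionality_dep => R.
  by apply/funext => e; rewrite big_nil.
have := dtermD (dF j) IH; congr definable_term; apply/functional_extensionality_dep => R.
by apply/funext => e; rewrite big_cons.
Qed.

Lemma dterm_lc d (z : forall R : naRingType, (I -> R) -> 'I_d -> R) c :
  (forall i, definable_term (fun R e => z R e i)) ->
  definable_term (fun R e => lc (z R e) c).
Proof. by move=> dz; apply: dterm_sum => i; apply: dtermMz. Qed.

Lemma def_eq t u : definable_term t -> definable_term u ->
  definable (fun R e => t R e = u R e).
Proof.
move=> dt du nu n nun; have [t1 [t2 [tv tE]]] := dt nu n nun.
have [u1 [u2 [uv uE]]] := du nu n nun.
exists (FEq (TAdd t1 u2) (TAdd u1 t2)); split=> [j|R e] /=.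
  rewrite !mem_cat => /orP[]/orP[] jt; first
    [by apply: tv; rewrite mem_cat jt ?orbT | by apply: uv; rewrite mem_cat jt ?orbT].
have E : t R (fun i => e (nu i)) - u R (fun i => e (nu i))
    = term_eval e t1 + term_eval e u2 - (term_eval e u1 + term_eval e t2).
  by rewrite tE uE opprB opprD [- _ - _ in RHS]addrC addrACA.
split=> /eqP H; apply/eqP; rewrite -subr_eq0; first by rewrite E subr_eq0.
by rewrite -E subr_eq0.
Qed.

End Closure.

Lemma def_ex_tuple (I : Type) s (P : forall R : naRingType, (I -> R) -> ('I_s -> R) -> Prop) :
  definable (fun (R : naRingType) (e : I + 'I_s -> R) =>
    P R (fun i => e (inl i)) (fun j => e (inr j))) ->
  definable (fun R e => exists u, P R e u).
Proof.
elim: s I P => [|s IH] I P dP.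
  move=> nu n nun; pose mu (x : I + 'I_0) := if x is inl i then nu i else 0%N.
  have [|f [fv fP]] := dP mu n; first by case=> [i|[]//]; apply: nun.
  exists f; split=> // R e; rewrite fP.
  split=> [H|[u Pu]]; first by exists (fun j => e (mu (inr j))); exact: H.
  by rewrite (_ : (fun j : 'I_0 => _) = u) //; apply/funext => -[].
pose cons R (x : R) (u : 'I_s -> R) (i : 'I_s.+1) :=
  if unlift ord0 i is Some j then u j else x.
pose sg (x : I + 'I_s.+1) : option I + 'I_s :=
  match x with
  | inl i => inl (Some i)
  | inr j => if unlift ord0 j is Some k then inr k else inl None
  end.
have dQ : definable (fun R (e : I -> R) => exists x, exists u : 'I_s -> R, P R e (cons R x u)).
  apply: def_ex; apply: (IH _ (fun R e u => P R (fun i => e (Some i)) (cons R (e None) u))).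
  apply: def_ext (def_rename sg dP) => R e.
  rewrite (_ : (fun j => e (sg (inr j))) = cons R (e (inl None)) (fun j => e (inr j))) //.
  by apply/funext => j; rewrite /sg /cons; case: unlift.
apply: def_ext dQ => R e; split=> [[x [u Pu]]|[u Pu]]; first by exists (cons R x u).
exists (u ord0), (fun j => u (lift ord0 j)).
rewrite (_ : cons _ _ _ = u) //; apply/funext => i; rewrite /cons.
by case: unliftP => [j|] ->.
Qed.

Lemma def_all_tuple (I : Type) s (P : forall R : naRingType, (I -> R) -> ('I_s -> R) -> Prop) :
  definable (fun (R : naRingType) (e : I + 'I_s -> R) =>
    P R (fun i => e (inl i)) (fun j => e (inr j))) ->
  definable (fun R e => forall u, P R e u).
Proof.
move=> dP; have := def_not (def_ex_tuple (P := fun R e u => ~ P R e u) (def_not dP)).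
apply: def_ext => R e; split=> [H u|H [u]]; last exact.
by apply: contrapT => nP; apply: H; exists u.
Qed.

(** * Commuting integer matrices *)

Lemma finite_reps (T : eqType) (A : set T) (J : finType) (code : T -> J) :
  exists xs : seq T, (forall x, x \in xs -> A x) /\
    forall y, A y -> exists2 x, x \in xs & code x = code y.
Proof.
have /choice[f Hf] : forall j : J, exists o : option T,
    if o is Some x then A x /\ code x = j else forall x, A x -> code x <> j.
  move=> j; have [[x Ax Ex]|nx] := pselect (exists2 x, A x & code x = j).
    by exists (Some x).
  by exists None => x Ax Ex; apply: nx; exists x.
exists (pmap f (enum J)); split=> [x|y Ay].
  by rewrite mem_pmap => /mapP[j _ E]; have := Hf j; rewrite -E => -[].
have := Hf (code y); case E : (f (code y)) => [x|]; last by move=> /(_ y Ay).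
move=> [_ Ex]; exists x => //; rewrite mem_pmap; apply/mapP.
by exists (code y); rewrite ?mem_enum.
Qed.

Fixpoint pmx d (F : seq int) (M : 'M[int]_d) : 'M[int]_d :=
  if F is c :: F' then c%:M + M *m pmx F' M else 0.

Definition mxprod d (w : seq 'M[int]_d) : 'M[int]_d :=
  foldr (fun M A => M *m A) 1%:M w.

Lemma pmxXn d r (M : 'M[int]_d) : pmx (ncons r 0 [:: 1]) M = mxprod (nseq r M).
Proof.
elim: r => [|r IH] /=; first by rewrite mulmx0 addr0.
by rewrite IH raddf0 add0r.
Qed.

Lemma annihilating_poly d (t : seq 'M[int]_d) :
  exists2 F : {poly int}, F != 0 & forall M, M \in t -> pmx F M = 0.
Proof.
case: d t => [|d] t.
  by exists 1; [exact: oner_neq0 | move=> M _; apply: flatmx0].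
have pmxE (M : 'M[int]_d.+1) (p : {poly int}) : pmx p M = horner_mx M p.
  rewrite -[p in RHS]polyseqK; elim: (polyseq p) => [|c s IH] /=.
    by rewrite raddf0.
  by rewrite cons_poly_def rmorphD mulrC rmorphM /= horner_mx_X horner_mx_C IH addrC.
exists (\prod_(M <- t) char_poly M).
  by rewrite prodf_seq_neq0; apply/allP => M _; apply/monic_neq0/char_poly_monic.
move=> M Mt; rewrite pmxE (big_rem M) //= rmorphM /=.
by rewrite Cayley_Hamilton mul0r.
Qed.

Lemma mx_span m n : exists t : seq 'M[int]_(m, n), span t = setT.
Proof.
exists (codom (fun ij : 'I_m * 'I_n => delta_mx ij.1 ij.2 : 'M[int]_(m, n))).
apply/seteqP; split=> // M _.
rewrite (matrix_sum_delta M); apply: subg_sum => [|i _]; first exact: subg_span.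
apply: subg_sum => [|j _]; first exact: subg_span.
rewrite -[M i j]intz scaler_int; apply: (subgMz _ (subg_span _)); apply: mem_span.
exact: (codom_f (fun ij : 'I_m * 'I_n => delta_mx ij.1 ij.2 : 'M[int]_(m, n)) (i, j)).
Qed.

Section Triangular.
Variables (d : nat) (Gam : set 'M[int]_d).
Hypothesis (sGam : is_subgroup Gam).
Hypothesis comG : forall M M', Gam M -> Gam M' -> M *m M' = M' *m M.

(** [chi M] is the diagonal of [M] in a common triangular form over the
    algebraic numbers. A triangular matrix with zero diagonal moves the
    entries one step away from the diagonal, so a product of [d] of them is
    zero. *)
Lemma triangularization : exists chi : 'M[int]_d -> 'I_d -> algC,
  [/\ forall M M', Gam M -> Gam M' -> forall i, chi (M - M') i = chi M i - chi M' i,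
      forall M (F : seq int), Gam M -> pmx F M = 0 ->
        forall i, horner_rec (map intr F) (chi M i) = 0
    & forall w, (forall M, M \in w -> Gam M /\ forall i, chi M i = 0) ->
        (d <= size w)%N -> mxprod w = 0].
Proof.
have [T TT] := mx_span d d.
have [t Gt] : exists t, Gam = span t by apply: (subgroup_fg (t := T)) => //; rewrite TT.
pose c (M : 'M[int]_d) : 'M[algC]_d := map_mx intr M.
have [|P Pu] := @cotrigonalization algC d (map c t).
  move=> _ _ /mapP[M Mt ->] /mapP[M' Mt' ->]; rewrite /comm_mx /c -!map_mxM.
  by rewrite comG // Gt; apply: mem_span.
move=> /allP trig.
have Punit : P \in unitmx by apply: unitarymx_unit.
pose cj M := P *m c M *m invmx P.
have cjB M M' : cj (M - M') = cj M - cj M'.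
  by rewrite /cj /c map_mxB mulmxBr mulmxBl.
have cjM M M' : cj (M *m M') = cj M *m cj M'.
  by rewrite /cj /c map_mxM !mulmxA mulmxKV.
have cjD M M' : cj (M + M') = cj M + cj M'.
  by rewrite /cj /c map_mxD mulmxDr mulmxDl.
have cjC a : cj a%:M = (a%:~R)%:M.
  by rewrite /cj /c map_scalar_mx /= scalar_mxC mulmxK.
have cj0 M : cj M = 0 -> M = 0.
  rewrite /cj => E; have E' : c M = 0.
    have := congr1 (fun X => invmx P *m X *m P) E.
    by rewrite !mulmxA mulVmx // mul1mx mulmxKV // mulmx0 mul0mx.
  apply/matrixP => i j; have /matrixP/(_ i j) := E'; rewrite !mxE => /eqP.
  by rewrite intr_eq0 => /eqP.
have tr M : Gam M -> forall i j : 'I_d, (i < j)%N -> cj M i j = 0.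
  rewrite Gt => GM i j ij.
  apply: (span_min (t := t) (H := [set M | cj M i j = 0])) GM.
    split=> [|A B]; rewrite /= ?cjB; last by rewrite !mxE => -> ->; rewrite subrr.
    by rewrite /cj /c map_mx0 mulmx0 mul0mx mxE.
  move=> A At /=; have := trig (c A); rewrite map_f //= => /(_ isT).
  by rewrite /similar_to /= conjumx // => /is_trig_mxP; apply.
exists (fun M i => cj M i i); split.
- by move=> M M' _ _ i; rewrite cjB !mxE.
- move=> M F GM FM i.
  have H (s : seq int) : (forall k j : 'I_d, (k < j)%N -> cj (pmx s M) k j = 0) /\
      cj (pmx s M) i i = horner_rec (map intr s) (cj M i i).
    elim: s => [|a s [IH1 IH2]] /=.
      by split=> [k j _|]; rewrite /cj /c map_mx0 mulmx0 mul0mx mxE.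
    rewrite cjD cjC cjM; split=> [k j kj|].
      rewrite !mxE big1 => [|l _]; first by rewrite addr0; case: eqP kj => // ->; rewrite ltnn.
      have [kl|lk] := ltnP k l; first by rewrite tr // mul0r.
      by rewrite IH1 ?mulr0 //; apply: leq_ltn_trans kj.
    rewrite [LHS]mxE [_%:M i i]mxE [(_ *m _) i i]mxE eqxx mulr1n.
    rewrite (bigD1 i) //= big1 => [|l li]; last first.
      have [il|lei] := ltnP i l; first by rewrite tr // mul0r.
      by rewrite IH1 ?mulr0 // ltn_neqAle lei andbT.
    by rewrite addr0 IH2 [cj M i i * _]mulrC addrC.
  by have [_ <-] := H F; rewrite FM /cj /c map_mx0 mulmx0 mul0mx mxE.
- move=> w Hw dw; apply: cj0; apply/matrixP => i j; rewrite [RHS]mxE.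
  have H : forall i j : 'I_d, (i < j + size w)%N -> cj (mxprod w) i j = 0.
    elim: w Hw {dw} => [|M w IH] Hw i' j' ij /=.
      by rewrite cjC mxE; case: eqP ij => // ->; rewrite addn0 ltnn.
    rewrite cjM mxE big1 // => k _.
    have [GM chi0] : Gam M /\ forall i, cj M i i = 0 by apply: Hw; rewrite mem_head.
    have [ik|ki|ik] := ltngtP i' k.
    - by rewrite tr // mul0r.
    - rewrite IH ?mulr0 // => [A Aw|]; first by apply: Hw; rewrite inE Aw orbT.
      by rewrite addnS ltnS in ij; apply: leq_trans ij.
    - by rewrite -(val_inj ik) chi0 mul0r.
  by apply: H; apply: (leq_trans (ltn_ord i)); apply: leq_trans dw (leq_addl _ _).
Qed.

End Triangular.

(** * The definable scalars of a ring *)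

Section ScalarDefs.
Variables (tau : nat) (R : naRingType) (s : nat).
Implicit Types (z u w : 'I_s -> R) (a b c x y : R).

Definition tor x := x *+ tau = 0.

(** Modulo the subgroup [annT] the ring is a free abelian group [A], once [tau]
    is a common exponent. *)
Definition annT x := Ann R (x *+ tau).

(** The family [u] codes the endomorphism [g] of [A] with [g(a) z_i = a u_i] and
    [z_i g(a) = u_i a] modulo torsion, and [act z u a b] means that [b] is [g(a)].
    There is at most one such [g] when only the elements of [annT] annihilate all
    the [z_i] modulo torsion. *)
Definition act z u a b :=
  forall i, tor (b ** z i - a ** u i) /\ tor (z i ** b - u i ** a).

(** The second condition extends the first one from the members of [z] to all
    elements [x]; it makes the group of the coded endomorphisms independent of
    [z]. *)
Definition endo z u :=
  (forall a, exists b, act z u a b) /\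
  forall x, exists y, forall a b, act z u a b ->
    tor (b ** x - a ** y) /\ tor (x ** b - y ** a).

Definition commuting z u w := forall a b c b' c', act z u a b -> act z w b c ->
  act z w a b' -> act z u b' c' -> annT (c - c').

(** Commuting with all the coded endomorphisms makes the scalars commute with
    one another, while the integers remain among them. *)
Definition scalar z u := endo z u /\ forall w, endo z w -> commuting z u w.

(** [b] is the image of [a] under the polynomial with coefficients [F] in the
    endomorphism coded by [u], in Horner form. *)
Fixpoint eval_act z (F : seq int) u a b : Prop :=
  if F is k :: F' then exists x y,
    act z u a x /\ eval_act z F' u x y /\ annT (b - (a *~ k + y))
  else annT b.

Definition vanishes z (F : seq int) u := forall a b, eval_act z F u a b -> annT b.

Definition nil_scalar r z u := scalar z u /\ vanishes z (ncons r 0 [:: 1]) u.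

(** These groups filter [A] by the number of nilpotent scalars needed to kill an
    element; nilpotent scalars act as zero on each layer. *)
Fixpoint killed r i z a : Prop :=
  if i is i'.+1 then forall u, nil_scalar r z u -> forall b, act z u a b -> killed r i' z b
  else annT a.

(** [a] is a sum of scalar multiples of the combinations [ks] of [z] modulo the
    previous layer. The scalars absorb the integral coefficients, which cannot be
    quantified over. *)
Fixpoint covered r i z (ks : seq {ffun 'I_s -> int}) a : Prop :=
  if ks is k :: ks' then exists u b,
    scalar z u /\ act z u (lc z k) b /\ covered r i z ks' (a - b)
  else killed r i z a.

End ScalarDefs.

Section ScalarDefinable.
Variables (tau s : nat).

Let dtup I (u : forall R : naRingType, (I -> R) -> 'I_s -> R) :=
  forall i, definable_term (fun R e => u R e i).

Lemma def_tor I t : definable_term (I := I) t -> definable (fun R e => tor tau (t R e)).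
Proof. by move=> dt; exact: (def_eq (dtermMn tau dt) (@dterm0 I)). Qed.

Lemma def_annT I t : definable_term (I := I) t -> definable (fun R e => annT tau (t R e)).
Proof.
move=> dt; apply: def_all.
have dt' := dtermMn tau (dterm_rename some dt).
have dx : definable_term (fun (R : naRingType) (e : option I -> R) => e None) := dterm_var None.
exact: (def_and (def_eq (dtermM dt' dx) (@dterm0 _)) (def_eq (dtermM dx dt') (@dterm0 _))).
Qed.

Lemma def_act I z u a b : dtup z -> dtup u ->
  definable_term (I := I) a -> definable_term b ->
  definable (fun R e => act tau (z R e) (u R e) (a R e) (b R e)).
Proof.
move=> dz du da db; apply: def_all_ord => i.
exact: (def_and (def_tor (dtermB (dtermM db (dz i)) (dtermM da (du i))))
  (def_tor (dtermB (dtermM (dz i) db) (dtermM (du i) da)))).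
Qed.

Lemma dtup_rename (I J : Type) (sg : I -> J) u : dtup u ->
  dtup (fun (R : naRingType) (e : J -> R) => u R (fun i => e (sg i))).
Proof. by move=> du i; exact: (dterm_rename sg (du i)). Qed.

Lemma dtup_var (J : Type) (sg : 'I_s -> J) : dtup (fun (R : naRingType) (e : J -> R) i => e (sg i)).
Proof. by move=> i; exact: (dterm_var (sg i)). Qed.

Lemma def_endo I z u : dtup (I := I) z -> dtup u ->
  definable (fun R e => endo tau (z R e) (u R e)).
Proof.
move=> dz du; apply: def_and.
  apply: def_all; apply: def_ex; pose sg (i : I) := Some (Some i).
  exact: (def_act (dtup_rename sg dz) (dtup_rename sg du)
    (dterm_var (Some None)) (dterm_var None)).
apply: def_all; apply: def_ex; apply: def_all; apply: def_all.
pose sg (i : I) := Some (Some (Some (Some i))).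
apply: def_imp.
  exact: (def_act (dtup_rename sg dz) (dtup_rename sg du)
    (dterm_var (Some None)) (dterm_var None)).
pose V (o : option (option (option (option I)))) := dterm_var o.
exact: (def_and
  (def_tor (dtermB (dtermM (V None) (V (Some (Some (Some None)))))
                   (dtermM (V (Some None)) (V (Some (Some None))))))
  (def_tor (dtermB (dtermM (V (Some (Some (Some None)))) (V None))
                   (dtermM (V (Some (Some None))) (V (Some None)))))).
Qed.

Lemma def_commuting I z u w : dtup (I := I) z -> dtup u -> dtup w ->
  definable (fun R e => commuting tau (z R e) (u R e) (w R e)).
Proof.
move=> dz du dw; do 5 apply: def_all.
pose sg (i : I) := Some (Some (Some (Some (Some i)))).
pose V (o : option (option (option (option (option I))))) := dterm_var o.
have A u' (du' : dtup u') o o' :=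
  def_act (dtup_rename sg dz) (dtup_rename sg du') (V o) (V o').
apply: def_imp; first exact: (A _ du).
apply: def_imp; first exact: (A _ dw).
apply: def_imp; first exact: (A _ dw).
apply: def_imp; first exact: (A _ du).
exact: (def_annT (dtermB (V _) (V _))).
Qed.

Lemma def_scalar I z u : dtup (I := I) z -> dtup u ->
  definable (fun R e => scalar tau (z R e) (u R e)).
Proof.
move=> dz du; apply: def_and; first exact: def_endo.
apply: def_all_tuple; apply: def_imp.
  exact: (def_endo (dtup_rename inl dz) (dtup_var inr)).
exact: (def_commuting (dtup_rename inl dz) (dtup_rename inl du) (dtup_var inr)).
Qed.

Lemma def_eval_act F I z u a b : dtup (I := I) z -> dtup u ->
  definable_term (I := I) a -> definable_term b ->
  definable (fun R e => eval_act tau (z R e) F (u R e) (a R e) (b R e)).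
Proof.
elim: F I z u a b => [|k F IH] I z u a b dz du da db; first exact: def_annT.
do 2 apply: def_ex; pose sg (i : I) := Some (Some i).
apply: def_and; last apply: def_and.
- exact: (def_act (dtup_rename sg dz) (dtup_rename sg du) (dterm_rename sg da)
    (dterm_var (Some None))).
- exact: (IH _ _ _ _ _ (dtup_rename sg dz) (dtup_rename sg du)
    (dterm_var (Some None)) (dterm_var None)).
- exact: (def_annT (dtermB (dterm_rename sg db)
    (dtermD (dtermMz k (dterm_rename sg da)) (dterm_var None)))).
Qed.

Lemma def_vanishes F I z u : dtup (I := I) z -> dtup u ->
  definable (fun R e => vanishes tau (z R e) F (u R e)).
Proof.
move=> dz du; do 2 apply: def_all; pose sg (i : I) := Some (Some i).
apply: def_imp; last exact: (def_annT (dterm_var None)).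
exact: (def_eval_act F (dtup_rename sg dz) (dtup_rename sg du)
  (dterm_var (Some None)) (dterm_var None)).
Qed.

Lemma def_nil_scalar r I z u : dtup (I := I) z -> dtup u ->
  definable (fun R e => nil_scalar tau r (z R e) (u R e)).
Proof. by move=> dz du; apply: def_and; [apply: def_scalar | apply: def_vanishes]. Qed.

Lemma def_killed r i I z a : dtup (I := I) z -> definable_term a ->
  definable (fun R e => killed tau r i (z R e) (a R e)).
Proof.
elim: i I z a => [|i IH] I z a dz da; first exact: def_annT.
apply: def_all_tuple; apply: def_imp.
  exact: (def_nil_scalar r (dtup_rename inl dz) (dtup_var inr)).
apply: def_all; pose sg (x : I) : option (I + 'I_s) := Some (inl x).
apply: def_imp; last exact: (IH _ _ _ (dtup_rename sg dz) (dterm_var None)).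
exact: (def_act (dtup_rename sg dz) (dtup_var (fun j => Some (inr j)))
  (dterm_rename sg da) (dterm_var None)).
Qed.

Lemma def_covered r i ks I z a : dtup (I := I) z -> definable_term a ->
  definable (fun R e => covered tau r i (z R e) ks (a R e)).
Proof.
elim: ks I z a => [|k ks IH] I z a dz da; first exact: def_killed.
apply: def_ex_tuple; apply: def_ex; pose sg (x : I) : option (I + 'I_s) := Some (inl x).
have dz' := dtup_rename sg dz.
have du : dtup (fun R e j => e (Some (inr j) : option (I + 'I_s))).
  exact: (dtup_var (fun j => Some (inr j))).
apply: def_and; [|apply: def_and].
- exact: (def_scalar dz' du).
- exact: (def_act dz' du (dterm_lc k dz') (dterm_var None)).
- exact: (IH _ _ _ dz' (dtermB (dterm_rename sg da) (dterm_var None))).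
Qed.

End ScalarDefinable.

Section ScalarMatrices.
Variables (R : naRingType) (tau s d : nat) (v : {additive R -> 'rV[int]_d}).
Hypothesis vsurj : forall w, exists x, v x = w.
Hypothesis vker : forall x, v x = 0 <-> annT tau x.
Implicit Types (z u : 'I_s -> R) (a b c x y : R) (M : 'M[int]_d).

Lemma subg_tor : is_subgroup (tor (R := R) tau).
Proof.
split=> [|x y]; rewrite /tor ?mul0rn //.
by rewrite mulrnBl => -> ->; rewrite subrr.
Qed.

Lemma tor_annT a x : annT tau a -> tor tau (a ** x) /\ tor tau (x ** a).
Proof.
by move=> /(_ x)[]; rewrite /tor !pmulrn namulMzl namulMzr.
Qed.

Lemma annT_sub a b : annT tau (a - b) <-> v a = v b.
Proof.
rewrite -vker raddfB; split=> [/eqP|->]; last exact: subrr.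
by rewrite subr_eq0 => /eqP.
Qed.

Definition represents z u M := forall a b, act tau z u a b <-> v b = v a *m M.

Definition endo_mx M := forall x, exists y, forall a b, v b = v a *m M ->
  tor tau (b ** x - a ** y) /\ tor tau (x ** b - y ** a).

Definition scalar_mx : set 'M[int]_d := [set M |
  endo_mx M /\ forall M', endo_mx M' -> M *m M' = M' *m M].

Lemma subg_endo_mx : is_subgroup endo_mx.
Proof.
split=> [x|M M' hM hM' x].
  exists 0 => a b; rewrite mulmx0 => /vker /(tor_annT x)[h h'].
  by rewrite namulr0 namul0r !subr0.
have [y hy] := hM x; have [y' hy'] := hM' x; exists (y - y') => a b.
have [b1 Eb1] := vsurj (v a *m M); have [t1 t2] := hy a b1 Eb1.
rewrite mulmxBr => E; have [|t3 t4] := hy' a (b1 - b).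
  by rewrite raddfB /= Eb1 E opprB addrC subrK.
rewrite -[b](subKr b1); split.
  rewrite (namulBl b1) (namulBr y) (_ : _ - _ = (b1 ** x - a ** y) - ((b1 - b) ** x - a ** y')).
    by apply: (subgB subg_tor).
  by rewrite !opprD !opprK addrACA.
rewrite (namulBr b1) (namulBl y) (_ : _ - _ = (x ** b1 - y ** a) - (x ** (b1 - b) - y' ** a)).
  by apply: (subgB subg_tor).
by rewrite !opprD !opprK addrACA.
Qed.

Lemma endo_mx_scalar (k : int) : endo_mx k%:M.
Proof.
move=> x; exists (x *~ k) => a b E.
have /(tor_annT x) : annT tau (b - a *~ k).
  by apply/annT_sub; rewrite E raddfMz /= mul_mx_scalar -scaler_int intz.
by rewrite namulBl namulBr !namulMzl !namulMzr.
Qed.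

Lemma subg_scalar_mx : is_subgroup scalar_mx.
Proof.
split; first by split; [apply: subg0 subg_endo_mx | move=> M _; rewrite mul0mx mulmx0].
move=> M M' [hM cM] [hM' cM']; split; first exact: (subgB subg_endo_mx).
by move=> N hN; rewrite mulmxBl mulmxBr cM // cM'.
Qed.

Lemma scalar_mxZ (k : int) : scalar_mx k%:M.
Proof. by split=> [|M _]; [exact: endo_mx_scalar | rewrite scalar_mxC]. Qed.

Lemma scalar_mx_comm M M' : scalar_mx M -> scalar_mx M' -> M *m M' = M' *m M.
Proof. by move=> [_ cM] [hM' _]; apply: cM. Qed.

Section Complete.
Variable z : 'I_s -> R.
Hypothesis complete : forall a, (forall i, tor tau (a ** z i) /\ tor tau (z i ** a)) ->
  annT tau a.

Lemma act_sub u u' a a' b b' :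
  act tau z u a b -> act tau z u a' b' -> act tau z u (a - a') (b - b').
Proof.
move=> h h' i; have [t1 t2] := h i; have [t3 t4] := h' i.
split.
  rewrite !namulBl (_ : _ - _ = (b ** z i - a ** u i) - (b' ** z i - a' ** u i)).
    exact: (subgB subg_tor).
  by rewrite !opprD !opprK addrACA.
rewrite !namulBr (_ : _ - _ = (z i ** b - u i ** a) - (z i ** b' - u i ** a')).
  exact: (subgB subg_tor).
by rewrite !opprD !opprK addrACA.
Qed.

Lemma act_annT u a b : annT tau a -> annT tau b -> act tau z u a b.
Proof.
move=> ha hb i; have [t1 t2] := tor_annT (u i) ha; have [t3 t4] := tor_annT (z i) hb.
by split; apply: (subgB subg_tor).
Qed.

Lemma act_annTl u a b : annT tau a -> act tau z u a b -> annT tau b.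
Proof.
move=> ha h; apply: complete => i; have [t1 t2] := h i.
have [t3 t4] := tor_annT (u i) ha.
by split; [have := subgD subg_tor t1 t3 | have := subgD subg_tor t2 t4]; rewrite subrK.
Qed.

Lemma represents_exists u : (forall a, exists b, act tau z u a b) -> exists M, represents z u M.
Proof.
move=> hu; have /choice[e He] : forall i : 'I_d, exists x, v x = delta_mx 0 i.
  by move=> i; apply: vsurj.
have /choice[w Hw] : forall i, exists b, act tau z u (e i) b by move=> i; apply: hu.
pose M := \matrix_i v (w i).
have vlc (f : 'I_d -> R) (c : 'I_d -> int) : v (lc f c) = (\row_i c i) *m \matrix_i v (f i).
  rewrite lc_raddf mulmx_sum_row; apply: eq_bigr => i _.
  by rewrite mxE rowK -scaler_int intz.
have Me a : v (lc e (v a 0)) = v a.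
  rewrite vlc (_ : \row_i _ = v a); last by apply/rowP => i; rewrite mxE.
  rewrite (_ : \matrix_i _ = 1%:M) ?mulmx1 //.
  by apply/row_matrixP => i; rewrite rowK He row1.
have Mw a : v (lc w (v a 0)) = v a *m M.
  by rewrite vlc (_ : \row_i _ = v a) //; apply/rowP => i; rewrite mxE.
have act_lc (c : 'I_d -> int) : act tau z u (lc e c) (lc w c).
  pose g : set (R * R)%type := [set p | act tau z u p.1 p.2].
  have sg : is_subgroup g.
    split; first by apply: act_annT; apply/vker; rewrite raddf0.
    by move=> x y; apply: act_sub.
  have -> : lc e c = (lc (fun j => (e j, w j)) c).1.
    by rewrite /lc raddf_sum; apply: eq_bigr => j _; rewrite raddfMz.
  have -> : lc w c = (lc (fun j => (e j, w j)) c).2.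
    by rewrite /lc raddf_sum; apply: eq_bigr => j _; rewrite raddfMz.
  by apply: (subg_lc _ sg) => j; apply: Hw.
exists M => a b; rewrite -Mw -annT_sub; split=> [h|h].
  apply: act_annTl (act_sub u h (act_lc (v a 0))).
  by apply/annT_sub; rewrite Me.
rewrite -[a](subrK (lc e (v a 0))) -[b](subrK (lc w (v a 0))).
rewrite -[X in act _ _ _ (_ + X)]opprK -[X in act _ _ _ _ (_ + X)]opprK.
apply: (act_sub u).
  by apply: act_annT => //; apply/annT_sub; rewrite Me.
rewrite -[X in act _ _ _ X]sub0r -[X in act _ _ _ _ X]sub0r.
by apply: (act_sub u) => //; apply: act_annT; apply/vker; rewrite raddf0.
Qed.

Lemma represents_inj u M M' : represents z u M -> represents z u M' -> M = M'.
Proof.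
move=> hM hM'; apply/row_matrixP => i.
have [a Ea] := vsurj (delta_mx 0 i); have [b Eb] := vsurj (v a *m M).
by rewrite !rowE -Ea -Eb; apply/hM'/hM.
Qed.

Lemma represents_sub u u' M M' : represents z u M -> represents z u' M' ->
  represents z (fun i => u i - u' i) (M - M').
Proof.
have half w w' N N' a b : represents z w N -> represents z w' N' ->
    v b = v a *m (N - N') -> act tau z (fun i => w i - w' i) a b.
  move=> hN hN' E i; have [b1 Eb1] := vsurj (v a *m N).
  have [t1 t2] := (hN a b1).2 Eb1 i.
  have [|t3 t4] := (hN' a (b1 - b)).2 _ i.
    by rewrite raddfB /= Eb1 E mulmxBr opprB addrC subrK.
  rewrite -[b](subKr b1); split.
    rewrite (namulBl b1) (namulBr (w i)).
    rewrite (_ : _ - _ = (b1 ** z i - a ** w i) - ((b1 - b) ** z i - a ** w' i)).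
      exact: (subgB subg_tor).
    by rewrite !opprD !opprK addrACA.
  rewrite (namulBr b1) (namulBl (w i)).
  rewrite (_ : _ - _ = (z i ** b1 - w i ** a) - (z i ** (b1 - b) - w' i ** a)).
    exact: (subgB subg_tor).
  by rewrite !opprD !opprK addrACA.
move=> hM hM' a b; split=> [h|]; last exact: half.
have [b' Eb'] := vsurj (v a *m (M - M')).
have h' := half _ _ _ _ _ _ hM hM' Eb'.
rewrite -Eb' -annT_sub; apply: act_annTl (act_sub u h h').
by rewrite subrr; apply/vker; rewrite raddf0.
Qed.

Lemma endo_represents u : endo tau z u -> exists2 M, endo_mx M & represents z u M.
Proof.
move=> [hu hE]; have [M hM] := represents_exists hu; exists M => //.
by move=> x; have [y hy] := hE x; exists y => a b /hM/hy.
Qed.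

Lemma endo_mx_lift M : endo_mx M -> exists u, represents z u M.
Proof.
move=> hM; have /choice[u hu] : forall i, exists y, forall a b, v b = v a *m M ->
    tor tau (b ** z i - a ** y) /\ tor tau (z i ** b - y ** a).
  by move=> i; apply: hM.
exists u => a b; split=> [h|E i]; last exact: hu.
have [b' Eb'] := vsurj (v a *m M).
have h' : act tau z u a b' by move=> i; apply: hu.
rewrite -Eb' -annT_sub; apply: act_annTl (act_sub u h h').
by rewrite subrr; apply/vker; rewrite raddf0.
Qed.

Lemma endo_mxP u M : represents z u M -> endo_mx M -> endo tau z u.
Proof.
move=> hM hE; split=> [a|x].
  by have [b Eb] := vsurj (v a *m M); exists b; apply/hM.
by have [y hy] := hE x; exists y => a b /hM/hy.
Qed.

Lemma commutingP u u' M M' : represents z u M -> represents z u' M' ->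
  commuting tau z u u' <-> M *m M' = M' *m M.
Proof.
move=> hM hM'; split=> [h|E a b c b' c' /hM E1 /hM' E2 /hM' E3 /hM E4]; last first.
  by apply/annT_sub; rewrite E2 E4 E1 E3 -!mulmxA E.
apply/row_matrixP => i; have [a Ea] := vsurj (delta_mx 0 i).
have [b Eb] := vsurj (v a *m M); have [c Ec] := vsurj (v b *m M').
have [b' Eb'] := vsurj (v a *m M'); have [c' Ec'] := vsurj (v b' *m M).
rewrite !rowE -Ea !mulmxA -Eb -Eb' -Ec -Ec'; apply/annT_sub.
by apply: (h a b c b' c'); [apply/hM | apply/hM' | apply/hM' | apply/hM].
Qed.

Lemma scalarP u M : represents z u M -> scalar tau z u <-> scalar_mx M.
Proof.
move=> hM; split=> [[hu cu]|[hE cE]].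
  have [M1 hE hM1] := endo_represents hu.
  have E1 := represents_inj hM1 hM; rewrite E1 in hE; split=> // M' hM'.
  have [u' hu'] := endo_mx_lift hM'.
  by apply/(commutingP hM hu'); apply: cu; apply: endo_mxP hu' hM'.
split=> [|w hw]; first exact: endo_mxP hM hE.
have [M' hM' rM'] := endo_represents hw.
by apply/(commutingP hM rM')/cE.
Qed.

Lemma scalar_represents u : scalar tau z u -> exists2 M, scalar_mx M & represents z u M.
Proof.
move=> hu; have [M _ hM] := endo_represents hu.1; exists M => //.
exact/(scalarP hM).
Qed.

Lemma scalar_mx_lift M : scalar_mx M -> exists2 u, scalar tau z u & represents z u M.
Proof.
move=> hM; have [u hu] := endo_mx_lift hM.1; exists u => //.
exact/(scalarP hu).
Qed.

Lemma eval_actP F u M a b : represents z u M ->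
  eval_act tau z F u a b <-> v b = v a *m pmx F M.
Proof.
move=> hM; elim: F a b => [|k F IH] a b /=; first by rewrite mulmx0 vker.
have vk x : v (x *~ k) = v x *m k%:M.
  by rewrite raddfMz /= mul_mx_scalar -scaler_int intz.
have vD x y : v (x + y) = v x + v y by rewrite raddfD.
split=> [[x [y [/hM Ex [/IH Ey /annT_sub Eb]]]]|E].
  by rewrite Eb vD vk Ey Ex mulmxDr mulmxA.
have [x Ex] := vsurj (v a *m M); have [y Ey] := vsurj (v x *m pmx F M).
exists x, y; split; [exact/hM | split; [exact/IH | apply/annT_sub]].
by rewrite E vD vk Ey Ex mulmxDr mulmxA.
Qed.

Lemma vanishesP F u M : represents z u M -> vanishes tau z F u <-> pmx F M = 0.
Proof.
move=> hM; split=> [h|E a b /(eval_actP _ _ _ hM)].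
  apply/row_matrixP => i; have [a Ea] := vsurj (delta_mx 0 i).
  have [b Eb] := vsurj (v a *m pmx F M).
  by rewrite rowE -Ea -Eb row0; apply/vker/(h a b)/(eval_actP _ _ _ hM).
by rewrite E mulmx0 => /vker.
Qed.

Definition nil_mx r : set 'M[int]_d :=
  [set M | scalar_mx M /\ pmx (ncons r 0 [:: 1]) M = 0].

Lemma nil_scalarP r u M : represents z u M -> nil_scalar tau r z u <-> nil_mx r M.
Proof.
by move=> hM; split=> -[/(scalarP hM) h1 /(vanishesP _ hM) h2].
Qed.

Lemma killedP r i a : killed tau r i z a <->
  forall w, size w = i -> (forall M, M \in w -> nil_mx r M) -> v a *m mxprod w = 0.
Proof.
elim: i a => [|i IH] a /=.
  rewrite -vker; split=> [-> w _ _|h]; first by rewrite mul0mx.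
  by have := h [::] erefl; rewrite mulmx1; apply.
split=> [h [//|M w] [sw] hw|h u hu b hb].
  have hM : nil_mx r M by apply: hw; rewrite mem_head.
  have [u _ ru] := scalar_mx_lift hM.1; have [b Eb] := vsurj (v a *m M).
  have /IH kb : killed tau r i z b.
    by apply: (h u); [apply/(nil_scalarP _ ru) | apply/ru].
  by rewrite /= mulmxA -Eb kb // => M' wM'; apply: hw; rewrite inE wM' orbT.
apply/IH => w sw hw; have [M _ ru] := scalar_represents hu.1.
have -> : v b = v a *m M by apply/ru.
rewrite -mulmxA; apply: (h (M :: w)) => [|M']; first by rewrite /= sw.
by rewrite inE => /orP[/eqP->|/hw//]; apply/(nil_scalarP _ ru).
Qed.

Lemma subg_killed r i : is_subgroup (killed tau r i z).
Proof.
split=> [|a b /killedP ha /killedP hb]; apply/killedP => w sw hw.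
  by rewrite raddf0 mul0mx.
by rewrite raddfB mulmxBl ha // hb // subrr.
Qed.

Lemma represents_scalar (k : int) : represents z (fun i => z i *~ k) k%:M.
Proof.
have [u hu] := endo_mx_lift (endo_mx_scalar k).
have vk x : v (x *~ k) = v x *m k%:M.
  by rewrite raddfMz /= mul_mx_scalar -scaler_int intz.
have act_k a : act tau z (fun i => z i *~ k) a (a *~ k).
  by move=> i; rewrite !namulMzl !namulMzr !subrr; split; apply: (subg0 subg_tor).
move=> a b; rewrite -vk -annT_sub; split=> [h|h].
  apply: act_annTl (act_sub u h (act_k a)).
  by rewrite subrr; apply/vker; rewrite raddf0.
rewrite -[a]subr0 -[b](subKr (a *~ k)); apply: (act_sub u) => //.
apply: act_annT; first by apply/vker; rewrite raddf0.
by apply/vker; rewrite -opprB raddfN /=; move/vker: h => ->; rewrite oppr0.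
Qed.

End Complete.
End ScalarMatrices.

(** * Transferring a generating family modulo the annihilator *)

Lemma lc0 (G : zmodType) d (b : 'I_d -> G) : lc b (fun=> 0) = 0.
Proof. by rewrite /lc big1 // => i _; rewrite mulr0z. Qed.

Lemma namul_lcr (R : naRingType) s (z : 'I_s -> R) a c :
  a ** lc z c = lc (fun i => a ** z i) c.
Proof.
have [f fE] : exists f : {additive R -> R}, f =1 (fun x => a ** x).
  by apply: additive_of => x y; rewrite namulBr.
by rewrite -fE lc_raddf; apply: eq_bigr => i _; rewrite fE.
Qed.

Lemma namul_lcl (R : naRingType) s (z : 'I_s -> R) a c :
  lc z c ** a = lc (fun i => z i ** a) c.
Proof.
have [f fE] : exists f : {additive R -> R}, f =1 (fun x => x ** a).
  by apply: additive_of => x y; rewrite namulBl.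
by rewrite -fE lc_raddf; apply: eq_bigr => i _; rewrite fE.
Qed.

Definition torsion_exponent (R : naRingType) (tau : nat) :=
  (0 < tau)%N /\ forall (x : R) (c : int), c != 0 ->
    (tor tau (x *~ c) -> tor tau x) /\ (annT tau (x *~ c) -> annT tau x).

Lemma torsion_exponent_exists (R : naRingType) : FDZ_algebra R ->
  exists2 e, (0 < e)%N &
    forall tau, (0 < tau)%N -> (e %| tau)%N -> torsion_exponent R tau.
Proof.
move=> hR; have [e1 e10 H1] := Is_exponent hR (@subg_set0 R).
have [e2 e20 H2] := Is_exponent hR (subg_Ann R).
exists (e1 * e2)%N; first by rewrite muln_gt0 e10.
move=> tau tau0 etau; split=> // x c c0.
have ct : c * tau%:Z != 0 by rewrite mulf_neq0 // eqz_nat -lt0n.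
have E : x *~ c *+ tau = x *~ (c * tau%:Z) by rewrite mulrzA.
split=> [h|h].
  have /H1 /= h1 : Is [set 0] x by exists (c * tau%:Z) => //; rewrite /= -E.
  have /dvdnP[k ->] : (e1 %| tau)%N by apply: dvdn_trans etau; apply: dvdn_mulr.
  by rewrite /tor mulnC mulrnA h1 mul0rn.
have /H2 h2 : Is (Ann R) x by exists (c * tau%:Z) => //; rewrite -E.
have /dvdnP[k ->] : (e2 %| tau)%N by apply: dvdn_trans etau; apply: dvdn_mull.
by rewrite /annT mulnC mulrnA; apply: (subgMn _ (subg_Ann R)).
Qed.

Lemma subg_annT (R : naRingType) tau : is_subgroup (annT (R := R) tau).
Proof.
split=> [|x y hx hy]; rewrite /annT ?mul0rn ?mulrnBl; first exact: (subg0 (subg_Ann R)).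
exact: (subgB (subg_Ann R)).
Qed.

Lemma annT_coordinates (R : naRingType) tau : FDZ_algebra R -> torsion_exponent R tau ->
  exists d (v : {additive R -> 'rV[int]_d}),
    (forall w, exists x, v x = w) /\ forall x, v x = 0 <-> annT tau x.
Proof.
move=> hR [_ ht].
have [|d [b hb]] := FDZ_basis hR (@subg_setT R) (subg_annT R tau) (fun _ _ => I).
  by move=> x c _ c0; have [_] := ht x c c0.
have [v [_ vB v0 vl]] := coordinates (@subg_setT R) (subg_annT R tau) (fun _ _ => I) hb.
have [f fE] : exists f : {additive R -> 'rV[int]_d}, f =1 v.
  by apply: additive_of => x y; apply: vB.
exists d, f; split=> [w|x]; last by rewrite fE; apply: v0.
exists (lc b (w 0)); rewrite fE vl; apply/rowP => i; by rewrite mxE.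
Qed.

Lemma complete_family (R : naRingType) tau s (z : 'I_s -> R) :
  torsion_exponent R tau ->
  (forall x, exists2 E : int, E != 0 & exists c, x *~ E = lc z c) ->
  forall a, (forall i, tor tau (a ** z i) /\ tor tau (z i ** a)) -> annT tau a.
Proof.
move=> [_ ht] hz a ha y; have [E E0 [c Ec]] := hz y.
rewrite !pmulrn namulMzl namulMzr -!pmulrn; split.
  have [h _] := ht (a ** y) E E0; apply: h.
  rewrite -namulMzr Ec namul_lcr; apply: (subg_lc _ (subg_tor R tau)) => i.
  by have [] := ha i.
have [h _] := ht (y ** a) E E0; apply: h.
rewrite -namulMzl Ec namul_lcl; apply: (subg_lc _ (subg_tor R tau)) => i.
by have [] := ha i.
Qed.

Section Frame.
Variables (n tau r s : nat).
Notation coef := {ffun 'I_s -> int}.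
Variables (rels : seq coef) (tab : 'I_s -> 'I_s -> coef) (Cs : seq coef).
Variables (F : seq int) (xs : seq {ffun 'I_s -> coef}) (ks : 'I_r -> seq coef).
Variable (wf : {ffun 'I_s -> coef} -> coef -> coef).

Definition presentation (R : naRingType) (z : 'I_s -> R) :=
  (forall c, c \in rels -> lc z c = 0) /\
  (forall i j, z i ** z j = lc z (tab i j)) /\
  (forall x, exists y, exists2 c, c \in Cs & x = lc z c + y *+ n).

Definition scalar_roots (R : naRingType) (z : 'I_s -> R) :=
  (forall x, x \in xs -> scalar tau z (fun i => lc z (x i))) /\
  (forall u, scalar tau z u -> vanishes tau z F u ->
     exists2 x, x \in xs & nil_scalar tau r z (fun i => u i - lc z (x i))).

Definition layers (R : naRingType) (z : 'I_s -> R) := forall i : 'I_r,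
  (forall k, k \in ks i -> killed tau r i.+1 z (lc z k)) /\
  (forall a, killed tau r i.+1 z a -> covered tau r i z (ks i) a) /\
  (forall x, x \in xs -> forall k, k \in ks i ->
     act tau z (fun j => lc z (x j)) (lc z k) (lc z (wf x k))).

(** The whole condition on [z] that is transferred from one ring to the other:
    the coefficients of all the combinations of [z] that occur are fixed. *)
Definition frame (R : naRingType) (z : 'I_s -> R) :=
  presentation z /\ scalar_roots z /\ layers z.

Lemma def_frame : definable (I := void) (fun R _ => exists z : 'I_s -> R, frame z).
Proof.
apply: def_ex_tuple; pose z R (e : void + 'I_s -> R) j := e (inr j).
have dz : forall i, definable_term (fun R e => z R e i) by move=> i; apply: dterm_var.
apply: def_and; [|apply: def_and].
- apply: def_and; [|apply: def_and].
  + by apply: def_all_in => c; exact: (def_eq (dterm_lc c dz) (@dterm0 _)).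
  + apply: def_all_ord => i; apply: def_all_ord => j.
    exact: (def_eq (dtermM (dz i) (dz j)) (dterm_lc _ dz)).
  + apply: def_all; apply: def_ex; apply: def_ex_in => c.
    pose z' R (e : option (option (void + 'I_s)) -> R) j := e (Some (Some (inr j))).
    have dz' : forall i, definable_term (fun R e => z' R e i) by move=> i; apply: dterm_var.
    exact: (def_eq (dterm_var (Some None))
      (dtermD (dterm_lc c dz') (dtermMn n (dterm_var None)))).
- apply: def_and.
    apply: def_all_in => x; exact: (def_scalar tau dz (fun i => dterm_lc (x i) dz)).
  apply: def_all_tuple.
  pose z' R (e : (void + 'I_s) + 'I_s -> R) j := e (inl (inr j)).
  pose u R (e : (void + 'I_s) + 'I_s -> R) j := e (inr j).
  have dz' : forall i, definable_term (fun R e => z' R e i) by move=> i; apply: dterm_var.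
  have du : forall i, definable_term (fun R e => u R e i) by move=> i; apply: dterm_var.
  apply: def_imp; first exact: (def_scalar tau dz' du).
  apply: def_imp; first exact: (def_vanishes tau F dz' du).
  apply: def_ex_in => x.
  exact: (def_nil_scalar tau r dz' (fun i => dtermB (du i) (dterm_lc (x i) dz'))).
- apply: def_all_ord => i; apply: def_and; [|apply: def_and].
  + apply: def_all_in => k; exact: (def_killed tau r i.+1 dz (dterm_lc k dz)).
  + apply: def_all.
    pose z' R (e : option (void + 'I_s) -> R) j := e (Some (inr j)).
    have dz' : forall i, definable_term (fun R e => z' R e i) by move=> j; apply: dterm_var.
    apply: def_imp; first exact: (def_killed tau r i.+1 dz' (dterm_var None)).
    exact: (def_covered tau r i (ks i) dz' (dterm_var None)).
  + apply: def_all_in => x; apply: def_all_in => k.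
    exact: (def_act tau dz (fun j => dterm_lc (x j) dz) (dterm_lc k dz) (dterm_lc _ dz)).
Qed.

End Frame.

(** The nilpotent scalars are those with zero diagonal in the common
    triangular form; hence they form a group, and a product of [r] of them is
    zero. *)
Lemma nil_mx_chi (R : naRingType) tau d (v : {additive R -> 'rV[int]_d}) r :
  (forall w, exists x, v x = w) -> (forall x, v x = 0 <-> annT tau x) -> (d <= r)%N ->
  exists chi : 'M[int]_d -> 'I_d -> algC,
  [/\ forall M M', scalar_mx tau v M -> scalar_mx tau v M' ->
        forall i, chi (M - M') i = chi M i - chi M' i,
      forall M (F : seq int), scalar_mx tau v M -> pmx F M = 0 ->
        forall i, horner_rec (map intr F) (chi M i) = 0,
      forall M, nil_mx tau v r M <-> scalar_mx tau v M /\ forall i, chi M i = 0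
    & forall w, (forall M, M \in w -> nil_mx tau v r M) -> size w = r -> mxprod w = 0].
Proof.
move=> vsurj vker dr.
have sG := subg_scalar_mx vsurj vker.
have [chi [chiB chiF chi0]] := triangularization sG (@scalar_mx_comm _ _ _ v).
have nilP M : nil_mx tau v r M <-> scalar_mx tau v M /\ forall i, chi M i = 0.
  split=> [[hM E]|[hM h0]]; split=> //; last first.
    rewrite pmxXn; apply: chi0 => [M'|]; last by rewrite size_nseq.
    by move=> /nseqP[-> _].
  move=> i; have := chiF M _ hM E i; elim: (r) => [|k IH] /=.
    by move=> /eqP; rewrite mul0r add0r oner_eq0.
  by rewrite addr0 => /eqP; rewrite mulf_eq0 => /orP[/eqP/IH|/eqP].
exists chi; split=> // w hw sw; apply: chi0; last by rewrite sw.
by move=> M /hw/nilP.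
Qed.

Section FrameSpans.
Variables (S : naRingType) (tau d : nat) (v : {additive S -> 'rV[int]_d}).
Hypothesis vsurj : forall w, exists x, v x = w.
Hypothesis vker : forall x, v x = 0 <-> annT tau x.
Variables (r s : nat) (F : {poly int}) (t : seq 'M[int]_d).
Hypothesis dr : (d <= r)%N.
Hypothesis tG : scalar_mx tau v = span t.
Hypothesis tF : forall M, M \in t -> pmx F M = 0.
Variables (z : 'I_s -> S).
Hypothesis complete : forall a, (forall i, tor tau (a ** z i) /\ tor tau (z i ** a)) ->
  annT tau a.
Notation coef := {ffun 'I_s -> int}.
Variables (xs : seq {ffun 'I_s -> coef}) (ks : 'I_r -> seq coef).
Variable (wf : {ffun 'I_s -> coef} -> coef -> coef).

(** By induction on the layers: a scalar is an integral combination of the roots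
    [xs] plus a nilpotent scalar; the former maps the generators [ks i] of the
    layer into the span of [z], the latter into the previous layer. *)
Lemma frame_spans : scalar_roots tau r F xs z -> layers tau xs ks wf z ->
  forall a, exists c, annT tau (a - lc z c).
Proof.
move=> [xsG xsF] hl.
have [chi [_ _ _ nilprod]] := nil_mx_chi vsurj vker dr.
pose W : set S := [set a | exists c, annT tau (a - lc z c)].
have sA := subg_annT S tau.
have sW : is_subgroup W.
  split; first by exists (fun=> 0); rewrite lc0 subr0; apply: (subg0 sA).
  move=> a b [c hc] [c' hc']; exists (fun i => c i - c' i).
  rewrite lcB (_ : _ - _ = (a - lc z c) - (b - lc z c')); first exact: (subgB sA).
  by rewrite !opprD !opprK addrACA.
have AW a : annT tau a -> W a.
  by move=> ha; exists (fun=> 0); rewrite lc0 subr0.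
have lcW c : W (lc z c) by exists c; rewrite subrr; apply: (subg0 sA).
suff H i : (i <= r)%N -> forall a, killed tau r i z a -> W a.
  move=> a; apply: (H r (leqnn r)); apply/(killedP vsurj vker complete) => w sw hw.
  by rewrite nilprod // mulmx0.
elim: i => [|i IH] ir a; first exact: AW.
have [kK [kC kA]] := hl (Ordinal ir).
have genW k M b : k \in ks (Ordinal ir) -> scalar_mx tau v M ->
    v b = v (lc z k) *m M -> W b.
  move=> kk hM; move: b.
  have sH : is_subgroup [set M | forall b, v b = v (lc z k) *m M -> W b].
    split=> [b|M1 M2 h1 h2 b]; first by rewrite mulmx0 => /vker/AW.
    have [b1 Eb1] := vsurj (v (lc z k) *m M1); rewrite mulmxBr => E.
    rewrite -[b](subKr b1); apply: subgB => //; first exact: h1.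
    by apply: h2; rewrite raddfB /= E Eb1 opprB addrC subrK.
  rewrite tG in hM; apply: (span_min sH) hM => M1 tM1 b Eb.
  have hM1 : scalar_mx tau v M1 by rewrite tG; apply: mem_span.
  have [u hu ru] := scalar_mx_lift vsurj vker complete hM1.
  have [|x xx hx] := xsF u hu; first by apply/(vanishesP vsurj vker _ ru)/tF.
  have [M2 _ r2] := scalar_represents vsurj vker complete (xsG x xx).
  have Ew := (r2 _ _).1 (kA x xx k kk).
  rewrite -[b](subrK (lc z (wf x k))); apply: subgD => //; apply: IH (ltnW ir) _ _.
  apply: (kK k kk _ hx).
  apply/(represents_sub vsurj vker complete ru r2).
  by rewrite raddfB /= Eb Ew mulmxBr.
have covW l : (forall k, k \in l -> k \in ks (Ordinal ir)) ->
    forall a', covered tau r i z l a' -> W a'.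
  elim: l => [|k l IHl] kl a'; first exact: IH (ltnW ir) _.
  move=> [u [b [hu [hb hab]]]]; rewrite -[a'](subrK b); apply: subgD => //.
    by apply: IHl hab => k' k'l; apply: kl; rewrite inE k'l orbT.
  have [M hM rM] := scalar_represents vsurj vker complete hu.
  by apply: (genW k M) => //; [apply: kl; rewrite mem_head | apply/rM].
by move=> /kC; apply: covW.
Qed.

End FrameSpans.

(** A polynomial has finitely many roots in a field, so there are only
    finitely many possible diagonals for the matrices that it kills. *)
Lemma chi_roots (d : nat) (F : {poly int}) : F != 0 ->
  exists (J : finType) (code : ('I_d -> algC) -> J), forall f g : 'I_d -> algC,
    (forall i, horner_rec (map intr F) (f i) = 0) ->
    (forall i, horner_rec (map intr F) (g i) = 0) -> code f = code g -> f = g.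
Proof.
move=> F0; pose p : {poly algC} := map_poly intr F.
have p0 : p != 0.
  apply/eqP => /polyP/(_ (size F).-1); rewrite coef0 coef_map /= => /eqP.
  by rewrite intr_eq0 -[_ == 0]/(lead_coef F == 0) lead_coef_eq0 (negPf F0).
have [rts Erts] := closed_field_poly_normal p.
have mem_rts x : horner_rec (map intr F) x = 0 -> x \in rts.
  move=> E; have : root p x by rewrite /root /p map_polyE horner_Poly E.
  by rewrite Erts rootZ ?lead_coef_eq0 // root_prod_XsubC.
exists {ffun 'I_d -> 'I_(size rts).+1}, (fun f => [ffun i => inord (index (f i) rts)]).
move=> f g hf hg /ffunP E; apply/funext => i; have := E i; rewrite !ffunE.
move=> /(congr1 val) /=; rewrite !inordK ?ltnS ?index_size // => Ei.
by rewrite -(nth_index 0 (mem_rts _ (hf i))) Ei nth_index // mem_rts.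
Qed.

Lemma lc_ffun (G : zmodType) s (y : 'I_s -> G) (c : 'I_s -> int) : lc y [ffun i => c i] = lc y c.
Proof. by apply: eq_bigr => i _; rewrite ffunE. Qed.

Lemma relations_fg (G : zmodType) s (y : 'I_s -> G) :
  exists rels : seq {ffun 'I_s -> int}, (forall c, c \in rels -> lc y c = 0) /\
    forall (H : zmodType) (z : 'I_s -> H), (forall c, c \in rels -> lc z c = 0) ->
      forall c, lc y c = 0 -> lc z c = 0.
Proof.
have [T TT] := mx_span 1 s.
have sK (H : zmodType) (z : 'I_s -> H) : is_subgroup [set w : 'rV[int]_s | lc z (w 0) = 0].
  split=> [|w w'] /=; first by rewrite [LHS]big1 // => i _; rewrite mxE mulr0z.
  have -> : (w - w') 0 = (fun i => w 0 i - w' 0 i) by apply/funext => i; rewrite !mxE.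
  by rewrite lcB => -> ->; rewrite subrr.
have [|t Et] := subgroup_fg (t := T) (sK G y); first by rewrite TT.
exists [seq [ffun i => (w : 'rV_s) 0 i] | w <- t]; split=> [_ /mapP[w wt ->]|H z hz c hc].
  rewrite lc_ffun; suff : [set w : 'rV[int]_s | lc y (w 0) = 0] w by [].
  by rewrite Et; apply: mem_span.
have rowE (K : zmodType) (x : 'I_s -> K) : lc x ((\row_i c i) 0) = lc x c.
  by apply: eq_bigr => i _; rewrite mxE.
have : span t (\row_i c i) by rewrite -Et /= rowE.
rewrite -[in X in _ -> X]rowE; apply: (span_min (sK H z)) => w wt /=.
by rewrite -lc_ffun; apply: hz; apply: map_f.
Qed.

Section FrameExists.
Variables (R : naRingType) (tau d : nat) (v : {additive R -> 'rV[int]_d}).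
Hypothesis hR : FDZ_algebra R.
Hypothesis ht : torsion_exponent R tau.
Hypothesis vsurj : forall w, exists x, v x = w.
Hypothesis vker : forall x, v x = 0 <-> annT tau x.
Variables (n r : nat) (F : {poly int}).
Hypotheses (n0 : (0 < n)%N) (dr : (d <= r)%N) (F0 : F != 0).

(** As [y] generates [R] over the integers, the scalars needed in [covered]
    can be taken to be integers. *)
Lemma frame_exists : exists s rels tab Cs xs ks wf (y : 'I_s -> R),
  [/\ @frame n tau r s rels tab Cs F xs ks wf R y,
      forall x, exists c : {ffun 'I_s -> int}, x = lc y c
    & forall (H : zmodType) (z : 'I_s -> H), (forall c, c \in rels -> lc z c = 0) ->
        forall c, lc y c = 0 -> lc z c = 0].
Proof.
have [s [y hy]] := hR.
have /choice[co hco] : forall x, exists c : {ffun 'I_s -> int}, x = lc y c.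
  by move=> x; have [c ->] := hy x; exists [ffun i => c i]; rewrite lc_ffun.
have complete := complete_family ht
  (fun x => ex_intro2 _ _ 1 (oner_neq0 _) (ex_intro _ (co x : 'I_s -> int) (hco x))).
have [rels [relsy relsz]] := relations_fg y.
have [chi [chiB chiF nilP nilprod]] := nil_mx_chi vsurj vker dr.
have [J [code hcode]] := chi_roots d F0.
have [Ms [MsA Mscode]] := finite_reps
  [set M | scalar_mx tau v M /\ pmx F M = 0] (fun M => code (chi M)).
have /choice[X hX] : forall M, exists x : {ffun 'I_s -> {ffun 'I_s -> int}},
    scalar_mx tau v M -> represents tau v y (fun i => lc y (x i)) M.
  move=> M; have [hM|nM] := pselect (scalar_mx tau v M); last by exists [ffun => 0].
  have [u _ ru] := scalar_mx_lift vsurj vker complete hM.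
  exists [ffun i => co (u i)] => _.
  by rewrite (_ : (fun i => _) = u) //; apply/funext => i; rewrite ffunE -hco.
have /choice[l hl] : forall i : 'I_r, exists l, killed tau r i.+1 y = span l.
  by move=> i; exact: (FDZ_subgroup_fg hR (subg_killed vsurj vker complete r i.+1)).
have /choice[wf hwf] : forall xk : {ffun 'I_s -> {ffun 'I_s -> int}} * {ffun 'I_s -> int},
    exists w : {ffun 'I_s -> int}, scalar tau y (fun i => lc y (xk.1 i)) ->
      act tau y (fun i => lc y (xk.1 i)) (lc y xk.2) (lc y w).
  move=> [x k] /=; have [[[hx _] _]|nx] := pselect (scalar tau y (fun i => lc y (x i)));
    last by exists 0.
  by have [b hb] := hx (lc y k); exists (co b); rewrite -hco.
have scalarX M : M \in Ms -> scalar tau y (fun i => lc y (X M i)).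
  by move=> /MsA[hM _]; apply/(scalarP vsurj vker complete (hX M hM)).
have covered_span i t a : span t a -> covered tau r i y (map co t) a.
  elim: t a => [|g t IH] a /=.
    by move=> ->; apply: (subg0 (subg_killed vsurj vker complete r i)).
  move=> [c /IH hc]; exists (fun i => y i *~ c), (g *~ c); split; last split => //.
    apply/(scalarP vsurj vker complete (represents_scalar vsurj vker complete c)).
    exact: (scalar_mxZ vker c).
  rewrite -hco; apply/(represents_scalar vsurj vker complete c).
  by rewrite raddfMz /= mul_mx_scalar -scaler_int intz.
exists s, rels, (fun i j => co (y i ** y j)),
  (codom (fun f : {ffun 'I_s -> 'I_n} => [ffun i => (f i : nat)%:Z])),
  (map X Ms), (fun i => map co (l i)), (fun x k => wf (x, k)), y.
split=> //; last by move=> x; exists (co x).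
split; [split=> //; split|split].
- by move=> i j; rewrite -hco.
- move=> x; exists (lc y (fun i => (co x i %/ n%:Z)%Z)).
  have n0' : n%:Z != 0 by rewrite eqz_nat -lt0n.
  have /choice[f hf] : forall i, exists k : 'I_n, (k : nat)%:Z = (co x i %% n%:Z)%Z.
    move=> i; have m0 : 0 <= (co x i %% n%:Z)%Z := modz_ge0 _ n0'.
    have mn : (`|(co x i %% n%:Z)%Z| < n)%N by rewrite -ltz_nat gez0_abs // ltz_pmod.
    by exists (Ordinal mn) => /=; rewrite gez0_abs.
  exists [ffun i => (([ffun i => f i] : {ffun 'I_s -> 'I_n}) i : nat)%:Z].
    exact: (codom_f (fun f : {ffun 'I_s -> 'I_n} => [ffun i => (f i : nat)%:Z])).
  rewrite pmulrn -lcM -lcD {1}[x]hco; apply: eq_bigr => i _; congr (_ *~ _).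
  by rewrite !ffunE hf addrC -divz_eq.
- split=> [_ /mapP[M MMs ->]|u hu hF]; first exact: scalarX.
  have [M hM ru] := scalar_represents vsurj vker complete hu.
  have pM : pmx F M = 0 by apply/(vanishesP vsurj vker _ ru).
  have [M' M'Ms E] := Mscode M (conj hM pM); have [hM' pM'] := MsA _ M'Ms.
  exists (X M'); first exact: map_f.
  apply/(nil_scalarP vsurj vker complete r (represents_sub vsurj vker complete ru (hX _ hM'))).
  apply/nilP; split=> [|i]; first exact: (subgB (subg_scalar_mx vsurj vker)).
  by rewrite chiB // (hcode _ _ (chiF _ _ hM' pM') (chiF _ _ hM pM) E) subrr.
- move=> i; split=> [_ /mapP[g gl ->]|]; first by rewrite -hco hl; apply: mem_span.
  split=> [a|_ /mapP[M MMs ->] k _]; first by rewrite hl; apply: covered_span.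
  exact: (hwf (X M, k) (scalarX M MMs)).
Qed.

End FrameExists.

(** The polynomial [F] comes from [S] and all the other data from [R]: the
    scalar matrices of [S] do not depend on the family [z], so that [F] is
    known before the sentence is formed. Once the sentence is transferred,
    the roots of [F] include generators of the scalars of [S]. *)
Lemma almost_onto_morphism (R S : naRingType) n : FDZ_algebra R -> FDZ_algebra S ->
  elem_equiv R S -> (0 < n)%N ->
  exists phi : {additive R -> S}, [/\ na_multiplicative phi,
    forall y, exists x, Ann S (y - phi x) & forall y, exists x z, y = phi x + z *+ n].
Proof.
move=> hR hS RS n0.
have [eR eR0 hRt] := torsion_exponent_exists hR.
have [eS eS0 hSt] := torsion_exponent_exists hS.
(* The factor 2 makes the modulus greater than 1, and [tau] multiplies [annT]
   into the annihilator. *)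
pose tau := (eR * eS)%N; have tau0 : (0 < tau)%N by rewrite muln_gt0 eR0.
have tR := hRt tau tau0 (dvdn_mulr _ (dvdnn _)).
have tS := hSt tau tau0 (dvdn_mull _ (dvdnn _)).
have [dR [vR [vRs vRk]]] := annT_coordinates hR tR.
have [dS [vS [vSs vSk]]] := annT_coordinates hS tS.
pose r := maxn dR dS; pose N := (2 * n * tau)%N.
have N0 : (0 < N)%N by rewrite muln_gt0 tau0 andbT muln_gt0 n0.
have [T TT] := mx_span dS dS.
have [|t Et] := subgroup_fg (t := T) (subg_scalar_mx vSs vSk); first by rewrite TT.
have [F F0 Ft] := annihilating_poly t.
have [s [rels [tab [Cs [xs [ks [wf [y [hy ygen yrel]]]]]]]]] :=
  frame_exists hR tR vRs vRk N0 (leq_maxl dR dS) F0.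
have [z [[zrel [ztab zN]] [zroots zlayers]]] :
    exists z : 'I_s -> S, frame N tau rels tab Cs F xs ks wf z.
  by apply: (definable_sentence (def_frame N tau rels tab Cs F xs ks wf) RS); exists y.
have /choice[co hco] := ygen.
have coE c c' : lc y c = lc y c' -> lc z c = lc z c'.
  move=> /eqP; rewrite -subr_eq0 -lcB => /eqP /(yrel _ z zrel).
  by rewrite lcB => /eqP; rewrite subr_eq0 => /eqP.
have [phi phiE] : exists phi : {additive R -> S}, phi =1 (fun x => lc z (co x)).
  apply: additive_of => x x'; rewrite -lcB; apply: coE.
  by rewrite lcB -!hco.
have phi_lc c : phi (lc y c) = lc z c by rewrite phiE; apply: coE; rewrite -hco.
have phiM : na_multiplicative phi.
  move=> x x'; rewrite [x]hco [x']hco !phi_lc.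
  have prodE (Q : naRingType) (g : 'I_s -> Q) : (forall i j, g i ** g j = lc g (tab i j)) ->
      lc g (co x) ** lc g (co x')
      = lc g (fun l => \sum_i (\sum_j tab i j l * co x' j) * co x i).
    move=> gtab; rewrite namul_lcl -lc_lc; apply: eq_bigr => i _; congr (_ *~ _).
    rewrite namul_lcr -lc_lc; apply: eq_bigr => j _; congr (_ *~ _).
    by rewrite gtab.
  have [_ [ytab _]] := hy.1.
  by rewrite !prodE // phi_lc.
have zgen x : exists x' x'', x = phi x' + x'' *+ N.
  by have [x'' [c _ ->]] := zN x; exists (lc y c), x''; rewrite phi_lc.
have complete : forall a, (forall i, tor tau (a ** z i) /\ tor tau (z i ** a)) -> annT tau a.
  apply: (complete_family tS) => x; have [t' t'T] := FDZ_span hS.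
  have N2 : (2 <= N)%N by rewrite /N -mulnA leq_pmulr // muln_gt0 n0.
  have [E E0 [_ HE]] := onto_modulo_exponent t'T N2 zgen.
  by exists E => //; have [a <-] := HE x; exists (co a); rewrite phiE.
have span := frame_spans vSs vSk (leq_maxr dR dS) Et Ft complete zroots zlayers.
exists phi; split=> // [x|x].
  have [x1 [x2 E]] := zgen x; have [c hc] := span x2.
  exists (x1 + lc y c *+ N); rewrite E raddfD raddfMn /= phi_lc opprD addrA.
  rewrite [phi x1 + _ - _]addrAC subrr add0r -mulrnBl /N mulnC mulrnA.
  by apply: (subgMn _ (subg_Ann S)).
have [x1 [x2 E]] := zgen x; exists x1, (x2 *+ (2 * tau)).
by rewrite -mulrnA mulnAC.
Qed.

(** * Morphisms in both directions *)

(** The kernels of the iterates of [h] form an ascending chain, which stops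
    because subgroups are finitely generated. If it stops at [i] and [E]
    multiplies the group into the image of [h], then [E ^ i] kills the kernel of
    [h]. As [E] is 1 modulo [n], and [n] kills the torsion, the kernel is zero. *)
Lemma endo_injective (R : naRingType) (h : {additive R -> R}) (n : nat) :
  FDZ_algebra R -> (2 <= n)%N -> (forall y, exists x z, y = h x + z *+ n) ->
  (forall x : R, Is [set (0 : R)] x -> x *+ n = 0) -> injective h.
Proof.
move=> hR n2 hn htor; have [t tT] := FDZ_span hR.
have [E E0 [[q EE] Hq]] := onto_modulo_exponent tT n2 hn.
have iterB i x y : iter i h (x - y) = iter i h x - iter i h y.
  by elim: i => //= i ->; rewrite raddfB.
have iter0 i : iter i h 0 = 0 by elim: i => //= i ->; rewrite raddf0.
have iterle i j x : (i <= j)%N -> iter i h x = 0 -> iter j h x = 0.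
  by move=> ij Ex; rewrite -(subnK ij) iterD Ex iter0.
pose U : set R := [set x | exists i, iter i h x = 0].
have sU : is_subgroup U.
  split=> [|x y [i Ex] [j Ey]]; first by exists 0%N.
  exists (maxn i j); rewrite iterB (iterle i) ?leq_maxl // (iterle j) ?leq_maxr //.
  by rewrite subrr.
have [u Uu] := FDZ_subgroup_fg hR sU.
have [i Ui] : exists i, forall x, x \in u -> iter i h x = 0.
  have : forall x, x \in u -> U x by move=> x xu; rewrite Uu; apply: mem_span.
  elim: u {Uu} => [|x u IH] H; first by exists 0%N.
  have [|i Hi] := IH; first by move=> y yu; apply: H; rewrite inE yu orbT.
  have [|j Hj] := H x; first exact: mem_head.
  exists (maxn i j) => y; rewrite inE => /orP[/eqP->|/Hi Ey].
    by apply: iterle Hj; apply: leq_maxr.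
  by apply: iterle Ey; apply: leq_maxl.
have {}Ui x : U x -> iter i h x = 0.
  rewrite Uu => ux; apply: (span_min (t := u) (H := [set x | iter i h x = 0])) ux => //.
  by split=> [|a b] /=; rewrite ?iter0 // iterB => -> ->; rewrite subrr.
have hit j x : exists y, iter j h y = x *~ (E ^+ j).
  elim: j => [|j [y Ey]]; first by exists x.
  have [w Ew] := Hq y; exists w; rewrite iterSr Ew exprSr mulrzA -Ey.
  have [g gE] : exists g : {additive R -> R}, g =1 iter j h.
    by apply: additive_of => a b; rewrite iterB.
  by rewrite -!gE raddfMz.
apply: raddf_inj => x hx.
have [y Ey] := hit i x.
have : iter i h y = 0.
  apply: Ui; exists i.+1; rewrite iterS Ey.
  by rewrite raddfMz /= hx mul0rz.
rewrite Ey => Ex; have xn : x *+ n = 0.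
  by apply: htor; exists (E ^+ i) => //; rewrite expf_neq0.
have [w Ew] : exists w, E ^+ i = 1 + n%:Z * w.
  elim: (i) => [|j [w Ew]]; first by exists 0; rewrite mulr0 addr0.
  by exists (w + q + n%:Z * w * q); rewrite exprSr Ew EE; ring.
move: Ex; rewrite Ew mulrzDr mulr1z mulrzA -pmulrn xn mul0rz.
by rewrite addr0.
Qed.

Theorem theorem1p5 (R S : naRingType)
  (hR : FDZ_algebra R) (hS : FDZ_algebra S) :
  elem_equiv R S <->
  (MR R = NR R /\ ring_isomorphic R S) \/
  (exists (phi : {additive R -> S}) (R0 : set R) (S0 : set S),
     [/\ ring_monomorphism phi, is_addition R0 & is_addition S0] /\
     [/\ induces_iso phi setT R0 setT S0,
         induces_iso phi (MR R) (NR R) (MR S) (NR S)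
       & phi @` R0 `<=` S0 /\
         exists k m : nat,
           [/\ has_index S0 (phi @` R0) k, has_index (MR R) (NR R) m,
               coprime k m & m <> 1%N]]).
Proof.
split; last first.
  move=> [[_ iso]|[phi [R0 [S0 [[mono aR0 aS0] [iso _ [phiR0 [k [m [ik im km _]]]]]]]]]].
    exact: iso_elem_equiv.
  exact: embedding_elem_equiv hR hS mono aR0 aS0 iso phiR0 ik im km.
move=> RS.
have [m im] : exists m, has_index (MR R) (NR R) m.
  have [t tM] := FDZ_subgroup_fg hR (subg_MR R).
  have [e e0 He] := Is_exponent hR (subg_NR R).
  have [|m im _] := finite_index (t := t) (subg_NR R) e0.
    by move=> x /mem_span; rewrite -tM => /MR_Is_NR/He.
  exists m; rewrite (_ : set_sum (span t) _ = MR R) // in im; rewrite -tM.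
  apply/seteqP; split=> [_ [x Mx [y /NR_MR My <-]]|x Mx].
    exact: (subgD (subg_MR R)).
  by exists x => //; exists 0; [exact: (subg0 (subg_NR R)) | rewrite addr0].
have m0 : (0 < m)%N by apply: has_index_gt0 (subg_MR R) (subg_NR R) im.
have [e2 e20 H2] := Is_exponent hS (subg_Sq S).
have [e3 e30 H3] := Is_exponent hR (@subg_set0 R).
(* [m] for the coprimality of the indices, [e2] and [e3] to multiply the
   isolator of the square of [S] into the square and to kill the torsion of [R]. *)
pose n := (2 * m * e2 * e3)%N.
have n2 : (2 <= n)%N by rewrite /n -!mulnA leq_pmulr // !muln_gt0 m0 e20.
have n0 : (0 < n)%N := ltnW n2.
have [phi [phiM genA genn]] := almost_onto_morphism hR hS RS n0.
have SR : elem_equiv S R by move=> f sf; apply: iff_sym; apply: RS.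
have [psi [_ _ genn']] := almost_onto_morphism hS hR SR n0.
have hI : injective (psi \o phi).
  apply: (@endo_injective _ (psi \o phi) n hR n2) => [y|x /H3 /= E].
    have [s [r ->]] := genn' y; have [r' [s' ->]] := genn s.
    exists r', (psi s' + r); rewrite raddfD raddfMn /= mulrnDl addrA.
    by [].
  by rewrite /n mulnC mulrnA E mul0rn.
have phiI : injective phi by move=> x y E; apply: hI; rewrite /= E.
apply: (almost_onto_conclusion hR hS phiM phiI genA genn n2 _ im).
  by rewrite /n -mulnA mulnAC dvdn_mull.
move=> x /H2 hx; rewrite /n (_ : 2 * m * e2 * e3 = e2 * (2 * m * e3))%N; last by lia.
by rewrite mulrnA; apply: (subgMn _ (subg_Sq S)).
Qed.
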